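(* Let $\mathcal C\subset\mathbb R^n\setminus\{0\}$ be an open, non-empty, convex cone and let $\Omega\subset\mathbb R^n$ be open, non-empty and bounded. Let $W\subset(\mathbb R^n\setminus\overline\Omega)\cap\mathcal C(\Omega)$ be open. Let $s\in(0,1)$, let $q\in L^\infty(\Omega)$ be real-valued, and let $L(D)+q$ be a self-adjoint elliptic operator (in the sense specified in the context) for which the Dirichlet problem $$(L(D)+q)u=0\ \text{ in }\Omega,\qquad u=f\ \text{ on }\mathcal C(\Omega)\setminus\overline\Omega$$ is well-posed and gives rise to a well-defined Poisson operator $P_q:H^s(\mathcal C(\Omega)\setminus\overline\Omega)\to H^s(\mathcal C(\Omega))$, $f\mapsto u$. Then the following are equivalent: (a) The set $\mathcal R:=\{P_q(f)|_\Omega:\ f\in C_c^\infty(W)\}$ is dense in $\widetilde H^s(\Omega)$. (b) If $w\in\widetilde H^s(\Omega)$ (weakly) solves $$(L(D)+q)w=v\ \text{ in }\Omega,\qquad w=0\ \text{ in }\mathcal C(\Omega)\setminus\overline\Omega,$$ for some $v\in H^{-s}(\Omega)$, and $L(D)w=0$ in $W$, then $v\equiv0$ and hence $w\equiv0$ in $\mathcal C(\Omega)$.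
   Context: All functions are real-valued. A cone is a set closed under multiplication by $t>0$; $\mathcal C(\Omega):=\Omega+(-\mathcal C\cup\mathcal C)$. Sobolev spaces: $H^s(\mathbb R^n)$ is the usual $L^2$-based space; for open $U$, $H^s(U)$ is the space of restrictions to $U$ of elements of $H^s(\mathbb R^n)$ with the quotient norm; $\widetilde H^s(U)$ is the closure of $C_c^\infty(U)$ in $H^s(\mathbb R^n)$; $H^{-s}(\Omega)$ is the dual of $\widetilde H^s(\Omega)$, with pairing $\langle\cdot,\cdot\rangle$. For $u$ defined on $U$, $\mathcal E_Uu$ is its extension by zero. Self-adjoint elliptic operator: $L(D)$ is the Fourier multiplier with a real, even symbol $L(\xi)$ satisfying $\lambda^{-1}|\xi|^{2s}\le L(\xi)\le\lambda|\xi|^{2s}$ for some $\lambda\geq 1$, with form $\tilde B_q(u,v)=\langle L(D)u,v\rangle+\int_\Omega quv\,dx$ for $u,v\in H^s(\mathbb R^n)$. So that the Dirichlet problem is meaningful for functions on $\mathcal C(\Omega)$ only, $L(D)$ has the domain of dependence property: $\langle L(D)w,v\rangle=0$ whenever $w\in H^s(\mathbb R^n)$ vanishes on $\mathcal C(\Omega)$ and $v\in\widetilde H^s(\Omega)$. Consequently, for $u\in H^s(\mathcal C(\Omega))$ and $v\in\widetilde H^s(\Omega)$ the value $B_q(u,v):=\tilde B_q(\tilde u,v)$ is independent of the extension $\tilde u\in H^s(\mathbb R^n)$ of $u$. Weak solution of the exterior problem with datum $f\in H^s(\mathcal C(\Omega)\setminus\overline\Omega)$: $u\in H^s(\mathcal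 C(\Omega))$ with $B_q(u,v)=0$ for all $v\in\widetilde H^s(\Omega)$ and $\mathcal E_{\mathcal C(\Omega)}(u-\tilde f)\in\widetilde H^s(\Omega)$ for any $\tilde f\in H^s(\mathcal C(\Omega))$ with $\tilde f|_{\mathcal C(\Omega)\setminus\overline\Omega}=f$. Well-posedness means that for each $f$ there is a unique weak solution $u=:P_qf$, with $\|u\|_{H^s(\mathcal C(\Omega))}\le C\|f\|_{H^s(\mathcal C(\Omega)\setminus\overline\Omega)}$. $P_q(f)|_\Omega$ is identified with its extension by zero outside $\Omega$, which belongs to $\widetilde H^s(\Omega)$ for $f\in C_c^\infty(W)$. In (b), the weak equation means $\tilde B_q(w,\varphi)=\langle v,\varphi\rangle$ for all $\varphi\in\widetilde H^s(\Omega)$, and $L(D)w=0$ in $W$ means $\langle L(D)w,\varphi\rangle=0$ for all $\varphi\in C_c^\infty(W)$. *)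

(* Defs.v *)
From HB Require Import structures.
From mathcomp Require Import all_boot all_order all_algebra.
From mathcomp Require Import all_classical all_reals all_analysis.

Set Implicit Arguments.
Unset Strict Implicit.
Unset Printing Implicit Defensive.

Import Order.TTheory GRing.Theory Num.Theory.
Import numFieldNormedType.Exports.

Local Open Scope classical_set_scope.
Local Open Scope ring_scope.

(* R^n is 'rV[R]_n.  As for the library's tuples, the sigma-algebra is generated
   by the coordinates; it is the Borel sigma-algebra.  *)

Definition rV_display : measure_display.
Proof. exact: default_measure_display. Qed.

Section measurable_rV.
Context {R : realType} (n : nat).

Definition rV_coord (i : 'I_n) (x : 'rV[R]_n) : R := x ord0 i.

Let rV_set0 : g_sigma_preimage rV_coord set0.
Proof. exact: sigma_algebra0. Qed.

Let rV_setC A : g_sigma_preimage rV_coord A -> g_sigma_preimage rV_coord (~` A).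
Proof. exact: sigma_algebraC. Qed.

Let rV_bigcup (F : _^nat) : (forall i, g_sigma_preimage rV_coord (F i)) ->
  g_sigma_preimage rV_coord (\bigcup_i (F i)).
Proof. exact: sigma_algebra_bigcup. Qed.

HB.instance Definition _ := @isMeasurable.Build rV_display
  'rV[R]_n (g_sigma_preimage rV_coord) rV_set0 rV_setC rV_bigcup.

Lemma measurable_rV_coord (i : 'I_n) : measurable_fun setT (rV_coord i).
Proof.
move=> _ Y mY; rewrite setTI; apply: sub_sigma_algebra => /=.
rewrite -bigcup_seq/=; exists i => /=; first by rewrite mem_index_enum.
by exists Y => //; rewrite setTI.
Qed.

Lemma measurable_rV d (T : measurableType d) (f : T -> 'rV[R]_n) :
  (forall i, measurable_fun setT (rV_coord i \o f)) -> measurable_fun setT f.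
Proof.
move=> mf; suff sub : g_sigma_preimage (fun i => rV_coord i \o f) `<=` measurable.
  move=> _ A mA; apply: sub.
  by rewrite g_sigma_preimage_comp; exists A.
apply: smallest_sub; first exact: sigma_algebra_measurable.
rewrite -bigcup_seq; apply: bigcup_sub => i _ A [B mB <-].
exact: mf.
Qed.

End measurable_rV.

Section lebesgue_rV.
Context {R : realType}.

Definition cons_rV n (p : measurableTypeR R * 'rV[R]_n) : 'rV[R]_n.+1 :=
  \row_i oapp (p.2 ord0) p.1 (unlift ord0 i).

Definition uncons_rV n (x : 'rV[R]_n.+1) : measurableTypeR R * 'rV[R]_n :=
  (x ord0 ord0, \row_i x ord0 (lift ord0 i)).

Lemma cons_rVK n : cancel (@cons_rV n) (@uncons_rV n).
Proof.
case=> a x; rewrite /uncons_rV/= mxE unlift_none/=; congr (_, _).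
by apply/rowP => i; rewrite !mxE liftK.
Qed.

Lemma measurable_cons_rV n : measurable_fun setT (@cons_rV n).
Proof.
apply: measurable_rV => i; case: (unliftP ord0 i) => [j ->|->].
- rewrite (_ : _ \o _ = rV_coord j \o snd); last first.
    by apply/funext => p; rewrite /= /rV_coord mxE liftK.
  by apply: measurableT_comp => //; exact: measurable_rV_coord.
- rewrite (_ : _ \o _ = fst); last first.
    by apply/funext => p; rewrite /= /rV_coord mxE unlift_none.
  exact: measurable_fst.
Qed.

Lemma measurable_uncons_rV n : measurable_fun setT (@uncons_rV n).
Proof.
apply/measurable_fun_pairP; split; first exact: (measurable_rV_coord ord0).
apply: measurable_rV => i.
rewrite (_ : _ \o _ = rV_coord (lift ord0 i)); last first.
  by apply/funext => x; rewrite /= /rV_coord mxE.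
exact: measurable_rV_coord.
Qed.

(* Lebesgue measure is built by induction on the dimension: the product with the
   Lebesgue measure of the line is transported to row vectors by cons_rV.  *)

Section step.
Variables (n : nat) (m : {sigma_finite_measure set 'rV[R]_n -> \bar R}).
Local Open Scope ereal_scope.

Definition lebesgue_step : set 'rV[R]_n.+1 -> \bar R :=
  pushforward (lebesgue_measure \x m) (@cons_rV n).

Let step0 : lebesgue_step set0 = 0.
Proof. by rewrite /lebesgue_step/pushforward preimage_set0 measure0. Qed.

Let step_ge0 A : 0 <= lebesgue_step A.
Proof. by rewrite /lebesgue_step/pushforward measure_ge0. Qed.

Let mpre A : measurable A -> measurable (@cons_rV n @^-1` A).
Proof. by move=> mA; rewrite -[X in measurable X]setTI; exact: measurable_cons_rV. Qed.

Let step_sigma_additive : semi_sigma_additive lebesgue_step.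
Proof.
move=> F mF tF mUF; rewrite /lebesgue_step/pushforward preimage_bigcup.
apply: measure_semi_sigma_additive.
- by move=> i; exact: mpre.
- apply/trivIsetP => /= i j _ _ ij; rewrite -preimage_setI.
  by move/trivIsetP : tF => /(_ _ _ _ _ ij) ->//; rewrite preimage_set0.
- by rewrite -preimage_bigcup; exact: mpre.
Qed.

HB.instance Definition _ := isMeasure.Build _ _ _ lebesgue_step
  step0 step_ge0 step_sigma_additive.

Let step_sigma_finite : sigma_finite setT lebesgue_step.
Proof.
have /sigma_finiteP[F [TF ndF Foo]] := sigma_finiteT (@lebesgue_measure R).
have /sigma_finiteP[G [TG ndG Goo]] := sigma_finiteT m.
exists (fun k => @uncons_rV n @^-1` (F k `*` G k)).
  apply/esym; rewrite -subTset => x _.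
  have : (\bigcup_k F k) (uncons_rV x).1 by rewrite -TF.
  have : (\bigcup_k G k) (uncons_rV x).2 by rewrite -TG.
  move=> [j _ Gj] [i _ Fi]; exists (maxn i j) => //; split.
  - by move: Fi; apply/subsetPset/ndF/leq_maxl.
  - by move: Gj; apply/subsetPset/ndG/leq_maxr.
move=> k; have [mF Foo'] := Foo k; have [mG Goo'] := Goo k; split.
  rewrite -[X in measurable X]setTI; apply: measurable_uncons_rV => //.
  exact: measurableX.
rewrite /lebesgue_step/pushforward -comp_preimage.
rewrite (_ : _ \o _ = id); last by apply/funext => p; exact: cons_rVK.
by rewrite preimage_id product_measure1E// lte_mul_pinfty// ge0_fin_numE.
Qed.

HB.instance Definition _ := Measure_isSigmaFinite.Build _ _ _
  lebesgue_step step_sigma_finite.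

End step.

Fixpoint lebesgue_rV n : {sigma_finite_measure set 'rV[R]_n -> \bar R} :=
  if n is n'.+1 then lebesgue_step (lebesgue_rV n')
  else dirac (0 : 'rV[R]_0).

Lemma measurable_box n (A : 'I_n -> set R) : (forall i, measurable (A i)) ->
  measurable [set x : 'rV[R]_n | forall i, A i (x ord0 i)].
Proof.
move=> mA; rewrite (_ : mkset _ = \bigcap_i (rV_coord i @^-1` A i)); last first.
  by apply/seteqP; split => x /= Ax i; [move=> _; exact: Ax|exact: (Ax i I)].
apply: fin_bigcap_measurable => [|i _]; first exact: (@finite_finset _ setT).
rewrite -[X in measurable X]setTI; exact: measurable_rV_coord.
Qed.

Lemma lebesgue_rV_box n (A : 'I_n -> set R) : (forall i, measurable (A i)) ->
  lebesgue_rV n [set x | forall i, A i (x ord0 i)] =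
  (\prod_(i < n) (lebesgue_measure (A i) : \bar R))%E.
Proof.
elim: n A => [|n IHn] A mA.
  by rewrite big_ord0 /= diracE mem_set// => -[].
rewrite big_ord_recl -(IHn (fun i => A (lift ord0 i)))// /= /lebesgue_step.
have mB := measurable_box (fun i => mA (lift ord0 i)).
rewrite -(product_measure1E lebesgue_measure (lebesgue_rV n) (mA ord0) mB).
congr product_measure1; apply/seteqP; split => -[a x] /=.
  move=> Ax; split; first by have := Ax ord0; rewrite mxE unlift_none.
  by move=> i; have := Ax (lift ord0 i); rewrite mxE liftK.
move=> [Aa Ax] i; rewrite mxE.
by case: (unliftP ord0 i) => [j ->|->] /=.
Qed.

End lebesgue_rV.

Section sobolev.
Context {R : realType} (n : nat).
Local Notation V := 'rV[R]_n.
Local Notation mu := (lebesgue_rV n : {measure set 'rV[R]_n -> \bar R}).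
Implicit Types (U Om C W : set V) (u v f : V -> R) (s : R).

Definition dotrV (x y : V) : R := \sum_(i < n) x ord0 i * y ord0 i.

(* Euclidean norm; `|x| is the sup norm on 'rV[R]_n.  *)
Definition enorm (x : V) : R := Num.sqrt (dotrV x x).

Definition partial (i : 'I_n) (f : V -> R) : V -> R :=
  fun x => 'D_(delta_mx ord0 i) f x.

Definition smooth (f : V -> R) : Prop :=
  forall l : seq 'I_n, let g := foldr partial f l in
    continuous g /\ forall (i : 'I_n) (x : V), derivable g x (delta_mx ord0 i).

Definition Cc_infty (U : set V) : set (V -> R) := [set f |
  [/\ smooth f, compact (closure [set x | f x != 0]) &
      closure [set x | f x != 0] `<=` U]].

(* For a real-valued u in L^2, the pair (a, b) represents the Fourier transform
   a + i b of u with the unitary normalization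
     (2 pi)^(-n/2) int u(x) exp(- i x.xi) dx,
   as the L^2-limit of the transforms of the truncations of u to the balls of
   radius k.  With this normalization Plancherel's formula has no constant.  *)

Definition fourier_const : R := (Num.sqrt (2 * pi)) ^- n.

Definition fourier_re_trunc u (k : nat) (xi : V) : R :=
  fourier_const *
  \int[mu]_(x in [set x | enorm x <= k%:R]) (u x * cos (dotrV x xi)).

Definition fourier_im_trunc u (k : nat) (xi : V) : R :=
  - (fourier_const *
     \int[mu]_(x in [set x | enorm x <= k%:R]) (u x * sin (dotrV x xi))).

Definition L2 : set (V -> R) := [set u | u \in Lfun mu 2%:E].

Definition is_fourier u (g : (V -> R) * (V -> R)) : Prop :=
  [/\ L2 g.1, L2 g.2,
      (fun k => 'N[mu]_2%:E[EFin \o (fourier_re_trunc u k \- g.1)%R])%E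
        @ \oo --> 0%E &
      (fun k => 'N[mu]_2%:E[EFin \o (fourier_im_trunc u k \- g.2)%R])%E
        @ \oo --> 0%E].

Definition fourier u : (V -> R) * (V -> R) := get (is_fourier u).
Definition fourier_re u : V -> R := (fourier u).1.
Definition fourier_im u : V -> R := (fourier u).2.

(* |u|_{H^s}^2 *)
Definition Hs_energy s u : \bar R :=
  (\int[mu]_xi ((1 + enorm xi ^+ 2) `^ s *
                (fourier_re u xi ^+ 2 + fourier_im u xi ^+ 2))%:E)%E.

Definition Hs s : set (V -> R) :=
  [set u | L2 u /\ (Hs_energy s u < +oo)%E].

Definition Hs_norm s u : R := Num.sqrt (fine (Hs_energy s u)).

Definition Hs_closure s (A : set (V -> R)) : set (V -> R) := [set u |
  Hs s u /\ forall e : R, 0 < e ->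
    exists v, [/\ A v, Hs s v & Hs_norm s (u \- v) < e]].

Definition Htilde s U : set (V -> R) := Hs_closure s (Cc_infty U).

(* An element of H^s(U) is represented by a function on R^n whose values outside
   U are irrelevant.  As elements of L^2 are Borel functions, u is required to be
   Borel on U, so that its extension by zero (u \_ U) is again Borel.  *)
Definition Hs_ext s U u : set (V -> R) :=
  [set ut | Hs s ut /\ ut = u %[ae mu in U]].

Definition Hs_on s U : set (V -> R) :=
  [set u | measurable_fun U u /\ Hs_ext s U u !=set0].

Definition Hs_on_norm s U u : R := inf [set Hs_norm s ut | ut in Hs_ext s U u].

(* H^{-s}(U), the dual of Htilde s U *)
Definition Hs_dual s U : set ((V -> R) -> R) := [set ell |
  (forall (a : R) u v, Htilde s U u -> Htilde s U v ->
     ell (fun x => a * u x + v x) = a * ell u + ell v) /\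
  exists M : R, forall u, Htilde s U u -> `|ell u| <= M * Hs_norm s u].

Definition is_cone C : Prop := forall (t : R) x, 0 < t -> C x -> C (t *: x).

Definition cone_dom C Om : set V :=
  [set x + y | x in Om & y in [set - z | z in C] `|` C].

Definition elliptic_symbol s (L : V -> R) : Prop :=
  [/\ measurable_fun setT L, forall xi, L (- xi) = L xi &
      exists2 lam : R, 1 <= lam & forall xi,
        lam^-1 * enorm xi `^ (2 * s) <= L xi <= lam * enorm xi `^ (2 * s)].

(* <L(D) u, v>, by Parseval's formula; the imaginary part of the integrand
   L(xi) u^(xi) conj(v^(xi)) is odd and integrates to 0.  *)
Definition form_L (L : V -> R) u v : R :=
  \int[mu]_xi (L xi * (fourier_re u xi * fourier_re v xi +
                       fourier_im u xi * fourier_im v xi)).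

Definition domain_of_dependence s C Om (L : V -> R) : Prop :=
  forall w v, Hs s w -> w = cst 0 %[ae mu in cone_dom C Om] ->
    Htilde s Om v -> form_L L w v = 0.

Definition Btilde Om (L q : V -> R) u v : R :=
  form_L L u v + \int[mu]_(x in Om) (q x * u x * v x).

Definition Bform s C Om (L q : V -> R) u v : R :=
  Btilde Om L q (get (Hs_ext s (cone_dom C Om) u)) v.

Definition ext_dom C Om : set V := cone_dom C Om `\` closure Om.

Definition weak_solution s C Om (L q : V -> R) f : set (V -> R) := [set u |
  [/\ Hs_on s (cone_dom C Om) u,
      forall v, Htilde s Om v -> Bform s C Om L q u v = 0 &
      forall ft, Hs_on s (cone_dom C Om) ft ->
        ft = f %[ae mu in ext_dom C Om] ->
        Htilde s Om ((u \- ft) \_ (cone_dom C Om))]].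

Definition well_posed s C Om (L q : V -> R) : Prop :=
  [/\ forall f, Hs_on s (ext_dom C Om) f ->
        weak_solution s C Om L q f !=set0,
      forall f u1 u2, Hs_on s (ext_dom C Om) f ->
        weak_solution s C Om L q f u1 -> weak_solution s C Om L q f u2 ->
        u1 = u2 %[ae mu in cone_dom C Om] &
      exists M : R, forall f u, Hs_on s (ext_dom C Om) f ->
        weak_solution s C Om L q f u ->
        Hs_on_norm s (cone_dom C Om) u <= M * Hs_on_norm s (ext_dom C Om) f].

(* P_q f, unique up to a null set when the problem is well-posed *)
Definition poisson s C Om (L q : V -> R) f : V -> R :=
  get (weak_solution s C Om L q f).

End sobolev.

(* Main.v *)
Require Import Defs.
From mathcomp Require Import all_boot all_order all_algebra.
From mathcomp Require Import all_classical all_reals all_analysis.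
From mathcomp Require Import measurable_realfun ess_sup_inf.
From mathcomp Require Import ring lra.

(* For f supported in W let g be the restriction of P_q f to Om.  By the domain of
   dependence property, g is the element of Htilde with B(g, phi) = - <L f, phi>
   for all phi in Htilde.  As B is symmetric, a solution w of B(w, .) = v satisfies
   v(g) = - <L w, f>; so L w = 0 in W says exactly that v annihilates the functions
   g.  Hence (a) gives v = 0, and then w = 0 by uniqueness for the Dirichlet problem.
   Conversely, let z be orthogonal to all g in H^s.  The equation B(w, .) = <z, .>
   is solvable by the Fredholm alternative: B is symmetric, coercive up to finitely
   many bounded functionals (Rellich) and injective by well-posedness.  Then (b)
   gives z = 0.

   Plancherel's formula comes from the identity
     int K_e |g^|^2 = c int int g(x) g(y) P_e(x - y),  K_e = exp(- e sum_i |xi_i|),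
   where P_e is a product of Poisson kernels: Young's inequality gives the upper
   bound, and polarizing against the indicators of boxes, whose Poisson integrals
   are explicit, gives equality by density.  *)

Set Implicit Arguments.
Unset Strict Implicit.
Unset Printing Implicit Defensive.

Import Order.TTheory GRing.Theory Num.Theory.
Import numFieldNormedType.Exports.

Local Open Scope classical_set_scope.
Local Open Scope ring_scope.

(** * Hilbert spaces carried by a set of vectors *)

Section hilbert.
Context {R : realType} {E : lmodType R}.
Implicit Types (S M : set E) (b B : E -> E -> R) (l : E -> R).

(** Functions that agree almost everywhere are not identified, and [fourier] and [poisson] are
    values of a choice operator. Hence inner products are only semi-definite, [b x x = 0] plays the
    part of [x = 0], transforms are linear only almost everywhere, and the functions g of the
    overview are replaced by a genuine subspace of functions almost everywhere equal to them. The
    kernel exp(- e |t|) is chosen because its transform is rational and the primitive of the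
    transform is an arctangent: the limit e -> 0 for a box is read off from a formula. The upper
    bound in Plancherel's formula serves twice: it makes the transforms of truncations converge in
    L^2, so that [fourier] has a meaning, and it lets equality pass to the limit. [Om] is an
    arbitrary bounded open set, so compactness cannot rest on its boundary. It rests on the support:
    the transform of a function vanishing outside a ball has pointwise values and a Lipschitz
    constant bounded by the L^2 norm. *)

Definition subspace S := S 0 /\ forall (a : R) x y, S x -> S y -> S (a *: x + y).

Definition linear_on S l :=
  forall (a : R) x y, S x -> S y -> l (a *: x + y) = a * l x + l y.

Definition symbilinear_on S b :=
  (forall x y, S x -> S y -> b x y = b y x) /\
  (forall y, S y -> linear_on S (fun x => b x y)).

(** Squared, like all norms here, so that no square root of [b x x] has to be handled. *)
Definition bounded_on S b l := exists K : R, forall x, S x -> l x ^+ 2 <= K * b x x.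

Definition converges_to b (u : nat -> E) x := forall e : R, 0 < e ->
  exists N, forall i, (N <= i)%N -> b (u i - x) (u i - x) < e.

Definition cauchy_for b (u : nat -> E) := forall e : R, 0 < e ->
  exists N, forall i j, (N <= i)%N -> (N <= j)%N -> b (u i - u j) (u i - u j) < e.

Definition complete_on S b := forall u : nat -> E, (forall k, S (u k)) ->
  cauchy_for b u -> exists2 x, S x & converges_to b u x.

(** Definiteness is left out on purpose: the vectors will be functions, and a function that vanishes
    almost everywhere has norm 0. *)
Definition hilbert S b := [/\ subspace S, symbilinear_on S b,
  forall x, S x -> 0 <= b x x & complete_on S b].

Definition closure_in S b M : set E := [set x | S x /\
  forall e : R, 0 < e -> exists y, [/\ M y, S y & b (x - y) (x - y) < e]].

Lemma quadratic_discr (a c d : R) : 0 <= a -> 0 <= d ->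
  (forall t, 0 <= t ^+ 2 * a + 2 * t * c + d) -> c ^+ 2 <= a * d.
Proof.
move=> a0 d0 H; have [a_eq0|a_neq0] := eqVneq a 0.
  have [->|c0] := eqVneq c 0; first by rewrite expr0n/= mulr_ge0.
  (* For [a = 0] the polynomial is affine in t, and this t gives it the value -1. *)
  have := H (- (d + 1) / (2 * c)); rewrite a_eq0 mulr0 add0r.
  have -> : 2 * (- (d + 1) / (2 * c)) * c + d = -1 by field; apply/eqP; lra.
  lra.
have a_gt0 : 0 < a by rewrite lt_neqAle eq_sym a_neq0.
have := H (- c / a).
have -> : (- c / a) ^+ 2 * a + 2 * (- c / a) * c + d = d - c ^+ 2 / a by field.
by rewrite subr_ge0 ler_pdivrMr// [a * d]mulrC.
Qed.

(** Closing device of the density arguments: x is fixed while e is free. As [K] may be zero or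
    negative, the proof works with [|K| + 1]. *)
Lemma eq0_of_sqr_le (x K : R) : (forall e, 0 < e -> x ^+ 2 <= K * e) -> x = 0.
Proof.
move=> H; apply/eqP; rewrite -sqrf_eq0 eq_le sqr_ge0 andbT leNgt; apply/negP => x0.
have K0 : 0 < `|K| + 1 by rewrite ltr_wpDl.
have := H (x ^+ 2 / (2 * (`|K| + 1))) (divr_gt0 x0 (mulr_gt0 (ltr0Sn _ 1) K0)).
rewrite mulrA ler_pdivlMr ?mulr_gt0// => h.
have : K * x ^+ 2 <= (`|K| + 1) * x ^+ 2.
  by rewrite ler_pM2r// (le_trans (ler_norm _))// lerDl.
have := mulr_gt0 x0 K0; nra.
Qed.

Section basic.
Variables (S : set E) (b : E -> E -> R).
Hypotheses (subS : subspace S) (bS : symbilinear_on S b).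

Lemma subspace0 : S 0. Proof. exact: subS.1. Qed.

Lemma subspaceD x y : S x -> S y -> S (x + y).
Proof. by move=> Sx Sy; rewrite -[x]scale1r; exact: subS.2. Qed.

Lemma subspaceZ a x : S x -> S (a *: x).
Proof. by move=> Sx; rewrite -[_ *: _]addr0; apply: subS.2 => //; exact: subspace0. Qed.

Lemma subspaceB x y : S x -> S y -> S (x - y).
Proof. by move=> Sx Sy; rewrite -scaleN1r addrC; exact: subS.2. Qed.

Lemma subspace_sum I (r : seq I) (F : I -> E) :
  (forall i, S (F i)) -> S (\sum_(i <- r) F i).
Proof. by move=> SF; elim/big_ind: _ => //; [exact: subspace0|exact: subspaceD]. Qed.

Lemma linear_on0 l : linear_on S l -> l 0 = 0.
Proof.
move=> ll; have := ll 1 0 0 subspace0 subspace0.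
by rewrite scale1r addr0 mul1r => /eqP; rewrite -subr_eq subrr => /eqP.
Qed.

Lemma linear_onD l x y : linear_on S l -> S x -> S y -> l (x + y) = l x + l y.
Proof. by move=> ll Sx Sy; rewrite -[x in LHS]scale1r ll// mul1r. Qed.

Lemma linear_onZ l a x : linear_on S l -> S x -> l (a *: x) = a * l x.
Proof.
move=> ll Sx; rewrite -[_ *: _ in LHS]addr0 ll//; last exact: subspace0.
by rewrite linear_on0// addr0.
Qed.

Lemma linear_onB l x y : linear_on S l -> S x -> S y -> l (x - y) = l x - l y.
Proof. by move=> ll Sx Sy; rewrite -scaleN1r addrC ll// mulN1r addrC. Qed.

Lemma linear_on_sum l I (r : seq I) (F : I -> E) : linear_on S l ->
  (forall i, S (F i)) -> l (\sum_(i <- r) F i) = \sum_(i <- r) l (F i).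
Proof.
move=> ll SF; elim: r => [|i r IH]; first by rewrite !big_nil linear_on0.
by rewrite !big_cons linear_onD// ?IH//; exact: subspace_sum.
Qed.

Lemma linear_onr x : S x -> linear_on S (b x).
Proof.
move=> Sx a y z Sy Sz; have [sym lin] := bS.
by rewrite sym ?lin// ?(sym x)//; exact: subS.2.
Qed.

Lemma linear_onl x : S x -> linear_on S (b ^~ x).
Proof. by move=> Sx; exact: bS.2. Qed.

Lemma form_sqrD x y t : S x -> S y ->
  b (x + t *: y) (x + t *: y) = t ^+ 2 * b y y + 2 * t * b x y + b x x.
Proof.
move=> Sx Sy; have Sty := subspaceZ t Sy; have SD := subspaceD Sx Sty.
rewrite (linear_onD (linear_onl SD))// !(linear_onD (linear_onr _))//.
rewrite !(linear_onZ _ (linear_onl _))// !(linear_onZ _ (linear_onr _))//.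
rewrite (bS.1 y x)//; ring.
Qed.

Hypothesis b0 : forall x, S x -> 0 <= b x x.

Lemma form_cauchy_schwarz x y : S x -> S y -> b x y ^+ 2 <= b y y * b x x.
Proof.
move=> Sx Sy; apply: quadratic_discr; [exact: b0|exact: b0|move=> t].
by rewrite -form_sqrD//; apply: b0; apply: subspaceD => //; exact: subspaceZ.
Qed.

(** Written with the midpoint, which stays in [S]: in [riesz] the functional at the midpoint is
    bounded below by the infimum, and the identity turns this into a bound on the distance. *)
Lemma form_parallelogram x y : S x -> S y ->
  b (x - y) (x - y) = 2 * b x x + 2 * b y y - 4 * b (2^-1 *: (x + y)) (2^-1 *: (x + y)).
Proof.
move=> Sx Sy; have SD := subspaceD Sx Sy.
rewrite (linear_onZ _ (linear_onl _))// ?(linear_onZ _ (linear_onr _))//; last exact: subspaceZ.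
rewrite -[x - y]/(x + - y) -scaleN1r form_sqrD//.
have -> : b (x + y) (x + y) = b y y + 2 * b x y + b x x.
  by rewrite -[in LHS](scale1r y) form_sqrD// expr1n mul1r mulr1.
by field.
Qed.

Lemma form_sqrB_le x y : S x -> S y -> b (x - y) (x - y) <= 2 * b x x + 2 * b y y.
Proof.
move=> Sx Sy; rewrite form_parallelogram// gerBl mulr_ge0//; apply: b0.
by apply: subspaceZ; exact: subspaceD.
Qed.

Lemma form_sqrD_le x y : S x -> S y -> b (x + y) (x + y) <= 2 * b x x + 2 * b y y.
Proof.
move=> Sx Sy; have := form_sqrB_le Sx (subspaceZ (-1) Sy).
rewrite scaleN1r opprK => /le_trans; apply; rewrite -scaleN1r.
rewrite (linear_onZ _ (linear_onl _))// ?(linear_onZ _ (linear_onr _))//.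
  by rewrite !mulN1r opprK.
exact: subspaceZ.
Qed.

Lemma form_sqrN x y : S x -> S y -> b (y - x) (y - x) = b (x - y) (x - y).
Proof.
move=> Sx Sy; have Sxy := subspaceB Sx Sy.
rewrite -[y - x]opprB -[- (x - y)]scaleN1r (linear_onZ _ (linear_onl _)) ?(linear_onZ _ (linear_onr _))//.
  by rewrite !mulN1r opprK.
exact: subspaceZ.
Qed.

(** Replaces the triangle inequality for squared distances, at the price of a factor 2; this
    explains the thresholds [e / 4] in the limit arguments. *)
Lemma form_dist_le x y z : S x -> S y -> S z ->
  b (x - z) (x - z) <= 2 * b (x - y) (x - y) + 2 * b (y - z) (y - z).
Proof.
move=> Sx Sy Sz; rewrite -(subrKA y x (- z)).
by apply: form_sqrD_le; exact: subspaceB.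
Qed.

Lemma converges_cauchy u x : (forall k, S (u k)) -> S x ->
  converges_to b u x -> cauchy_for b u.
Proof.
move=> Su Sx ux e e0; have [N HN] := ux (e / 4) (divr_gt0 e0 (ltr0Sn _ _)).
exists N => i j Ni Nj; apply: le_lt_trans (form_dist_le (Su i) Sx (Su j)) _.
have := HN _ Ni; have := HN _ Nj; rewrite (form_sqrN (Su j) Sx); lra.
Qed.

End basic.

(** Direct method: minimise [J x = b x x - 2 * l x]. The parallelogram law makes a minimising
    sequence Cauchy, and its limit represents [l]. The Euler equation is derived, with an error,
    along the sequence, so [J] is never evaluated at the limit. *)
Theorem riesz S b l : hilbert S b -> linear_on S l -> bounded_on S b l ->
  exists2 r, S r & forall x, S x -> b r x = l x.
Proof.
move=> [subS bS b0 cS] ll [K lK].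
pose J x := b x x - 2 * l x.
(* From 2 l(x) <= 2 sqrt(|K| b(x, x)) <= |K| + b(x, x). *)
have JK x : S x -> - `|K| <= J x.
  move=> Sx; have := lK x Sx; have := b0 x Sx; have := ler_norm K.
  rewrite /J; set q := b x x; set y := l x; set k := `|K| => Kk q0 h.
  have h' : y ^+ 2 <= k * q by apply: le_trans h _; rewrite ler_wpM2r.
  have k0 : 0 <= k by exact: normr_ge0.
  rewrite lerNl opprB leNgt; apply/negP => hlt; have := sqr_ge0 (k - q); nra.
pose A := [set J x | x in S].
have A0 : A !=set0 by exists (J 0); exists 0 => //; exact: subspace0 subS.
have lbA : has_lbound A by exists (- `|K|) => _ [x Sx <-]; exact: JK.
have Am x : S x -> inf A <= J x by move=> Sx; apply: ge_inf => //; exists x.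
have ex k : exists x, S x /\ J x < inf A + k.+1%:R^-1.
  have [_ [x Sx <-] h] := @inf_adherent R A k.+1%:R^-1 ltac:(by rewrite invr_gt0) (conj A0 lbA).
  by exists x.
have /choice[u uP] := ex.
have Su k := (uP k).1; have Ju k := (uP k).2.
have inv_small e : 0 < e -> exists N, forall i, (N <= i)%N -> i.+1%:R^-1 < e :> R.
  move=> e0; exists (Num.truncn e^-1) => i Ni.
  rewrite invf_plt ?posrE//; apply: (lt_le_trans (truncnS_gt _)).
  by rewrite ler_nat.
have [|x Sx ux] := cS u Su.
  move=> e e0; have [N HN] := inv_small (e / 4) (divr_gt0 e0 (ltr0Sn _ _)).
  exists N => i j Ni Nj; rewrite (form_parallelogram subS bS)//.
  have Sm : S (2^-1 *: (u i + u j)) by apply: subspaceZ => //; exact: subspaceD.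
  have := Am _ Sm; have := Ju i; have := Ju j; rewrite /J.
  have -> : l (2^-1 *: (u i + u j)) = 2^-1 * (l (u i) + l (u j)).
    by rewrite (linear_onZ subS)// ?(linear_onD ll)//; exact: subspaceD.
  move: (HN _ Ni) (HN _ Nj); move: (i.+1%:R^-1) (j.+1%:R^-1) => p1 p2; lra.
exists x => // y Sy; apply/eqP; rewrite -subr_eq0; apply/eqP.
apply: (@eq0_of_sqr_le _ (4 * b y y)) => e e0.
have [N1 HN1] := inv_small e e0; have [N2 HN2] := ux e e0.
pose k := maxn N1 N2.
(* [J (u k + t *: y)] is at least [inf A], and [J (u k)] exceeds [inf A] by less than 1 / (k + 1).
   So a quadratic in t is nonnegative, and its discriminant gives the bound. *)
have h1 : (b (u k) y - l y) ^+ 2 <= b y y * k.+1%:R^-1.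
  apply: quadratic_discr => [||t]; [exact: b0|by rewrite invr_ge0|].
  have := Am _ (subspaceD subS (Su k) (subspaceZ subS t Sy)); have := Ju k.
  rewrite /J (form_sqrD subS bS)// (linear_onD ll)// ?(linear_onZ subS)//; last exact: subspaceZ.
  move: (k.+1%:R^-1) => p; nra.
have h2 := form_cauchy_schwarz subS bS b0 (subspaceB subS (Su k) Sx) Sy.
rewrite (linear_onB (linear_onl bS Sy)) // in h2.
have h3 : b y y * k.+1%:R^-1 <= b y y * e.
  by apply: ler_wpM2l; [exact: b0|apply/ltW/HN1; exact: leq_maxl].
have h4 : b y y * b (u k - x) (u k - x) <= b y y * e.
  by apply: ler_wpM2l; [exact: b0|apply/ltW/HN2; exact: leq_maxr].
have := le_trans h1 h3; have := le_trans h2 h4.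
move: (b (u k) y) (b x y) (l y) => p1 p2 p3 g2 g1.
by have := sqr_ge0 ((p1 - p3) + (p1 - p2)); nra.
Qed.

Lemma closure_in_subspace S b M : subspace S -> symbilinear_on S b ->
  (forall x, S x -> 0 <= b x x) -> subspace M -> subspace (closure_in S b M).
Proof.
move=> subS bS b0 subM; split.
  split; first exact: subspace0.
  move=> e e0; exists 0; split; [exact: subspace0|exact: subspace0|].
  by rewrite subr0 (linear_on0 subS (linear_onl bS (subspace0 subS))).
move=> a x y [Sx Mx] [Sy My]; split; first exact: subS.2.
move=> e e0.
have [|x' [Mx' Sx' hx]] := Mx (e / (4 * (a ^+ 2 + 1))).
  by rewrite divr_gt0// mulr_gt0// ltr_wpDl// sqr_ge0.
have [y' [My' Sy' hy]] := My (e / 4) (divr_gt0 e0 (ltr0Sn _ _)).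
exists (a *: x' + y'); split; [exact: subM.2|exact: subS.2|].
have -> : a *: x + y - (a *: x' + y') = a *: (x - x') + (y - y').
  by rewrite scalerBr opprD addrACA.
have Sx1 := subspaceB subS Sx Sx'; have Sy1 := subspaceB subS Sy Sy'.
apply: le_lt_trans (form_sqrD_le subS bS b0 (subspaceZ subS a Sx1) Sy1) _.
rewrite (linear_onZ subS _ (linear_onl _ _))// ?(linear_onZ subS _ (linear_onr _ _ _))//;
  last exact: subspaceZ.
have : (a ^+ 2 + 1) * b (x - x') (x - x') < e / 4.
  rewrite mulrC -ltr_pdivlMr; last by rewrite ltr_wpDl// sqr_ge0.
  by rewrite -mulrA -invfM.
have := b0 _ Sx1; nra.
Qed.

Lemma closure_in_complete S b M : hilbert S b -> complete_on (closure_in S b M) b.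
Proof.
move=> [subS bS b0 cS] u Mu cu; have Su k : S (u k) by have [] := Mu k.
have [x Sx ux] := cS u Su cu; exists x => //; split=> // e e0.
have [N HN] := ux (e / 4) (divr_gt0 e0 (ltr0Sn _ _)).
have [y [My Sy hy]] := (Mu N).2 (e / 4) (divr_gt0 e0 (ltr0Sn _ _)).
exists y; split => //; apply: le_lt_trans (form_dist_le subS bS b0 Sx (Su N) Sy) _.
by rewrite (form_sqrN subS bS (Su N) Sx); have := HN N (leqnn _); lra.
Qed.

Lemma sub_closure_in S b M : subspace S -> symbilinear_on S b ->
  M `<=` S -> M `<=` closure_in S b M.
Proof.
move=> subS bS MS x Mx; split; first exact: MS.
move=> e e0; exists x; split => //; first exact: MS.
by rewrite subrr (linear_on0 subS (linear_onl bS (subspace0 subS))).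
Qed.

Lemma hilbert_closure_in S b M : hilbert S b -> subspace M ->
  hilbert (closure_in S b M) b.
Proof.
move=> hS subM; have [subS [bS1 bS2] b0 cS] := hS; split.
- exact: closure_in_subspace.
- split => [x y [Sx _] [Sy _]|y [Sy _] a x z [Sx _] [Sz _]]; first exact: bS1.
  exact: bS2.
- by move=> x [Sx _]; exact: b0.
- exact: closure_in_complete.
Qed.

(** The Riesz representative r of [b x] in the closure of [M] is the orthogonal projection of x; the
    hypothesis applies to x - r and puts x at distance 0 from the closure. *)
Theorem dense_of_orthogonal S b M : hilbert S b -> subspace M -> M `<=` S ->
  (forall z, S z -> (forall y, M y -> b z y = 0) -> b z z = 0) ->
  S `<=` closure_in S b M.
Proof.
move=> hS subM MS orth x Sx; have [subS bS b0 cS] := hS.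
have [r [Sr Mr] rP] : exists2 r, closure_in S b M r &
    forall y, closure_in S b M y -> b r y = b x y.
  apply: riesz; first exact: hilbert_closure_in.
    by move=> a y z [Sy _] [Sz _]; exact: (linear_onr subS bS Sx).
  exists (b x x) => y [Sy _].
  by rewrite mulrC; exact: (form_cauchy_schwarz subS bS b0 Sx Sy).
have Sxr := subspaceB subS Sx Sr.
have xr0 : b (x - r) (x - r) = 0.
  apply: orth => // y My; rewrite (linear_onB (linear_onl bS (MS _ My)))//.
  by rewrite rP ?subrr//; exact: sub_closure_in.
split => // e e0; have [y [My Sy hy]] := Mr (e / 2) (divr_gt0 e0 (ltr0Sn _ _)).
exists y; split => //; apply: le_lt_trans (form_dist_le subS bS b0 Sx Sr Sy) _; lra.
Qed.

(* The coercive form [B + K sum_j l_j l_j] is an inner product, so that solving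
   [B w = l] amounts to an N x N linear system for the numbers [K l_j(w)]; its
   matrix is invertible because [B] is injective.  *)
Theorem symmetric_fredholm S b B N (lj : 'I_N -> E -> R) (K c M : R) l :
  hilbert S b -> symbilinear_on S B -> 0 < c ->
  (forall x, S x -> B x x <= M * b x x) ->
  (forall j, linear_on S (lj j)) -> (forall j, bounded_on S b (lj j)) ->
  (forall x, S x -> c * b x x <= B x x + K * \sum_j lj j x ^+ 2) ->
  (forall x, S x -> (forall y, S y -> B x y = 0) -> b x x = 0) ->
  linear_on S l -> bounded_on S b l ->
  exists2 w, S w & forall y, S y -> B w y = l y.
Proof.
move=> hS BS c0 BM ll lb coer inj lin bdd; have [subS bS b0 cS] := hS.
pose b' x y := B x y + K * \sum_j lj j x * lj j y.
have b'E x : b' x x = B x x + K * \sum_j lj j x ^+ 2.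
  by rewrite /b'; under [in RHS]eq_bigr do rewrite expr2.
have b'S : symbilinear_on S b'.
  split => [x y Sx Sy|y Sy a x z Sx Sz].
    by rewrite /b' BS.1//; under eq_bigr do rewrite mulrC.
  rewrite /b' BS.2//; under eq_bigr do rewrite ll// mulrDl -mulrA.
  by rewrite big_split/= -mulr_sumr; ring.
have [M' b'M] : exists M' : R, forall x, S x -> b' x x <= M' * b x x.
  have /choice[Mj HMj] : forall j, exists K0, forall x, S x -> lj j x ^+ 2 <= K0 * b x x.
    by move=> j; exact: lb.
  exists (M + `|K| * \sum_j Mj j) => x Sx; rewrite b'E mulrDl lerD ?BM// -mulrA.
  apply: (@le_trans _ _ (`|K| * \sum_j lj j x ^+ 2)).
    by rewrite ler_wpM2r ?ler_norm// sumr_ge0// => j _; exact: sqr_ge0.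
  by rewrite ler_wpM2l// mulr_suml ler_sum// => j _; exact: HMj.
have coer' x : S x -> b x x <= c^-1 * b' x x.
  by move=> Sx; rewrite mulrC ler_pdivlMr// mulrC b'E; exact: coer.
have b'0 x : S x -> 0 <= b' x x.
  by move=> Sx; rewrite b'E (le_trans _ (coer x Sx))// mulr_ge0 ?b0// ltW.
(* [b] and [b'] define the same convergence: [coer'] carries Cauchy sequences from [b'] to [b], and
   [b'M] carries the limit back. *)
have hS' : hilbert S b'.
  split => // u Su cu.
  have [|x Sx ux] := cS u Su.
    move=> e e0; have [n Hn] := cu (c * e) (mulr_gt0 c0 e0).
    exists n => i j ni nj; apply: le_lt_trans (coer' _ (subspaceB subS (Su i) (Su j))) _.
    by rewrite mulrC ltr_pdivrMr// mulrC; exact: Hn.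
  exists x => // e e0; have M0 : 0 < `|M'| + 1 by rewrite ltr_wpDl.
  have [n Hn] := ux (e / (`|M'| + 1)) (divr_gt0 e0 M0).
  exists n => i ni; have Sd := subspaceB subS (Su i) Sx.
  apply: le_lt_trans (b'M _ Sd) _; have := Hn i ni.
  rewrite ltr_pdivlMr// => /(le_lt_trans _); apply; rewrite mulrC ler_wpM2l ?b0//.
  by rewrite (le_trans (ler_norm _))// lerDl.
have bounded' l' : bounded_on S b l' -> bounded_on S b' l'.
  move=> [K' HK']; exists (`|K'| * c^-1) => x Sx; apply: le_trans (HK' x Sx) _.
  rewrite -mulrA; apply: (@le_trans _ _ (`|K'| * b x x)).
    by rewrite ler_wpM2r ?b0// ler_norm.
  by rewrite ler_wpM2l// coer'.
have [r0 Sr0 r0P] := riesz hS' lin (bounded' _ bdd).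
have /choice[r rP] : forall j, exists rj, S rj /\ forall x, S x -> b' rj x = lj j x.
  move=> j; have [rj Srj rjP] := riesz hS' (ll j) (bounded' _ (lb j)).
  by exists rj.
have Sr j := (rP j).1.
pose comb (d : 'rV[R]_N) := \sum_i d ord0 i *: r i.
have Scomb d : S (comb d) by apply: subspace_sum => // i; exact: subspaceZ.
have lcomb d j : lj j (comb d) = \sum_i d ord0 i * lj j (r i).
  rewrite (linear_on_sum subS _ (ll j)); last by move=> i; exact: subspaceZ.
  by apply: eq_bigr => i _; rewrite (linear_onZ subS).
have b'comb d y : S y -> b' (comb d) y = \sum_i d ord0 i * lj i y.
  move=> Sy; rewrite (linear_on_sum subS _ (linear_onl b'S Sy)); last first.
    by move=> i; exact: subspaceZ.
  apply: eq_bigr => i _.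
  by rewrite (linear_onZ subS _ (linear_onl b'S Sy))// (rP i).2.
(* For w = r0 + [comb d], the conditions d_j = K l_j(w) read: d A is the row of the numbers K
   l_j(r0). *)
pose A : 'M[R]_N := 1%:M - \matrix_(i, j) (K * lj j (r i)).
have dA (d : 'rV[R]_N) j : (d *m A) ord0 j = d ord0 j - K * lj j (comb d).
  rewrite mulmxBr mulmx1 !mxE; congr (_ - _).
  rewrite lcomb mulr_sumr; apply: eq_bigr => i _; rewrite !mxE; ring.
have uA : A \in unitmx.
  rewrite -row_free_unit -kermx_eq0; apply/eqP/row_matrixP => i.
  set d := row i (kermx A); rewrite row0.
  have d0 : d *m A = 0 by rewrite /d -row_mul mulmx_ker row0.
  have dj j : d ord0 j = K * lj j (comb d).
    by apply/eqP; rewrite -subr_eq0 -dA d0 mxE.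
  (* Since d_j = K l_j([comb d]), the finite-rank part of [b' (comb d) y] is all of it, and
     [B (comb d) y = 0] for every y. *)
  have z0 : b (comb d) (comb d) = 0.
    apply: inj => // y Sy; have := b'comb d y Sy; rewrite /b'.
    rewrite mulr_sumr; under [X in _ = X]eq_bigr do rewrite dj -mulrA.
    by move=> h; apply: (addIr (\sum_i0 K * (lj i0 (comb d) * lj i0 y))); rewrite h add0r.
  apply/rowP => j; rewrite dj mxE; have [K' HK'] := lb j.
  have := HK' _ (Scomb d); rewrite z0 mulr0 => h.
  have /eqP : lj j (comb d) ^+ 2 = 0 by apply: le_anti; rewrite h sqr_ge0.
  by rewrite sqrf_eq0 => /eqP ->; rewrite mulr0.
pose d := (\row_j (K * lj j r0)) *m invmx A.
have dj j : d ord0 j = K * lj j (r0 + comb d).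
  rewrite (linear_onD (ll j))// mulrDr; apply/eqP; rewrite -subr_eq -dA.
  by rewrite /d mulmxKV// mxE.
exists (r0 + comb d); first exact: subspaceD.
move=> y Sy; have := linear_onD (linear_onl b'S Sy) Sr0 (Scomb d).
rewrite r0P// b'comb// {1}/b' mulr_sumr.
under [X in _ = _ + X]eq_bigr do rewrite dj -mulrA.
by move/addIr.
Qed.

End hilbert.

(** * Limits and continuity for a semi-definite form *)

Section hilbert_limits.
Context {R : realType} {E : lmodType R}.
Variables (S : set E) (b : E -> E -> R).
Hypotheses (subS : subspace S) (bS : symbilinear_on S b)
  (b0 : forall x, S x -> 0 <= b x x).

(** Cauchy-Schwarz on each term of b(dx, dy) + b(dx, y) + b(x, dy); the assumption [e <= 1] lets e
    also bound the first term, which is quadratically small. *)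
Lemma form_near x y x' y' e : S x -> S y -> S x' -> S y' -> e <= 1 ->
  b (x' - x) (x' - x) <= e -> b (y' - y) (y' - y) <= e ->
  (b x' y' - b x y) ^+ 2 <= 3 * e * (1 + b x x + b y y).
Proof.
move=> Sx Sy Sx' Sy' e1 hx hy.
have Sdx := subspaceB subS Sx' Sx; have Sdy := subspaceB subS Sy' Sy.
have Px := b0 Sdx; have Py := b0 Sdy; have X0 := b0 Sx; have Y0 := b0 Sy.
have h1 : b (x' - x) (y' - y) = b x' (y' - y) - b x (y' - y).
  exact: (linear_onB (linear_onl bS Sdy) Sx' Sx).
have h2 : b x' (y' - y) = b x' y' - b x' y.
  exact: (linear_onB (linear_onr subS bS Sx') Sy' Sy).
have h3 : b (x' - x) y = b x' y - b x y.
  exact: (linear_onB (linear_onl bS Sy) Sx' Sx).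
have -> : b x' y' - b x y = b (x' - x) (y' - y) + b (x' - x) y + b x (y' - y).
  rewrite h1 h2 h3; ring.
have c1 := form_cauchy_schwarz subS bS b0 Sdx Sdy.
have c2 := form_cauchy_schwarz subS bS b0 Sdx Sy.
have c3 := form_cauchy_schwarz subS bS b0 Sx Sdy.
clear h1 h2 h3.
move: (b (x' - x) (x' - x)) (b (y' - y) (y' - y)) (b x x) (b y y) hx hy Px Py X0 Y0 c1 c2 c3.
move: (b (x' - x) (y' - y)) (b (x' - x) y) (b x (y' - y)) => p q r P Q X Y.
move=> hx hy P0 Q0 X0 Y0 c1 c2 c3.
have k1 : p ^+ 2 <= e by apply: le_trans c1 _; rewrite -[leRHS]mul1r; apply: ler_pM => //; exact: le_trans hy e1.
have k2 : q ^+ 2 <= Y * e by apply: le_trans c2 _; exact: ler_wpM2l.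
have k3 : r ^+ 2 <= X * e by apply: le_trans c3 _; rewrite mulrC; exact: ler_wpM2l.
have : (p + q + r) ^+ 2 <= 3 * (p ^+ 2 + q ^+ 2 + r ^+ 2).
  have := sqr_ge0 (p - q); have := sqr_ge0 (p - r); have := sqr_ge0 (q - r); nra.
nra.
Qed.

Lemma form_cvg u v x y : (forall k, S (u k)) -> (forall k, S (v k)) -> S x -> S y ->
  converges_to b u x -> converges_to b v y -> b (u k) (v k) @[k --> \oo] --> b x y.
Proof.
move=> Su Sv Sx Sy ux vy; apply/cvgrPdist_lt => e e0.
pose M := 3 * (1 + b x x + b y y).
have M0 : 0 < M by have := b0 Sx; have := b0 Sy; rewrite /M; lra.
pose d := Num.min 1 (e ^+ 2 / 2 / M).
have d0 : 0 < d by rewrite /d lt_min ltr01/= !divr_gt0// exprn_gt0.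
have [N1 H1] := ux d d0; have [N2 H2] := vy d d0.
exists (maxn N1 N2) => // k /=; rewrite geq_max => /andP[k1 k2].
rewrite distrC -(ltr_pXn2r (ltn0Sn 1)) ?nnegrE ?(ltW e0)// real_normK ?num_real//.
apply: (@le_lt_trans _ _ (3 * d * (1 + b x x + b y y))).
  by apply: form_near => //; [rewrite /d ge_min lexx|exact/ltW/H1|exact/ltW/H2].
have -> : 3 * d * (1 + b x x + b y y) = M * d by rewrite /M; ring.
apply: (@le_lt_trans _ _ (e ^+ 2 / 2)); last by rewrite ltr_pdivrMr// ltr_pMr ?exprn_gt0// ltr1n.
by rewrite mulrC -ler_pdivlMr// /d ge_min lexx orbT.
Qed.

Lemma converges_unique u x y : (forall k, S (u k)) -> S x -> S y ->
  converges_to b u x -> converges_to b u y -> b (x - y) (x - y) = 0.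
Proof.
move=> Su Sx Sy ux uy; have Sxy := subspaceB subS Sx Sy.
apply/eqP; rewrite eq_le b0// andbT; apply/ler_addgt0Pl => e e0; rewrite addr0.
have [N1 H1] := ux (e / 4) (divr_gt0 e0 (ltr0Sn _ _)).
have [N2 H2] := uy (e / 4) (divr_gt0 e0 (ltr0Sn _ _)).
pose N := maxn N1 N2; apply: le_trans (form_dist_le subS bS b0 Sx (Su N) Sy) _.
rewrite (form_sqrN subS bS (Su N) Sx).
have := H1 N (leq_maxl _ _); have := H2 N (leq_maxr _ _); lra.
Qed.

Lemma converges_linear a u v x y : (forall k, S (u k)) -> (forall k, S (v k)) ->
  S x -> S y -> converges_to b u x -> converges_to b v y ->
  converges_to b (fun k => a *: u k + v k) (a *: x + y).
Proof.
move=> Su Sv Sx Sy ux vy e e0.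
have A0 : 0 < 1 + a ^+ 2 by rewrite ltr_pwDl// sqr_ge0.
pose d := e / 4 / (1 + a ^+ 2).
have d0 : 0 < d by rewrite !divr_gt0.
have [N1 H1] := ux d d0; have [N2 H2] := vy d d0.
exists (maxn N1 N2) => k; rewrite geq_max => /andP[k1 k2].
have -> : a *: u k + v k - (a *: x + y) = a *: (u k - x) + (v k - y).
  by rewrite scalerBr opprD addrACA.
have Sux := subspaceB subS (Su k) Sx; have Svy := subspaceB subS (Sv k) Sy.
apply: le_lt_trans (form_sqrD_le subS bS b0 (subspaceZ subS a Sux) Svy) _.
have -> : b (a *: (u k - x)) (a *: (u k - x)) = a ^+ 2 * b (u k - x) (u k - x).
  rewrite (linear_onZ subS _ (linear_onl bS _))//; last exact: subspaceZ.
  by rewrite (linear_onZ subS _ (linear_onr subS bS _))// mulrA.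
have dE : (1 + a ^+ 2) * d = e / 4 by rewrite /d mulrC divfK// gt_eqF.
have := H1 k k1; have := H2 k k2; have := b0 Sux; have := b0 Svy; have := sqr_ge0 a; nra.
Qed.

Lemma converges_eventually u x N : (forall k, S (u k)) ->
  (forall k, (N <= k)%N -> u k = x) -> converges_to b u x.
Proof.
move=> Su H e e0; exists N => k /H ->; rewrite subrr.
by rewrite (linear_on0 subS (linear_onl bS (subspace0 subS))).
Qed.

Lemma converges_cvg u x : (forall k, S (u k)) -> S x ->
  converges_to b u x <-> (b (u k - x) (u k - x) @[k --> \oo] --> (0 : R)).
Proof.
move=> Su Sx; split => [ux|/cvgrPdist_lt ux e e0].
  apply/cvgrPdist_lt => e e0; have [N H] := ux e e0; exists N => // k /= Nk.
  by rewrite sub0r normrN ger0_norm ?H// b0//; exact: subspaceB.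
have [N _ H] := ux e e0; exists N => k Nk; have := H k Nk.
by rewrite sub0r normrN ger0_norm// b0//; exact: subspaceB.
Qed.

End hilbert_limits.

(** * Square-integrable functions *)

Section square_integrable.
Context d {T : measurableType d} {R : realType}.
Variable mu : {measure set T -> \bar R}.
Implicit Types f g h u v : T -> R.

Definition L2norm2 f : \bar R := (\int[mu]_x (f x ^+ 2)%:E)%E.

Definition L2on : set (T -> R) := [set f | f \in Lfun mu 2%:E].

Definition L2dot f g : R := \int[mu]_x (f x * g x).

(** Lower semicontinuity of the integral. It passes uniform bounds to pointwise limits three times:
    for the completeness of L^2, for the limit e -> 0 in the smoothed Plancherel inequality, and for
    the gradient of a test function. *)
Lemma fatou_le (f_ : nat -> T -> R) f (c : \bar R) :
  (forall n, measurable_fun setT (f_ n)) -> measurable_fun setT f ->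
  (forall n x, 0 <= f_ n x) -> (forall x, 0 <= f x) -> {ae mu, forall x, f_ ^~ x @ \oo --> f x} ->
  (forall n, (\int[mu]_x (f_ n x)%:E <= c)%E) -> (\int[mu]_x (f x)%:E <= c)%E.
Proof.
move=> mf_ mf f0 fge0 cf fc.
have mEf n : measurable_fun setT (EFin \o f_ n) by exact/measurable_EFinP.
have f_ge0 n x : setT x -> (0 <= (EFin \o f_ n) x)%E by rewrite /= lee_fin.
have fat := fatou mu measurableT mEf f_ge0.
have mlim : measurable_fun setT (fun x => limn_einf (fun n => (f_ n x)%:E)).
  under eq_fun do rewrite limn_einf_lim.
  (* The sequence [einfs] converges, so its limit is its upper limit, and measurability of upper
     limits applies. *)
  have -> : (fun x => limn (einfs (fun n => (f_ n x)%:E))) =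
      (fun x => limn_esup (einfs (fun n => (f_ n x)%:E))).
    by apply/funext => x; rewrite is_cvg_limn_esupE//; exact: is_cvg_einfs.
  apply: measurable_realfun.measurable_fun_limn_esup => n.
  exact: measurable_realfun.measurable_fun_einfs.
have limE x : f_ ^~ x @ \oo --> f x -> limn_einf (fun n => (f_ n x)%:E) = (f x)%:E.
  move=> fx; have fx' : (f_ n x)%:E @[n --> \oo] --> (f x)%:E.
    by apply: cvg_EFin; [exact: nearW|exact: fx].
  rewrite is_cvg_limn_einfE; last by apply/cvg_ex; exists (f x)%:E.
  exact/cvg_lim.
have lim0 x : (0 <= limn_einf (fun n => (f_ n x)%:E))%E.
  rewrite limn_einf_lim; apply: lime_ge; first exact: is_cvg_einfs.
  by apply: nearW => n; apply: le_ereal_inf_tmp => _ [m /= _ <-]; rewrite lee_fin.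
have -> : (\int[mu]_x (f x)%:E = \int[mu]_x (limn_einf (fun n => (f_ n x)%:E)))%E.
  apply: ge0_ae_eq_integral => //.
  - exact/measurable_EFinP.
  - by move=> x _; rewrite lee_fin.
  - by apply: filterS cf => x /limE -> _.
apply: (le_trans fat); rewrite limn_einf_lim; apply: lime_le; first exact: is_cvg_einfs.
apply: nearW => n; apply: le_trans (fc n).
by apply: ereal_inf_lbound; exists n => /=.
Qed.

Lemma sqr_absE (a : R) : (`|a%:E| `^ 2)%E = (a ^+ 2)%:E.
Proof. by rewrite abse_EFin poweR_EFin powR_mulrn// real_normK ?num_real. Qed.

Lemma L2onP f : L2on f <-> measurable_fun setT f /\ (L2norm2 f < +oo)%E.
Proof.
split=> [|[mf f2]].
  move=> Lf; have mf : measurable_fun setT f.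
    by move: (Lf); rewrite /L2on/= inE => /andP[]; rewrite inE.
  split=> //.
  have /integrableP[_] := Lfun2_integrable_sqr Lf.
  apply: le_lt_trans; apply: ge0_le_integral => //.
  - by move=> x _; rewrite lee_fin sqr_ge0.
  - apply/measurable_EFinP; apply: measurable_funX.
    exact: mf.
  - apply: measurableT_comp => //; apply/measurable_EFinP; exact: measurable_funX.
  - by move=> x _; rewrite /= lee_fin ler_norm.
rewrite /L2on/= inE; apply/andP; split; rewrite inE//=.
rewrite /finite_norm unlock; apply: poweR_lty; apply: le_lt_trans f2.
rewrite /L2norm2; under eq_integral => x _.
  rewrite (sqr_absE (f x)); over.
by [].
Qed.

Lemma L2on_measurable f : L2on f -> measurable_fun setT f.
Proof. by case/L2onP. Qed.

Lemma L2norm2_lty f : L2on f -> (L2norm2 f < +oo)%E.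
Proof. by case/L2onP. Qed.

Lemma L2norm2_ge0 f : (0 <= L2norm2 f)%E.
Proof. by apply: integral_ge0 => x _; rewrite lee_fin sqr_ge0. Qed.

Lemma L2norm2_fin f : L2on f -> L2norm2 f \is a fin_num.
Proof. by move=> Lf; rewrite ge0_fin_numE ?L2norm2_ge0//; exact: L2norm2_lty. Qed.

Lemma L2dotE f : L2dot f f = fine (L2norm2 f).
Proof. by rewrite /L2dot /Rintegral; under eq_integral do rewrite -expr2. Qed.

Lemma L2dot_norm2 f : L2on f -> (L2dot f f)%:E = L2norm2 f.
Proof. by move=> Lf; rewrite L2dotE fineK//; exact: L2norm2_fin. Qed.

Lemma LnormE f : ('N[mu]_2%:E[EFin \o f] = L2norm2 f `^ 2^-1)%E.
Proof.
rewrite unlock; congr poweR; apply: eq_integral => x _.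
exact: (sqr_absE (f x)).
Qed.

Lemma subspace_L2 : subspace L2on.
Proof.
have [L0 LD] := @Lfun_submod_closed _ T R mu 2%:E ltac:(by rewrite lee_fin ler1n).
by split => // a x y Lx Ly; exact: LD.
Qed.

Lemma integrable_mul f g : L2on f -> L2on g ->
  mu.-integrable setT (EFin \o (fun x => f x * g x)).
Proof. by move=> Lf Lg; apply/Lfun1_integrable; exact: Lfun2_mul_Lfun1. Qed.

Lemma symbilinear_L2dot : symbilinear_on L2on L2dot.
Proof.
split=> [f g _ _|g Lg a f h Lf Lh].
  by apply: eq_Rintegral => x _; rewrite mulrC.
rewrite /L2dot -RintegralZl//; last exact: integrable_mul.
rewrite -RintegralD//; last 2 first.
- by have := integrableZl measurableT a (integrable_mul Lf Lg); exact: eq_integrable.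
- exact: integrable_mul.
by apply: eq_Rintegral => x _; rewrite mulrDl mulrA.
Qed.

Lemma L2dot_ge0 f : 0 <= L2dot f f.
Proof. by apply: Rintegral_ge0 => x _; rewrite -expr2 sqr_ge0. Qed.

Lemma L2on_le f g : measurable_fun setT f -> (forall x, `|f x| <= `|g x|) ->
  L2on g -> L2on f.
Proof.
move=> mf fg /L2onP[mg g2]; apply/L2onP; split => //; apply: le_lt_trans g2.
apply: ge0_le_integral => //.
- by move=> x _; rewrite lee_fin sqr_ge0.
- by apply/measurable_EFinP; exact: measurable_funX.
- by apply/measurable_EFinP; exact: measurable_funX.
- by move=> x _; rewrite lee_fin -[leLHS]real_normK ?num_real// -[leRHS]real_normK ?num_real// lerXn2r ?nnegrE.
Qed.

Lemma L2norm2_ae f g : measurable_fun setT f -> measurable_fun setT g ->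
  f = g %[ae mu] -> L2norm2 f = L2norm2 g.
Proof.
move=> mf mg fg; apply: ge0_ae_eq_integral => //.
- by apply/measurable_EFinP; exact: measurable_funX.
- by apply/measurable_EFinP; exact: measurable_funX.
- by move=> x _; rewrite lee_fin sqr_ge0.
- by move=> x _; rewrite lee_fin sqr_ge0.
- by apply: filterS fg => x /= + _ => ->.
Qed.

Lemma L2on_ae f g : measurable_fun setT g -> f = g %[ae mu] -> L2on f -> L2on g.
Proof.
move=> mg fg Lf; apply/L2onP; split => //.
by rewrite -(L2norm2_ae (L2on_measurable Lf) mg fg); exact: L2norm2_lty.
Qed.

Lemma L2dot_ae f f' g g' : L2on f -> L2on f' -> L2on g -> L2on g' ->
  f = f' %[ae mu] -> g = g' %[ae mu] -> L2dot f g = L2dot f' g'.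
Proof.
move=> Lf Lf' Lg Lg' ff gg; congr fine; apply: ae_eq_integral => //.
- exact: measurable_int (integrable_mul Lf Lg).
- exact: measurable_int (integrable_mul Lf' Lg').
- by apply: filterS2 ff gg => x + + _ => -> // ->.
Qed.

Lemma L2norm2_eq0 f : measurable_fun setT f -> L2norm2 f = 0%E -> f = cst 0 %[ae mu].
Proof.
move=> mf f0.
have m2 : measurable_fun setT (fun x => (f x ^+ 2)%:E).
  by apply/measurable_EFinP; exact: measurable_funX.
have /(ae_eq_integral_abs mu measurableT m2) : (\int[mu]_x `|(f x ^+ 2)%:E| = 0)%E.
  by rewrite -f0; apply: eq_integral => x _; rewrite gee0_abs// lee_fin sqr_ge0.
by apply: filterS => x /(_ I)[/eqP]; rewrite sqrf_eq0 => /eqP.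
Qed.

Lemma L2dot_eq0 f : L2on f -> L2dot f f = 0 -> f = cst 0 %[ae mu].
Proof.
move=> Lf f0; apply: L2norm2_eq0; first exact: L2on_measurable.
by rewrite -L2dot_norm2// f0.
Qed.

(** With squared increments of order 4^-k, the weighted sum of 2^k |u_(k+1) - u_k|^2 still has a
    finite integral, hence is finite almost everywhere; this forces absolute convergence of the
    telescoping series there. *)
Lemma L2_fast_cauchy (u_ : nat -> T -> R) : (forall k, L2on (u_ k)) ->
  (forall k, L2dot (u_ k.+1 - u_ k) (u_ k.+1 - u_ k) <= (4 ^ k.+1)%:R^-1) ->
  exists2 v : T -> R, measurable_fun setT v &
    {ae mu, forall x, u_ ^~ x @ \oo --> v x}.
Proof.
move=> Lu cu; pose D k x := (u_ k.+1 x - u_ k x) ^+ 2.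
pose G k x : R := (2 ^ k.+1)%:R * D k x.
have LB k : L2on (u_ k.+1 - u_ k) by apply: subspaceB => //; exact: subspace_L2.
have mD k : measurable_fun setT (D k).
  by apply: measurable_funX; apply: measurable_funB; exact: L2on_measurable.
have mG k : measurable_fun setT (EFin \o G k).
  by apply/measurable_EFinP; apply: measurable_funM => //.
have G0 k x : 0 <= G k x by rewrite mulr_ge0// sqr_ge0.
have iG k : (\int[mu]_x (G k x)%:E <= (1 / (2 ^ k.+1)%:R)%:E)%E.
  under eq_integral do rewrite EFinM.
  rewrite ge0_integralZl_EFin//; last 2 first.
    by move=> x _; rewrite lee_fin sqr_ge0.
    exact/measurable_EFinP.
  have -> : (\int[mu]_x (D k x)%:E = L2norm2 (u_ k.+1 - u_ k)%R)%E by [].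
  rewrite -L2dot_norm2// -EFinM lee_fin.
  apply: (@le_trans _ _ ((2 ^ k.+1)%:R * (4 ^ k.+1)%:R^-1)); first by rewrite ler_wpM2l.
  rewrite (_ : 4 ^ k.+1 = 2 ^ k.+1 * 2 ^ k.+1)%N; last by rewrite -expnMn.
  by rewrite natrM invfM mulrA mulfV ?mul1r// pnatr_eq0 -lt0n expn_gt0.
pose S x := (\sum_(0 <= k <oo) (G k x)%:E)%E.
have mS : measurable_fun setT S.
  apply: (ge0_emeasurable_sum (h := fun k x => (G k x)%:E) (P := xpredT)) => //.
    by move=> k x _ _; rewrite lee_fin.
  by move=> k _; exact: mG.
have iS : (\int[mu]_x S x < +oo)%E.
  rewrite /S integral_nneseries//; last by move=> k x _; rewrite /= lee_fin.
  apply: (@le_lt_trans _ _ (\sum_(0 <= k <oo) (1 / (2 ^ k.+1)%:R)%:E)%E).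
    by apply: lee_nneseries => [k _ _|k _]; [apply: integral_ge0 => x _; rewrite lee_fin|exact: iG].
  by apply: le_lt_trans (epsilon_trick0 xpredT ler01) _; rewrite ltry.
have S0 x : (0 <= S x)%E by apply: nneseries_ge0 => k _ _; rewrite lee_fin.
have iSi : mu.-integrable setT S.
  by apply/integrableP; split => //; under eq_integral do rewrite gee0_abs//.
pose A := [set x | S x \is a fin_num].
have mA : measurable A.
  by have := emeasurable_fin_num measurableT mS; rewrite setTI.
have cA x : A x -> cvgn (u_ ^~ x).
  move=> Ax.
  have c1 : cvgn (series (G ^~ x)).
    by apply: nnseries_is_cvg => //; rewrite -ge0_fin_numE//; exact: S0.
  have c2 : cvgn (series (fun k => 1 / (2 ^ k.+1)%:R : R)).
    apply: nnseries_is_cvg => [k|]; first by rewrite divr_ge0.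
    by apply: le_lt_trans (epsilon_trick0 xpredT ler01) _; rewrite ltry.
  (* For an increment of size y and a = 2^(k+1), one has y <= 1/a + a y^2: the first terms form a
     geometric series, the second ones sum to [S x]. *)
  have c3 : cvgn (series (telescope (u_ ^~ x))).
    apply: normed_cvg; apply: (@series_le_cvg _ _ (fun k => 1 / (2 ^ k.+1)%:R + G k x)) => //.
    - by move=> k; rewrite /= normr_ge0.
    - by move=> k; rewrite addr_ge0// divr_ge0.
    - move=> k; rewrite /= /telescope /G /D; set z := u_ k.+1 x - u_ k x.
      rewrite -[z ^+ 2]real_normK ?num_real//; move: `|z| (normr_ge0 z) => y y0.
      have : 0 < (2 ^ k.+1)%:R :> R by rewrite ltr0n expn_gt0.
      move: (_ %:R) => a a0.
      have -> : 1 / a + a * y ^+ 2 = a^-1 * (1 + (a * y) ^+ 2).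
        by field; rewrite gt_eqF.
      rewrite -[leLHS](mulKf (lt0r_neq0 a0)) ler_pM2l ?invr_gt0//.
      have := sqr_ge0 (a * y - 1); have : 0 <= a * y by rewrite mulr_ge0// ltW.
      nra.
    - by apply: is_cvg_seriesD.
  have -> : u_ ^~ x = (fun n => u_ 0%N x + series (telescope (u_ ^~ x)) n).
    by apply/funext => n; rewrite -eq_sum_telescope.
  by apply: is_cvgD => //; exact: is_cvg_cst.
(* Multiplying by the indicator of [A] makes the sequence converge at every point, which yields a
   measurable limit. *)
pose w_ k x := u_ k x * \1_A x.
exists (fun x => limn (w_ ^~ x)).
  apply: (@measurable_realfun.measurable_fun_cvg _ _ _ _ w_).
    by move=> k; apply: measurable_funM; [exact: L2on_measurable|exact: measurable_indic].
  move=> x _; have [Ax|nAx] := pselect (A x).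
    by rewrite /w_ indicE mem_set//; under eq_fun do rewrite mulr1; exact: cA.
  by rewrite /w_ indicE memNset//; under eq_fun do rewrite mulr0; exact: is_cvg_cst.
apply: filterS (integrable_ae measurableT iSi) => x /(_ I) Ax.
by rewrite /w_ indicE mem_set//; under [X in _ --> limn X]eq_fun do rewrite mulr1; exact: cA.
Qed.

Lemma L2_complete : complete_on L2on L2dot.
Proof.
move=> u Lu cu.
have /choice[N HN] k : exists N, forall i j, (N <= i)%N -> (N <= j)%N ->
    L2dot (u i - u j) (u i - u j) < (4 ^ k.+1)%:R^-1.
  by apply: cu; rewrite invr_gt0 ltr0n expn_gt0.
(* The sum makes [phi] nondecreasing and at least [N k]; the summand k makes it tend to infinity. *)
pose phi k := (k + \sum_(i < k.+1) N i)%N.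
have Nphi k : (N k <= phi k)%N by rewrite /phi big_ord_recr/= addnA leq_addl.
have phiS k : (phi k <= phi k.+1)%N.
  by rewrite /phi [in leqRHS]big_ord_recr/= leq_add// leq_addr.
have phi_ge k : (k <= phi k)%N by exact: leq_addr.
have [v mv uv] : exists2 v : T -> R, measurable_fun setT v &
    {ae mu, forall x, (fun k => u (phi k) x) @ \oo --> v x}.
  apply: (@L2_fast_cauchy (u \o phi)) => k; first exact: Lu.
  by apply/ltW/HN; [exact: leq_trans (Nphi k) (phiS k)|exact: Nphi].
have LB i j : L2on (u i - u j) by apply: subspaceB => //; exact: subspace_L2.
(* Fatou along the subsequence turns the Cauchy bound for the whole sequence into a bound on the
   distance to the limit. *)
have key (e : R) n : (forall i j, (n <= i)%N -> (n <= j)%N -> L2dot (u i - u j) (u i - u j) < e) ->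
    forall i, (n <= i)%N -> (L2norm2 (u i - v)%R <= e%:E)%E.
  move=> He i ni; apply: (@fatou_le (fun k x => (u i x - u (phi (n + k)%N) x) ^+ 2)).
  - move=> k; apply: measurable_funX.
    by apply: measurable_funB; exact: L2on_measurable.
  - apply: measurable_funX.
    by apply: measurable_funB => //; exact: L2on_measurable.
  - by move=> k x; exact: sqr_ge0.
  - by move=> x; exact: sqr_ge0.
  - apply: filterS uv => x ux.
    have c1 : (u i x - u (phi (n + k)%N) x) @[k --> \oo] --> u i x - v x.
      apply: cvgB; first exact: cvg_cst.
      apply: (@cvg_comp _ _ _ (addn n) (fun k => u (phi k) x) _ _ _ _ ux).
      move=> A [m _ HA]; exists m => // k /= mk; apply: HA => /=.
      exact: leq_trans mk (leq_addl _ _).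
    by under eq_fun do rewrite expr2; rewrite expr2; exact: cvgM.
  - move=> k; rewrite -[leLHS]/(L2norm2 (u i - u (phi (n + k)%N))) -L2dot_norm2// lee_fin.
    apply/ltW/He => //; apply: leq_trans (phi_ge _); exact: leq_addr.
have Lv : L2on v.
  have [n Hn] := cu 1 ltr01; have := key _ _ Hn n (leqnn n) => h.
  have -> : v = u n - (u n - v) by rewrite opprB addrC subrK.
  apply: subspaceB => //; first exact: subspace_L2.
  apply/L2onP; split; first by apply: measurable_funB => //; exact: L2on_measurable.
  by apply: le_lt_trans h _; rewrite ltry.
exists v => // e e0; have [n Hn] := cu (e / 2) (divr_gt0 e0 (ltr0Sn _ _)).
exists n => i ni; have := key _ _ Hn i ni; rewrite -L2dot_norm2; last first.
  by apply: subspaceB => //; exact: subspace_L2.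
by rewrite lee_fin => /le_lt_trans; apply; rewrite ltr_pdivrMr// ltr_pMr// ltr1n.
Qed.

Lemma hilbert_L2 : hilbert L2on L2dot.
Proof.
split; [exact: subspace_L2|exact: symbilinear_L2dot| |exact: L2_complete].
by move=> f _; exact: L2dot_ge0.
Qed.

End square_integrable.

(** * Lebesgue measure on row vectors *)

Section rV_boxes.
Context {R : realType} (n : nat).
Local Notation V := 'rV[R]_n.
Local Notation mu := (lebesgue_rV n : {measure set 'rV[R]_n -> \bar R}).

Definition box (a b : V) : set V :=
  [set x | forall i, `]a ord0 i, b ord0 i]%classic (x ord0 i)].

Definition boxes : set (set V) := [set box p.1 p.2 | p in [set: V * V]].

Definition cube (r : R) : set V := box (const_mx (- r)) (const_mx r).

Lemma measurable_rV_box (a b : V) : measurable (box a b).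
Proof.
apply: (@measurable_box _ _ (fun i => `]a ord0 i, b ord0 i]%classic)) => i.
exact: measurable_itv.
Qed.

Lemma boxes_setI : setI_closed boxes.
Proof.
move=> _ _ [[a b] _ <-] [[a' b'] _ <-] /=.
exists (\row_i Num.max (a ord0 i) (a' ord0 i), \row_i Num.min (b ord0 i) (b' ord0 i)) => //=.
apply/seteqP; split => x /=.
  by move=> H; split=> i; have := H i;
    rewrite /= !mxE !in_itv/= gt_max le_min => /andP[/andP[h1 h2] /andP[h3 h4]];
    rewrite ?h1 ?h2 ?h3 ?h4.
move=> [H H'] i; have /= := H i; have /= := H' i.
by rewrite !mxE !in_itv/= gt_max le_min => /andP[-> ->] /andP[-> ->].
Qed.

Lemma cube_cover : \bigcup_k cube k%:R = [set: V].
Proof.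
apply/seteqP; split => // x _; pose M := \big[Num.max/0]_i `|x ord0 i|.
exists (Num.truncn M).+1 => // i /=; rewrite in_itv/= !mxE.
have : `|x ord0 i| < (Num.truncn M).+1%:R.
  apply: le_lt_trans (truncnS_gt M); exact: (le_bigmax _ (fun i => `|x ord0 i|)).
by rewrite ltr_norml => /andP[-> /ltW ->].
Qed.

(** Boxes are stable under intersection, so this opens the way to Dynkin's lemma: for the uniqueness
    of measures, and for functions whose integrals over all boxes vanish. *)
Lemma measurable_rVE : @measurable _ V = <<s boxes >>.
Proof.
apply/seteqP; split; last first.
  apply: smallest_sub; first exact: sigma_algebra_measurable.
  by move=> _ [[a b] _ <-]; exact: measurable_rV_box.
apply: smallest_sub; first exact: smallest_sigma_algebra.
rewrite -bigcup_seq; apply: bigcup_sub => i _ A [B mB <-].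
have mi : @measurable_fun _ _ (g_sigma_algebraType boxes) R setT (rV_coord i).
  apply: (measurability _ (RGenOInfty.measurableE R)) => _ [_ [y ->] <-].
  rewrite setTI.
  have -> : rV_coord i @^-1` `]y, +oo[%classic =
      \bigcup_k box (\row_j if j == i then y else - k%:R) (const_mx k%:R).
    apply/seteqP; split => x /=.
      rewrite in_itv/= andbT => yx.
      have : [set: V] x by []; rewrite -cube_cover => -[k _ Hk].
      exists k => // j; have /= := Hk j; rewrite !in_itv/= !mxE => /andP[h ->].
      by rewrite andbT; case: eqP => // ->.
    move=> [k _ /(_ i)]; rewrite /= !in_itv/= !mxE eqxx andbT => /andP[]//.
  apply: bigcup_measurable => k _; apply: sub_sigma_algebra.
  by exists (\row_j if j == i then y else - k%:R, const_mx k%:R).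
exact: (mi measurableT B mB).
Qed.

Lemma lebesgue_box (a b : V) : mu (box a b) =
  (\prod_i (if a ord0 i < b ord0 i then b ord0 i - a ord0 i else 0))%:E.
Proof.
rewrite [LHS](lebesgue_rV_box (fun i => measurable_itv _)).
rewrite -prodEFin; apply: eq_bigr => i _.
by rewrite lebesgue_measure_itv/= lte_fin; case: ifP.
Qed.

Lemma lebesgue_cube_lty r : (mu (cube r) < +oo)%E.
Proof. by rewrite /cube lebesgue_box ltry. Qed.

Lemma measure_rV_unique (m1 m2 : {measure set V -> \bar R}) :
  (forall a b, m1 (box a b) = m2 (box a b)) ->
  (forall k : nat, (m1 (cube k%:R) < +oo)%E) ->
  forall A, measurable A -> m1 A = m2 A.
Proof.
move=> m12 fin1; apply: (measure_unique boxes (fun k : nat => cube k%:R)) => //.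
- exact: measurable_rVE.
- exact: boxes_setI.
- by move=> k; exists (const_mx (- k%:R), const_mx k%:R).
- exact: cube_cover.
- by move=> _ [[a b] _ <-]; exact: m12.
Qed.

Lemma measurable_translation (h : V) : measurable_fun setT (fun x : V => x + h).
Proof.
apply: measurable_rV => i; rewrite (_ : _ \o _ = fun x => rV_coord i x + h ord0 i); last first.
  by apply/funext => x; rewrite /= /rV_coord mxE.
by apply: measurable_funD => //; exact: measurable_rV_coord.
Qed.

Lemma lebesgue_rV_translation (h : V) A : measurable A ->
  pushforward mu (fun x => x + h) A = mu A.
Proof.
have mh := measurable_translation h.
have mbox a b : pushforward mu (fun x => x + h) (box a b) = mu (box a b).
  rewrite /pushforward.
  have -> : (fun x : V => x + h) @^-1` box a b = box (a - h) (b - h).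
    apply/seteqP; split => x /= H i; have := H i; rewrite /= !in_itv/= !mxE.
      by rewrite ltrBlDr lerBrDr.
    by rewrite ltrBlDr lerBrDr.
  rewrite !lebesgue_box; congr (_%:E); apply: eq_bigr => i _; rewrite !mxE.
  rewrite ltrD2r; case: ifP => // _; ring.
have fin k : (pushforward mu (fun x => x + h)%R (cube k%:R) < +oo)%E.
  by rewrite mbox; exact: lebesgue_cube_lty.
move=> mA; exact: (measure_rV_unique mbox fin).
Qed.

Lemma integral_translation (h : V) (f : V -> \bar R) : measurable_fun setT f ->
  (\int[mu]_x f (x + h)%R = \int[mu]_x f x)%E.
Proof.
move=> mf; have mh := measurable_translation h.
have ge0 (g : V -> \bar R) : measurable_fun setT g -> (forall x, 0 <= g x)%E ->
    (\int[mu]_x g (x + h)%R = \int[mu]_x g x)%E.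
  move=> mg g0.
  have := ge0_integral_pushforward mh mu measurableT mg (fun x _ => g0 x).
  rewrite preimage_setT => <-; apply: eq_measure_integral => A mA _.
  exact: lebesgue_rV_translation.
rewrite integralE [RHS]integralE; congr (_ - _)%E.
  rewrite -(ge0 _ (measurable_funepos mf)); last by move=> x; exact: funepos_ge0.
  by apply: eq_integral => x _; rewrite !funeposE.
rewrite -(ge0 _ (measurable_funeneg mf)); last by move=> x; exact: funeneg_ge0.
by apply: eq_integral => x _; rewrite !funenegE.
Qed.

Lemma open_measurable_rV (U : set V) : open U -> measurable U.
Proof.
move=> oU.
pose B (p : 'rV[rat]_n * 'rV[rat]_n) := box (map_mx ratr p.1) (map_mx ratr p.2).
have -> : U = \bigcup_(p in [set p | B p `<=` U]) B p.
  apply/seteqP; split => [x Ux|x [p Bp]]; last exact: Bp.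
  have /nbhs_ballP[e /= e0 He] : nbhs x U by exact: open_nbhs_nbhs.
  have lo i : exists q : rat, x ord0 i - e < ratr q < x ord0 i.
    have [|q] := @rat_in_itvoo R (x ord0 i - e) (x ord0 i); first by rewrite ltrBlDr ltrDl.
    by rewrite in_itv/=; exists q.
  have hi i : exists q : rat, x ord0 i < ratr q < x ord0 i + e.
    have [|q] := @rat_in_itvoo R (x ord0 i) (x ord0 i + e); first by rewrite ltrDl.
    by rewrite in_itv/=; exists q.
  have /choice[a aP] := lo; have /choice[b bP] := hi.
  exists (\row_i a i, \row_i b i).
    move=> y By; apply: He; split => // i j; rewrite (ord1 i) /ball/= ltr_norml.
    have := By j; rewrite /= in_itv/= !mxE => /andP[h1 h2].
    have /andP[h3 _] := aP j; have /andP[_ h4] := bP j; apply/andP; split; lra.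
  move=> i; rewrite /= in_itv/= !mxE; have /andP[_ ->] := aP i.
  by have /andP[/ltW -> _] := bP i.
rewrite bigcup_mkcond; apply: countable_bigcupT_measurable; first exact: countableP.
by move=> p; case: ifP => // _; exact: measurable_rV_box.
Qed.

Lemma continuous_measurable_rV (f : V -> R) : continuous f -> measurable_fun setT f.
Proof.
move=> cf; apply: (measurability _ (RGenOInfty.measurableE R)) => _ [_ [y ->] <-].
rewrite setTI; apply: open_measurable_rV; apply: open_comp; first by move=> x _; exact: cf.
exact: rray_open.
Qed.

Lemma measurable_dotrV (x : V) : measurable_fun setT (fun y => dotrV x y).
Proof.
by apply: measurable_sum => i; apply: measurable_funM => //; exact: measurable_rV_coord.
Qed.

Lemma measurable_dotrV2 : measurable_fun setT (fun p : V * V => dotrV p.1 p.2).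
Proof.
apply: measurable_sum => i; apply: measurable_funM.
  by apply: (measurableT_comp (measurable_rV_coord i)); exact: measurable_fst.
by apply: (measurableT_comp (measurable_rV_coord i)); exact: measurable_snd.
Qed.

Lemma measurable_enorm : measurable_fun setT (@enorm R n).
Proof.
apply: measurableT_comp => //; last first.
  by apply: measurable_sum => i; apply: measurable_funM => //; exact: measurable_rV_coord.
exact: continuous_measurable_fun (@sqrt_continuous R).
Qed.

Lemma dotrV_ge0 (x : V) : 0 <= dotrV x x.
Proof. by apply: sumr_ge0 => i _; rewrite -expr2 sqr_ge0. Qed.

Lemma enorm_ge0 (x : V) : 0 <= enorm x. Proof. exact: sqrtr_ge0. Qed.

Lemma enorm_sqr (x : V) : enorm x ^+ 2 = dotrV x x.
Proof. by rewrite sqr_sqrtr// dotrV_ge0. Qed.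

Lemma coord_le_enorm (x : V) i : `|x ord0 i| <= enorm x.
Proof.
rewrite -sqrtr_sqr ler_wsqrtr// /dotrV (bigD1 i)//= -expr2 lerDl.
by apply: sumr_ge0 => j _; rewrite -expr2 sqr_ge0.
Qed.

Definition eball (k : R) : set V := [set x | enorm x <= k].

Lemma measurable_eball k : measurable (eball k).
Proof.
rewrite (_ : eball k = setT `&` (@enorm R n) @^-1` `]-oo, k]%classic); last first.
  by apply/seteqP; split => x /=; rewrite in_itv/=; [split|case].
by apply: measurable_enorm => //; exact: measurable_itv.
Qed.

Lemma eball_sub_cube k r : k < r -> eball k `<=` cube r.
Proof.
move=> kr x /= xk i; rewrite /= in_itv/= !mxE.
have : `|x ord0 i| < r by exact: le_lt_trans (le_trans (coord_le_enorm x i) xk) kr.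
by rewrite ltr_norml => /andP[-> /ltW ->].
Qed.

Lemma lebesgue_eball_lty k : (mu (eball k) < +oo)%E.
Proof.
apply: le_lt_trans (lebesgue_cube_lty (k + 1)); apply: le_measure; rewrite ?inE.
- exact: measurable_eball.
- exact: measurable_rV_box.
- by apply: eball_sub_cube; rewrite ltrDl.
Qed.

Lemma bounded_sub_eball (A : set V) : bounded_set A ->
  exists k : nat, A `<=` eball k%:R.
Proof.
move=> [M [_ HM]]; pose r := `|M| + 1.
have Ar x : A x -> `|x| <= r by apply: HM; rewrite (le_lt_trans (ler_norm M))// ltrDl.
have r0 : 0 <= r by rewrite addr_ge0.
(* An integer m above n r^2 bounds the squared Euclidean norm, and m <= m^2, so m also serves as
   radius. *)
exists (Num.truncn (n%:R * r ^+ 2)).+1 => x Ax /=.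
have h : dotrV x x <= n%:R * r ^+ 2.
  rewrite /dotrV (le_trans (ler_sum _ (G := fun=> r ^+ 2) _))//.
    move=> i _; rewrite -expr2 -real_normK ?num_real// lerXn2r ?nnegrE//.
    apply: le_trans (Ar x Ax); rewrite -[leRHS]/(mx_norm x) mx_normrE.
    by apply/bigmax_geP; right => /=; exists (ord0, i).
  by rewrite sumr_const card_ord mulr_natl.
have m0 : 0 <= n%:R * r ^+ 2 by rewrite mulr_ge0// sqr_ge0.
set m := (Num.truncn _).+1; have hm : n%:R * r ^+ 2 < m%:R by exact: truncnS_gt.
rewrite /eball/= -(@ler_pXn2r _ 2)// ?nnegrE ?enorm_ge0// enorm_sqr (le_trans h)// (le_trans (ltW hm))//.
by rewrite -natrX ler_nat -[leqLHS]expn1 leq_pexp2l.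
Qed.

End rV_boxes.

(** * Poisson kernels *)

Section exponential_kernel.
Context {R : realType}.
Implicit Types (e z t : R).
Local Notation leb := (@lebesgue_measure R).

Definition expabs e t : R := expR (- (e * `|t|)).

(** The Fourier integral of exp(- e |t|); it is 2 pi times the Poisson kernel of the half-plane at
    height e. *)
Definition poisson1 e t : R := 2 * e / (e ^+ 2 + t ^+ 2).

Lemma expabs_ge0 e t : 0 <= expabs e t. Proof. exact: expR_ge0. Qed.

Lemma expabs_le1 e t : 0 <= e -> expabs e t <= 1.
Proof. by move=> e0; rewrite -expR0 ler_expR oppr_le0 mulr_ge0. Qed.

Lemma continuous_expabs e : continuous (expabs e).
Proof.
move=> t; apply: (@continuous_comp _ _ _ (fun t => - (e * `|t|)) expR).
  apply: cvgN; apply: cvgMl_tmp; exact: norm_continuous.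
exact: continuous_expR.
Qed.

Lemma measurable_expabs e : measurable_fun setT (expabs e).
Proof. by apply: continuous_measurable_fun; exact: continuous_expabs. Qed.

Lemma poisson1_ge0 e t : 0 <= e -> 0 <= poisson1 e t.
Proof. by move=> e0; rewrite divr_ge0 ?addr_ge0 ?sqr_ge0// mulr_ge0. Qed.

Lemma is_derive_mull (c t : R) : is_derive t (1 : R) (fun u => c * u) c.
Proof.
rewrite (_ : (fun u => _) = c \*: id)//.
by apply: is_derive_eq; rewrite /GRing.scale/= mulr1.
Qed.

Lemma continuous_cosM z : continuous (fun t => cos (z * t)).
Proof.
move=> t; apply: (@continuous_comp _ _ _ ( *%R z) cos); first exact: mulrl_continuous.
exact: continuous_cos.
Qed.

Lemma continuous_sinM z : continuous (fun t => sin (z * t)).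
Proof.
move=> t; apply: (@continuous_comp _ _ _ ( *%R z) sin); first exact: mulrl_continuous.
exact: continuous_sin.
Qed.

(** The summand 1 makes the integrand nonnegative, as required by the fundamental theorem of
    calculus on a half-line; it is subtracted again in [Rintegral_expabs_cos]. *)
Lemma integral_halfline_exp_cos e z : 0 < e ->
  (\int[leb]_(t in `[0%R, +oo[) (expR (- e * t) * (1 + cos (z * t)))%:E =
   (e^-1 + e / (e ^+ 2 + z ^+ 2))%:E)%E.
Proof.
move=> e0; have D0 : e ^+ 2 + z ^+ 2 != 0.
  by rewrite gt_eqF// ltr_wpDr ?sqr_ge0// exprn_gt0.
set D := e ^+ 2 + z ^+ 2 in D0 *.
pose F := (expR \o (fun u => - e * u)) * ((z / D) \*: (sin \o (fun u => z * u))
  - (e / D) \*: (cos \o (fun u => z * u)) - cst e^-1).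
have dF t : is_derive t (1 : R) F (expR (- e * t) * (1 + cos (z * t))).
  have dE := is_derive1_comp (is_derive_expR (- e * t)) (is_derive_mull (- e) t).
  have dS := is_derive1_comp (is_derive_sin (z * t)) (is_derive_mull z t).
  have dC := is_derive1_comp (is_derive_cos (z * t)) (is_derive_mull z t).
  apply: is_derive_eq; rewrite /GRing.scale/= /cst.
  rewrite !fctE /=.
  have ZE (a b : R) : a *: (b : R^o) = a * b by [].
  rewrite !ZE; move: (expR _) (sin _) (cos _) => E S C.
  by rewrite /D; field; rewrite -/D D0 gt_eqF.
have F0 : F 0 = - (e^-1 + e / D).
  rewrite /F/= !fctE /= !mulr0 expR0 sin0 cos0.
  by rewrite -[(e / D) *: _]/(e / D * 1) -[(z / D) *: _]/(z / D * 0); ring.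
have cF : continuous F.
  move=> t; apply: differentiable_continuous; apply/derivable1_diffP.
  exact: (@ex_derive _ _ _ _ _ _ _ (dF t)).
rewrite (@ge0_continuous_FTC2y _ _ F _ 0).
- by rewrite F0 -EFinB sub0r opprK.
- by move=> t _; rewrite mulr_ge0 ?expR_ge0.
- apply: (@continuous_subspaceT R R) => t; apply: cvgM.
    apply: (@continuous_comp _ _ _ ( *%R (- e)) expR); first exact: mulrl_continuous.
    exact: continuous_expR.
  by apply: cvgD; [exact: cvg_cst|exact: continuous_cosM].
- pose M := `|z / D| + `|e / D| + `|e^-1|.
  have Flim : (fun t => M * expR (- e * t)) t @[t --> +oo] --> 0.
    rewrite -(mulr0 M); apply: cvgMl_tmp.
    have -> : (fun t => expR (- e * t)) = (fun t => expR (- t)) \o ( *%R e).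
      by apply/funext => t /=; rewrite mulNr.
    apply: cvg_comp; last exact: cvgr_expR.
    apply/cvgryPge => A; near=> t; rewrite -ler_pdivrMl//.

  apply/norm_cvg0P.
  apply: (squeeze_cvgr _ (cvg_cst 0) Flim); apply: nearW => t.
  rewrite normr_ge0/= /F !fctE/= normrM ger0_norm ?expR_ge0// mulrC ler_wpM2r ?expR_ge0//.
  rewrite /GRing.scale/= /M (le_trans (ler_normB _ _))// lerD//.
  rewrite (le_trans (ler_normB _ _))// !normrM lerD//.
    by rewrite ler_piMr// ?mulr_ge0// ler_norml sin_geN1 sin_le1.
  by rewrite ler_piMr// ?mulr_ge0// ler_norml cos_geN1 cos_le1.
- by move=> t _; exact: (@ex_derive _ _ _ _ _ _ _ (dF t)).
- exact/cvg_at_right_filter/cF.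
- by move=> t _; rewrite derive1E; exact: (@derive_val _ _ _ _ _ _ _ (dF t)).
Unshelve. all: by end_near. Qed.

Lemma integral_exp_cos_ge0 e z : 0 < e ->
  (\int[leb]_t (expabs e t * (1 + cos (z * t)))%:E =
   (2 * e^-1 + poisson1 e z)%:E)%E.
Proof.
move=> e0; rewrite ge0_symfun_integralT; last 3 first.
- by move=> t; rewrite mulr_ge0 ?expR_ge0.
- move=> t; apply: (@cvgM _ _ _ _ (expabs e) (fun t => 1 + cos (z * t))).
    exact: continuous_expabs.
  by apply: cvgD; [exact: cvg_cst|exact: continuous_cosM].
- by move=> t /=; rewrite /expabs normrN mulrN cosN.
have -> : (\int[leb]_(t in [set x | (0 <= x)%R]) (expabs e t * (1 + cos (z * t)))%:E =
    (e^-1 + e / (e ^+ 2 + z ^+ 2))%:E)%E.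
  rewrite -integral_halfline_exp_cos// set_itvcy; apply: eq_integral => t.
  by rewrite inE/= => t0; rewrite /expabs ger0_norm// mulNr.
by rewrite -EFinM mulrDr /poisson1 mulrA.
Qed.

Lemma integral_expabs e : 0 < e -> (\int[leb]_t (expabs e t)%:E = (2 / e)%:E)%E.
Proof.
move=> e0; have := integral_exp_cos_ge0 0 e0.
have -> : (fun t => (expabs e t * (1 + cos (0 * t)))%:E) =
    (fun t => 2%:E * (expabs e t)%:E)%E.
  by apply/funext => t; rewrite mul0r cos0 -EFinM mulrC.
rewrite ge0_integralZl_EFin//; last 2 first.
- by move=> t _; rewrite lee_fin expabs_ge0.
- by apply/measurable_EFinP; exact: measurable_expabs.
have -> : 2 * e^-1 + poisson1 e 0 = 2 * (2 / e).
  by rewrite /poisson1; field; rewrite gt_eqF.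
rewrite EFinM => /(congr1 (fun x => (2^-1)%:E * x)%E).
by rewrite !muleA -EFinM mulVf ?mul1e.
Qed.

Lemma integrable_expabs e : 0 < e -> leb.-integrable setT (EFin \o expabs e).
Proof.
move=> e0; apply/integrableP; split; first by apply/measurable_EFinP; exact: measurable_expabs.
under eq_integral do rewrite gee0_abs ?lee_fin ?expabs_ge0//.
by rewrite integral_expabs// ltry.
Qed.

Lemma integrable_expabs_mul e (f : R -> R) : 0 < e -> measurable_fun setT f ->
  (forall t, `|f t| <= 1) -> leb.-integrable setT (EFin \o (fun t => expabs e t * f t)).
Proof.
move=> e0 mf f1; apply: le_integrable (integrable_expabs e0) => //.
  by apply/measurable_EFinP; apply: measurable_funM => //; exact: measurable_expabs.
move=> t _; rewrite /= lee_fin normrM ler_piMr//.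
Qed.

Lemma Rintegral_expabs_cos e z : 0 < e ->
  \int[leb]_t (expabs e t * cos (z * t)) = poisson1 e z.
Proof.
move=> e0; have mc : measurable_fun setT (fun t => cos (z * t)).
  by apply: continuous_measurable_fun; exact: continuous_cosM.
have ic := integrable_expabs_mul e0 mc (fun t => cos_max _).
have i1 := integrable_expabs e0.
have : \int[leb]_t (expabs e t + expabs e t * cos (z * t)) = 2 * e^-1 + poisson1 e z.
  rewrite /Rintegral -[RHS]/(fine (2 * e^-1 + poisson1 e z)%:E) -integral_exp_cos_ge0//.
  by congr fine; apply: eq_integral => t _; rewrite mulrDr mulr1.
by rewrite RintegralD//; rewrite {1}/Rintegral integral_expabs//= => /addrI.
Qed.

(** The integrand is odd and reflection preserves Lebesgue measure, so the finite integral equals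
    its opposite. *)
Lemma Rintegral_expabs_sin e z : 0 < e ->
  \int[leb]_t (expabs e t * sin (z * t)) = 0.
Proof.
move=> e0; have ms : measurable_fun setT (fun t => sin (z * t)).
  by apply: continuous_measurable_fun; exact: continuous_sinM.
have is_ := integrable_expabs_mul e0 ms (fun t => sin_max _).
pose f := fun t => (expabs e t * sin (z * t))%:E.
have mf : measurable_fun setT f by exact: measurable_int is_.
have mN : measurable_fun setT (-%R : R -> R) by exact: oppr_measurable.
have fN t : f (- t) = (- f t)%E by rewrite /f /expabs normrN mulrN sinN mulrN.
have iN : leb.-integrable ((-%R : R -> R) @^-1` setT) (f \o (-%R : R -> R)).
  rewrite preimage_setT; have -> : f \o (-%R : R -> R) = (fun t => (- f t)%E).
    by apply/funext => t; exact: fN.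
  exact: integrableN.
have h : (\int[leb]_t f t =
    \int[leb]_(t in (-%R : _ -> measurableTypeR R) @^-1` setT) (f \o -%R) t)%E.
  rewrite -integral_pushforward//=.
  by apply: eq_measure_integral => //= A mA _; exact/esym/lebesgue_measureN.
have : (\int[leb]_t f t = - \int[leb]_t f t)%E.
  rewrite [LHS]h preimage_setT -integralN.
    by apply: eq_integral => t _; rewrite /= fN.
  exact: integrable_add_def.
rewrite /Rintegral -/f; have := integrable_fin_num measurableT is_.
rewrite -/f; case: (\int[leb]_t f t)%E => //= r _ [] /eqP.
by rewrite -subr_eq0 opprK -mulr2n mulrn_eq0/= => /eqP.
Qed.

End exponential_kernel.

(** * Integrals of the one-dimensional Poisson kernel *)

Section poisson_kernel_line.
Context {R : realType}.
Local Notation leb := (@lebesgue_measure R).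

Lemma continuous_poisson1 (e : R) : 0 < e -> continuous (poisson1 e).
Proof.
move=> e0 t; apply: cvgM; first exact: cvg_cst.
apply: cvgV; first by rewrite gt_eqF// ltr_wpDr ?sqr_ge0// exprn_gt0.
by apply: cvgD; [exact: cvg_cst|exact: exprn_continuous].
Qed.

Lemma continuous_poisson1B (e x : R) : 0 < e -> continuous (fun t => poisson1 e (x - t)).
Proof.
move=> e0 t; apply: (@continuous_comp _ _ _ (fun t => x - t) (poisson1 e)).
  by apply: cvgB; [exact: cvg_cst|exact: cvg_id].
exact: continuous_poisson1.
Qed.

Lemma measurable_poisson1 (e : R) : 0 < e -> measurable_fun setT (poisson1 e).
Proof. by move=> e0; apply: continuous_measurable_fun; exact: continuous_poisson1. Qed.

Lemma measurable_poisson1B (e x : R) : 0 < e ->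
  measurable_fun setT (fun t : R => poisson1 e (x - t)).
Proof. by move=> e0; apply: continuous_measurable_fun; exact: continuous_poisson1B. Qed.

Lemma integral_poisson1_itv (e x a b : R) : 0 < e -> a <= b ->
  (\int[leb]_(t in `]a, b]) (poisson1 e (x - t))%:E =
   (2 * (atan ((b - x) / e) - atan ((a - x) / e)))%:E)%E.
Proof.
move=> e0; rewrite le_eqVlt => /predU1P[->|ab].
  by rewrite set_itvoc0 integral_set0 subrr mulr0.
rewrite integral_itv_obnd_cbnd; last first.
  apply: measurable_funTS; apply/measurable_EFinP; exact: measurable_poisson1B.
pose F := 2 \*: (@atan R \o (fun t => e^-1 * (t - x))).
have dF t : is_derive t (1 : R) F (poisson1 e (x - t)).
  have dL : is_derive t (1 : R) (fun u => e^-1 * (u - x)) e^-1.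
    rewrite (_ : (fun u => _) = e^-1 \*: (id - cst x))//.
    by apply: is_derive_eq; rewrite subr0 /GRing.scale/= mulr1.
  have dA := @is_derive1_comp _ (@atan R) (fun u => e^-1 * (u - x)) t _ _
    (is_derive1_atan (e^-1 * (t - x))) dL.
  apply: is_derive_eq; rewrite -[LHS]/(2 * _) /poisson1.
  rewrite -(sqrrN (x - t)) opprB; move: (t - x) => y.
  have h1 : e ^+ 2 + y ^+ 2 != 0.
    by rewrite gt_eqF// ltr_wpDr ?sqr_ge0// exprn_gt0.
  have -> : 1 + (e^-1 * y) ^+ 2 = (e ^+ 2 + y ^+ 2) / e ^+ 2.
    by field; rewrite gt_eqF.
  by field; rewrite h1 gt_eqF.
have cF : continuous F.
  move=> t; apply: differentiable_continuous; apply/derivable1_diffP.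
  exact: (@ex_derive _ _ _ _ _ _ _ (dF t)).
rewrite (@continuous_FTC2 _ _ F)//.
- rewrite -EFinB -[F b]/(2 * atan (e^-1 * (b - x))) -[F a]/(2 * atan (e^-1 * (a - x))).
  by rewrite -mulrBr ![e^-1 * _]mulrC.
- apply: (@continuous_subspaceT R R) => t; exact: continuous_poisson1B.
- split; first by move=> t _; exact: (@ex_derive _ _ _ _ _ _ _ (dF t)).
    exact/cvg_at_right_filter/cF.
  exact/cvg_at_left_filter/cF.
- by move=> t _; rewrite derive1E; exact: (@derive_val _ _ _ _ _ _ _ (dF t)).
Qed.

(** On a bounded interval the integral is twice a difference of two arctangents, hence below 2 pi;
    monotone convergence does the rest. The bound is independent of e, which is what the Plancherel
    inequality needs. *)
Lemma integral_poisson1_le (e x : R) : 0 < e ->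
  (\int[leb]_t (poisson1 e (x - t))%:E <= (2 * pi)%:E)%E.
Proof.
move=> e0; pose I (k : nat) := `](- k%:R), k%:R]%classic : set R.
have mp : measurable_fun setT (fun t : R => (poisson1 e (x - t))%:E).
  by apply/measurable_EFinP; exact: measurable_poisson1B.
have cv := @ge0_nondecreasing_set_cvg_integral _ (measurableTypeR R) R I
   (fun t => (poisson1 e (x - t))%:E) leb.
have IT : \bigcup_k I k = setT.
  apply/seteqP; split => // t _; exists (Num.truncn `|t|).+1 => //.
  rewrite /I/= in_itv/=; have : `|t| < (Num.truncn `|t|).+1%:R by exact: truncnS_gt.
  by rewrite ltr_norml => /andP[-> /ltW ->].
rewrite -IT; apply: (cvge_le _ (cv _ _ _ _)).
- apply: nearW => k; rewrite integral_poisson1_itv//; last by rewrite ge0_cp.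
  rewrite lee_fin; have := atan_ltpi2 ((k%:R - x) / e).
  have := atan_gtNpi2 ((- k%:R - x) / e); lra.
- move=> i j ij; apply/subsetPset => t; rewrite /I/= !in_itv/= => /andP[h1 h2].
  by rewrite (le_lt_trans _ h1) ?(le_trans h2)// ?lerN2 ler_nat.
- by move=> k; exact: measurable_itv.
- by move=> k; apply: measurable_funTS.
- by move=> k t _; rewrite lee_fin poisson1_ge0// ltW.
Qed.

End poisson_kernel_line.

(** * Iterated integration, one coordinate at a time *)

Section iterated_integrals.
Context {R : realType}.
Local Notation leb := (@lebesgue_measure R).
Local Notation mu n := (lebesgue_rV n : {measure set 'rV[R]_n -> \bar R}).

Lemma integral_rVS n (F : 'rV[R]_n.+1 -> \bar R) : measurable_fun setT F ->
  (forall x, 0 <= F x)%E ->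
  (\int[mu n.+1]_x F x = \int[leb]_a \int[mu n]_x F (cons_rV (a, x)))%E.
Proof.
move=> mF F0.
have := @ge0_integral_pushforward _ _ _ _ R _ (@measurable_cons_rV R n)
  (leb \x lebesgue_rV n)%E setT F measurableT mF (fun x _ => F0 x).
rewrite preimage_setT => h; rewrite -[LHS]/(\int[pushforward (leb \x lebesgue_rV n)%E (@cons_rV R n)]_x F x)%E.
rewrite [LHS]h fubini_tonelli1//=.
by apply: measurableT_comp => //; exact: measurable_cons_rV.
Qed.

Lemma Rintegral_rVS n (f : 'rV[R]_n.+1 -> R) :
  (mu n.+1).-integrable setT (EFin \o f) ->
  (forall a, (mu n).-integrable setT (EFin \o (fun x => f (cons_rV (a, x))))) ->
  \int[mu n.+1]_x f x = \int[leb]_a \int[mu n]_x f (cons_rV (a, x)).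
Proof.
move=> fi fai; have mf := measurable_int _ fi.
have ic : (leb \x lebesgue_rV n)%E.-integrable setT ((EFin \o f) \o @cons_rV R n).
  apply/integrableP; split.
    by apply: measurableT_comp => //; exact: measurable_cons_rV.
  have /integrableP[_] := fi; rewrite integral_rVS//; last first.
    by apply: measurableT_comp.
  rewrite fubini_tonelli1//.
  apply: measurableT_comp => //.
  by apply: measurableT_comp => //; exact: measurable_cons_rV.
congr fine.
have := @integral_pushforward _ _ _ _ R _ (@measurable_cons_rV R n)
  (leb \x lebesgue_rV n)%E setT (EFin \o f) mf.
rewrite preimage_setT => /(_ ic measurableT) h.
rewrite -[LHS]/(\int[pushforward (leb \x lebesgue_rV n)%E (@cons_rV R n)]_x (EFin \o f) x)%E.
rewrite [LHS]h -integral12_prod_meas1//; apply: eq_integral => a _.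
by rewrite /fubini_F/= /Rintegral fineK//; exact: integrable_fin_num (fai a).
Qed.

Lemma measurable_prod_coord n (f : 'I_n -> R -> R) :
  (forall i, measurable_fun setT (f i)) ->
  measurable_fun setT (fun x : 'rV[R]_n => \prod_i f i (x ord0 i)).
Proof.
move=> mf; apply: measurable_prod => i _.
by apply: (measurableT_comp (mf i)); exact: measurable_rV_coord.
Qed.

Lemma cons_rV0 n (a : R) (x : 'rV[R]_n) : cons_rV (a, x) ord0 ord0 = a.
Proof. by rewrite mxE unlift_none. Qed.

Lemma cons_rVS n (a : R) (x : 'rV[R]_n) i : cons_rV (a, x) ord0 (lift ord0 i) = x ord0 i.
Proof. by rewrite mxE liftK. Qed.

Lemma prod_cons_rV n (f : 'I_n.+1 -> R -> R) a (x : 'rV[R]_n) :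
  \prod_i f i (cons_rV (a, x) ord0 i) =
  f ord0 a * \prod_i f (lift ord0 i) (x ord0 i).
Proof.
by rewrite big_ord_recl cons_rV0; congr (_ * _); apply: eq_bigr => i _; rewrite cons_rVS.
Qed.

Lemma dotrV_cons_rV n (z : 'rV[R]_n.+1) a (x : 'rV[R]_n) :
  dotrV z (cons_rV (a, x)) =
  z ord0 ord0 * a + dotrV (\row_i z ord0 (lift ord0 i)) x.
Proof.
rewrite /dotrV big_ord_recl cons_rV0; congr (_ + _).
by apply: eq_bigr => i _; rewrite cons_rVS !mxE.
Qed.

Lemma integral_rV0 (F : 'rV[R]_0 -> \bar R) : (\int[mu 0]_x F x = F 0%R)%E.
Proof.
rewrite (_ : F = cst (F 0%R)); last by apply/funext => x; rewrite [x]thinmx0.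
by rewrite /= integral_cst//= diracE mem_set// mule1.
Qed.

Lemma integral_prod_coord n (f : 'I_n -> R -> R) :
  (forall i, measurable_fun setT (f i)) -> (forall i t, 0 <= f i t) ->
  (\int[mu n]_x (\prod_i f i (x ord0 i))%:E = \prod_i \int[leb]_t (f i t)%:E)%E.
Proof.
elim: n f => [|n IH] f mf f0; first by rewrite integral_rV0 !big_ord0.
rewrite integral_rVS; last 2 first.
- by apply/measurable_EFinP; exact: measurable_prod_coord.
- by move=> x; rewrite lee_fin; apply: prodr_ge0.
rewrite big_ord_recl -IH//.
under eq_integral => a _.
  under eq_integral => x _ do rewrite prod_cons_rV EFinM.
  rewrite ge0_integralZl_EFin//; last 2 first.
  - by move=> x _; rewrite lee_fin; apply: prodr_ge0.
  - by apply/measurable_EFinP; exact: (@measurable_prod_coord n (fun i => f (lift ord0 i))).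
  over.
rewrite ge0_integralZr//.
- by apply/measurable_EFinP; exact: mf.
- by move=> t _; rewrite lee_fin.
- by apply: integral_ge0 => x _; rewrite lee_fin; apply: prodr_ge0.
Qed.

End iterated_integrals.

(** * Product kernels on row vectors *)

Section poisson_kernel.
Context {R : realType}.
Local Notation leb := (@lebesgue_measure R).
Local Notation mu n := (lebesgue_rV n : {measure set 'rV[R]_n -> \bar R}).

Definition expker n (e : R) (x : 'rV[R]_n) : R := \prod_i expabs e (x ord0 i).

Definition poisker n (e : R) (z : 'rV[R]_n) : R := \prod_i poisson1 e (z ord0 i).

Lemma expker_ge0 n e (x : 'rV[R]_n) : 0 <= expker e x.
Proof. by apply: prodr_ge0 => i _; exact: expabs_ge0. Qed.

Lemma expker_le1 n e (x : 'rV[R]_n) : 0 <= e -> expker e x <= 1.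
Proof.
move=> e0; apply: prodr_ile1 => i _; by rewrite expabs_ge0 expabs_le1.
Qed.

Lemma poisker_ge0 n e (x : 'rV[R]_n) : 0 <= e -> 0 <= poisker e x.
Proof. by move=> e0; apply: prodr_ge0 => i _; exact: poisson1_ge0. Qed.

Lemma poisker_le n e (x : 'rV[R]_n) : 0 < e -> poisker e x <= (2 / e) ^+ n.
Proof.
move=> e0; rewrite -[n in leRHS]card_ord -prodr_const; apply: ler_prod => i _.
apply/andP; split; first by rewrite poisson1_ge0// ltW.
have e2 : 0 < e ^+ 2 by rewrite exprn_gt0.
have -> : 2 / e = 2 * e / e ^+ 2 by field; rewrite gt_eqF.
apply: ler_wpM2l; first by rewrite mulr_ge0// ltW.
by rewrite lef_pV2 ?posrE ?ltr_wpDr ?sqr_ge0// lerDl sqr_ge0.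
Qed.

Lemma measurable_expker n e : measurable_fun setT (@expker n e).
Proof. by apply: (measurable_prod_coord (f := fun=> expabs e)) => i; exact: measurable_expabs. Qed.

Lemma measurable_poisker n e : 0 < e -> measurable_fun setT (@poisker n e).
Proof. by move=> e0; apply: (measurable_prod_coord (f := fun=> poisson1 e)) => i; exact: measurable_poisson1. Qed.

Lemma integrable_expker n e : 0 < e -> (mu n).-integrable setT (EFin \o expker e).
Proof.
move=> e0; apply/integrableP; split.
  by apply/measurable_EFinP; exact: measurable_expker.
under eq_integral do rewrite gee0_abs ?lee_fin ?expker_ge0//.
rewrite /expker (integral_prod_coord (f := fun=> expabs e)).
- under eq_bigr do rewrite integral_expabs//.
  by rewrite prodEFin ltry.
- by move=> _; exact: measurable_expabs.
- by move=> _ t; exact: expabs_ge0.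
Qed.

Lemma integrable_expker_mul n e (f : 'rV[R]_n -> R) : 0 < e -> measurable_fun setT f ->
  (forall t, `|f t| <= 1) -> (mu n).-integrable setT (EFin \o (fun t => expker e t * f t)).
Proof.
move=> e0 mf f1; apply: le_integrable (integrable_expker n e0) => //.
  by apply/measurable_EFinP; apply: measurable_funM => //; exact: measurable_expker.
move=> t _; rewrite /= lee_fin normrM ler_piMr//.
Qed.

Lemma measurable_cos_dotrV n (z : 'rV[R]_n) : measurable_fun setT (fun x => cos (dotrV z x)).
Proof.
apply: measurableT_comp; last exact: measurable_dotrV.
by apply: continuous_measurable_fun; exact: continuous_cos.
Qed.

Lemma measurable_sin_dotrV n (z : 'rV[R]_n) : measurable_fun setT (fun x => sin (dotrV z x)).
Proof.
apply: measurableT_comp; last exact: measurable_dotrV.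
by apply: continuous_measurable_fun; exact: continuous_sin.
Qed.

(** Cosine and sine are treated together because the addition formulas mix them when one coordinate
    is split off. *)
Lemma Rintegral_expker n e (z : 'rV[R]_n) : 0 < e ->
  \int[mu n]_x (expker e x * cos (dotrV z x)) = poisker e z /\
  \int[mu n]_x (expker e x * sin (dotrV z x)) = 0.
Proof.
move=> e0; elim: n z => [|n IH] z.
  rewrite /Rintegral !integral_rV0/= /poisker /expker /dotrV !big_ord0.
  by rewrite cos0 sin0 mulr1 mulr0.
have ic m (z : 'rV[R]_m) := integrable_expker_mul e0 (measurable_cos_dotrV z) (fun t => cos_max _).
have is_ m (z : 'rV[R]_m) := integrable_expker_mul e0 (measurable_sin_dotrV z) (fun t => sin_max _).
have [IHc IHs] := IH (\row_i z ord0 (lift ord0 i)); set z' := \row_i _ in IHc IHs.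
have scal c (f : 'rV[R]_n -> R) : (mu n).-integrable setT (EFin \o f) ->
    (mu n).-integrable setT (EFin \o (fun x => c * f x)).
  by move=> fi; have := integrableZl measurableT c fi; exact: eq_integrable.
have kcons a x : expker e (cons_rV (a, x)) = expabs e a * expker e (x : 'rV[R]_n).
  exact: (prod_cons_rV (fun=> expabs e)).
have cE a : (fun x : 'rV[R]_n => expker e (cons_rV (a, x)) * cos (dotrV z (cons_rV (a, x)))) =
    (fun x => expabs e a * cos (z ord0 ord0 * a) * (expker e x * cos (dotrV z' x)) -
              expabs e a * sin (z ord0 ord0 * a) * (expker e x * sin (dotrV z' x))).
  by apply/funext => x; rewrite kcons dotrV_cons_rV cosD; ring.
have sE a : (fun x : 'rV[R]_n => expker e (cons_rV (a, x)) * sin (dotrV z (cons_rV (a, x)))) =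
    (fun x => expabs e a * sin (z ord0 ord0 * a) * (expker e x * cos (dotrV z' x)) +
              expabs e a * cos (z ord0 ord0 * a) * (expker e x * sin (dotrV z' x))).
  by apply/funext => x; rewrite kcons dotrV_cons_rV sinD; ring.
split.
  rewrite Rintegral_rVS//; last first.
    move=> a; rewrite cE; have := integrableB measurableT
      (scal (expabs e a * cos (z ord0 ord0 * a)) _ (ic n z'))
      (scal (expabs e a * sin (z ord0 ord0 * a)) _ (is_ n z')); exact: eq_integrable.
  have -> : poisker e z = poisson1 e (z ord0 ord0) * poisker e z'.
    by rewrite /poisker big_ord_recl; congr (_ * _); apply: eq_bigr => i _; rewrite mxE.
  rewrite -Rintegral_expabs_cos// -RintegralZr//; last first.
    apply: (integrable_expabs_mul e0) => [|t]; last exact: cos_max.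
    by apply: continuous_measurable_fun; exact: continuous_cosM.
  apply: eq_Rintegral => a _; rewrite cE RintegralB//; try exact: scal.
  by rewrite !RintegralZl// IHc IHs mulr0 subr0.
rewrite Rintegral_rVS//; last first.
  move=> a; rewrite sE; have := integrableD measurableT
    (scal (expabs e a * sin (z ord0 ord0 * a)) _ (ic n z'))
    (scal (expabs e a * cos (z ord0 ord0 * a)) _ (is_ n z')); exact: eq_integrable.
rewrite -(mul0r (poisker e z')) -(Rintegral_expabs_sin (z ord0 ord0) e0) -RintegralZr//; last first.
  apply: (integrable_expabs_mul e0) => [|t]; last exact: sin_max.
  by apply: continuous_measurable_fun; exact: continuous_sinM.
apply: eq_Rintegral => a _; rewrite sE RintegralD//; try exact: scal.
by rewrite !RintegralZl// IHc IHs mulr0 addr0.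
Qed.

Lemma measurable_rVB n (x : 'rV[R]_n) : measurable_fun setT (fun y : 'rV[R]_n => x - y).
Proof.
apply: measurable_rV => i; rewrite (_ : _ \o _ = fun y => x ord0 i - rV_coord i y); last first.
  by apply/funext => y; rewrite /= /rV_coord !mxE.
by apply: measurable_funB => //; exact: measurable_rV_coord.
Qed.

Lemma integral_poisker_le n e (x : 'rV[R]_n) : 0 < e ->
  (\int[mu n]_y (poisker e (x - y))%:E <= ((2 * pi) ^+ n)%:E)%E.
Proof.
move=> e0; under eq_integral => y _.
  have -> : poisker e (x - y) = \prod_i (fun t => poisson1 e (x ord0 i - t)) (y ord0 i).
    by apply: eq_bigr => i _; rewrite !mxE.
  over.
rewrite (integral_prod_coord (f := fun i t => poisson1 e (x ord0 i - t))); last 2 first.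
- by move=> i; exact: measurable_poisson1B.
- by move=> i t; rewrite poisson1_ge0// ltW.
have -> : ((2 * pi) ^+ n)%:E = (\prod_(i < n) (2 * pi : R)%:E)%E.
  by rewrite prodEFin prodr_const card_ord.
suff [] : (0 <= \prod_i \int[leb]_t (poisson1 e (x ord0 i - t))%:E /\
   \prod_i \int[leb]_t (poisson1 e (x ord0 i - t))%:E <= \prod_(i < n) (2 * pi : R)%:E)%E by [].
elim/big_rec2: _ => // i a b _ [b0 ba].
have i0 : (0 <= \int[leb]_t (poisson1 e (x ord0 i - t))%:E)%E.
  by apply: integral_ge0 => t _; rewrite lee_fin poisson1_ge0// ltW.
split; first exact: mule_ge0.
by apply: lee_pmul => //; exact: integral_poisson1_le.
Qed.

(** For e -> 0 and x off the faces, each factor tends to 2 pi if the coordinate of x lies inside its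
    interval and to 0 otherwise: the approximate identity is visible in the formula. *)
Lemma Rintegral_poisker_box n e (x a b : 'rV[R]_n) : 0 < e ->
  (forall i, a ord0 i <= b ord0 i) ->
  \int[mu n]_y (\1_(box a b) y * poisker e (x - y)) =
  \prod_i (2 * (atan ((b ord0 i - x ord0 i) / e) - atan ((a ord0 i - x ord0 i) / e))).
Proof.
move=> e0 ab; pose f i t := \1_(`]a ord0 i, b ord0 i]%classic) t * poisson1 e (x ord0 i - t).
have -> : (fun y : 'rV[R]_n => \1_(box a b) y * poisker e (x - y)) =
    (fun y => \prod_i f i (y ord0 i)).
  apply/funext => y; rewrite /f big_split/=; congr (_ * _); last first.
    by apply: eq_bigr => i _; rewrite !mxE.
  rewrite indicE; case: (pselect (box a b y)) => [Hy|Hy].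
    rewrite mem_set// big1// => i _; rewrite indicE mem_set//; exact: Hy.
  rewrite memNset//; have [i Hi] : exists i, ~ (`]a ord0 i, b ord0 i]%classic (y ord0 i)).
    by apply/existsNP.
  by rewrite (bigD1 i)//= indicE memNset// mul0r.
rewrite /Rintegral integral_prod_coord; last 2 first.
- move=> i; apply: measurable_funM; last exact: measurable_poisson1B.
  by apply: measurable_indic; exact: measurable_itv.
- by move=> i t; rewrite /f mulr_ge0// poisson1_ge0// ltW.
rewrite (eq_bigr (fun i => (2 * (atan ((b ord0 i - x ord0 i) / e) - atan ((a ord0 i - x ord0 i) / e)))%:E)); last first.
  move=> i _; rewrite -integral_poisson1_itv// [RHS]integral_mkcond; apply: eq_integral => t _.
  rewrite /f patchE indicE; case: ifP => _; by rewrite ?mul1r ?mul0r.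
by rewrite prodEFin.
Qed.

End poisson_kernel.

(** * Fourier transform and Plancherel formula *)

Section fourier_integrable.
Context {R : realType} (n : nat).
Local Notation V := 'rV[R]_n.
Local Notation mu := (lebesgue_rV n : {measure set 'rV[R]_n -> \bar R}).
Implicit Types (f g h : V -> R) (k : V * V -> R).

Definition L1 f := mu.-integrable setT (EFin \o f).

Lemma L1_measurable f : L1 f -> measurable_fun setT f.
Proof. by move=> /(measurable_int mu)/measurable_EFinP. Qed.

Lemma L1_mul_bounded f g (M : R) : L1 f -> measurable_fun setT g ->
  (forall x, `|g x| <= M) -> L1 (fun x => f x * g x).
Proof.
move=> Lf mg gM; have := integrableZl measurableT M Lf; apply: le_integrable => //.
  by apply/measurable_EFinP; apply: measurable_funM => //; exact: L1_measurable.
move=> x _; rewrite /= lee_fin !normrM mulrC ler_wpM2r//.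
exact: le_trans (gM x) (ler_norm M).
Qed.

Lemma L1D f g : L1 f -> L1 g -> L1 (fun x => f x + g x).
Proof. by move=> Lf Lg; have := integrableD measurableT Lf Lg; exact: eq_integrable. Qed.

Lemma L1B f g : L1 f -> L1 g -> L1 (fun x => f x - g x).
Proof. by move=> Lf Lg; have := integrableB measurableT Lf Lg; exact: eq_integrable. Qed.

Lemma L1Z a f : L1 f -> L1 (fun x => a * f x).
Proof. by move=> Lf; have := integrableZl measurableT a Lf; exact: eq_integrable. Qed.

Lemma measurable_kernel_l k y : measurable_fun setT k -> measurable_fun setT (fun x => k (x, y)).
Proof. by move=> mk; apply: measurableT_comp => //; exact: pair2_measurable. Qed.

Lemma measurable_kernel_r k x : measurable_fun setT k -> measurable_fun setT (fun y => k (x, y)).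
Proof. by move=> mk; apply: measurableT_comp => //; exact: pair1_measurable. Qed.

Lemma integrable_kernel f h k : L1 f -> L1 h -> measurable_fun setT k ->
  (forall p, `|k p| <= 1) ->
  (lebesgue_rV n \x lebesgue_rV n)%E.-integrable setT
    (fun p => (f p.1 * (h p.2 * k p))%:E).
Proof.
move=> Lf Lh mk k1; have mf := L1_measurable Lf; have mh := L1_measurable Lh.
have mF : measurable_fun setT (fun p => (f p.1 * (h p.2 * k p))%:E).
  apply/measurable_EFinP; apply: measurable_funM.
    by apply: measurableT_comp => //; exact: measurable_fst.
  apply: measurable_funM => //.
  by apply: measurableT_comp => //; exact: measurable_snd.
apply/(integrable12ltyP _ _ mF); rewrite /=.
have /integrableP[mEf if_] := Lf; have /integrableP[mEh ih] := Lh.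
have mah : measurable_fun setT (fun y => `|(h y)%:E|)%E by exact: measurableT_comp mEh.
have maf : measurable_fun setT (fun y => `|(f y)%:E|)%E by exact: measurableT_comp mEf.
apply: (@le_lt_trans _ _ (\int[mu]_x (`|(f x)%:E| * \int[mu]_y `|(h y)%:E|))%E); last first.
  rewrite ge0_integralZr//; last exact: integral_ge0.
  apply: lte_mul_pinfty; [exact: integral_ge0| |exact: ih].
  by rewrite ge0_fin_numE//; exact: integral_ge0.
apply: ge0_le_integral => //.
- by move=> x _; exact: integral_ge0.
- apply: (@measurable_fun_fubini_tonelli_F _ _ _ _ _ (lebesgue_rV n) (fun p => `|(f p.1 * (h p.2 * k p))%:E|%E)) => //.
  exact: measurableT_comp.
- by apply: emeasurable_funM => //; exact: measurable_cst.
- move=> x _; rewrite -ge0_integralZl//; apply: ge0_le_integral => //.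
  + apply/measurable_EFinP; apply: measurableT_comp; first exact: normr_measurable.
    apply: measurable_funM => //.
    by apply: measurable_funM => //; exact: measurable_kernel_r.
  + by apply: emeasurable_funM => //; exact: measurable_cst.
  + move=> y _; rewrite -abseM -EFinM !abse_EFin lee_fin !normrM ler_wpM2l//.
    by rewrite ler_piMr.
Qed.

(** For [k] the cosine or the sine of x.xi this is the multiplication formula for the Fourier
    transform. *)
Lemma Rintegral_swap f h k : L1 f -> L1 h -> measurable_fun setT k ->
  (forall p, `|k p| <= 1) ->
  \int[mu]_y (h y * \int[mu]_x (f x * k (x, y))) =
  \int[mu]_x (f x * \int[mu]_y (h y * k (x, y))).
Proof.
move=> Lf Lh mk k1; have ik := integrable_kernel Lf Lh mk k1.
have L1r x : L1 (fun y => h y * k (x, y)).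
  by apply: (L1_mul_bounded (M := 1)) => //; exact: measurable_kernel_r.
have L1l y : L1 (fun x => f x * k (x, y)).
  by apply: (L1_mul_bounded (M := 1)) => //; exact: measurable_kernel_l.
have := Fubini ik; rewrite /= => H; congr fine; apply/esym.
transitivity (\int[mu]_x \int[mu]_y (f x * (h y * k (x, y)))%:E)%E.
  apply: eq_integral => x _; rewrite EFinM /Rintegral fineK; last exact: integrable_fin_num (L1r x).
  by rewrite -integralZl//; exact: L1r x.
rewrite H; apply: eq_integral => y _; rewrite EFinM /Rintegral fineK; last exact: integrable_fin_num (L1l y).
rewrite -integralZl; [|exact: measurableT|exact: L1l y].
by apply: eq_integral => x _; rewrite /= -EFinM mulrCA.
Qed.

(** Since [k] is merely bounded, f(x) k(x, y) need not be integrable in both variables, so Fubini's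
    theorem does not apply directly. It applies after multiplication by the integrable positive
    weight [expker 1 y], which is then divided out. *)
Lemma measurable_kernel_int f k : L1 f -> measurable_fun setT k ->
  (forall p, `|k p| <= 1) -> measurable_fun setT (fun y => \int[mu]_x (f x * k (x, y))).
Proof.
move=> Lf mk k1; have e1 : (0 : R) < 1 by [].
have ik := integrable_kernel Lf (integrable_expker n e1) mk k1.
have L1l y : L1 (fun x => f x * k (x, y)).
  by apply: (L1_mul_bounded (M := 1)) => //; exact: measurable_kernel_l.
have := measurable_fubini_G ik => mG.
have K0 y : expker 1 (y : V) != 0.
  by rewrite gt_eqF//; apply: prodr_gt0 => i _; exact: expR_gt0.
have -> : (fun y => \int[mu]_x (f x * k (x, y))) =
    (fun y => (expker 1 y)^-1 * fine (fubini_G mu (fun p => (f p.1 * (expker 1 p.2 * k p))%:E) y)).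
  apply/funext => y; rewrite /fubini_G/= -/(Rintegral _ _ _).
  have -> : (fun x => f x * (expker 1 y * k (x, y))) = (fun x => expker 1 y * (f x * k (x, y))).
    by apply/funext => x; rewrite mulrCA.
  by rewrite RintegralZl//; [rewrite mulrA mulVf// mul1r|exact: L1l].
apply: measurable_funM; last by apply: measurableT_comp mG; exact: fine_measurable.
have -> : (fun y : V => (expker 1 y)^-1) = (fun y => expR (\sum_i `|y ord0 i|)).
  apply/funext => y; apply: (mulfI (K0 y)); rewrite mulfV// /expker /expabs.
  rewrite -expR_sum -expRD -[LHS]expR0; congr expR.
  by rewrite -big_split/= big1// => i _; rewrite mul1r addNr.
apply: measurableT_comp; first exact: measurable_expR.
apply: measurable_sum => i.
apply: measurableT_comp; first exact: normr_measurable.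
exact: measurable_rV_coord.
Qed.

Lemma kernel_int_bound f k y : L1 f -> measurable_fun setT k ->
  (forall p, `|k p| <= 1) -> `|\int[mu]_x (f x * k (x, y))| <= \int[mu]_x `|f x|.
Proof.
move=> Lf mk k1; have L1l : L1 (fun x => f x * k (x, y)).
  by apply: (L1_mul_bounded (M := 1)) => //; exact: measurable_kernel_l.
apply: le_trans (le_normr_Rintegral measurableT L1l) _; apply: le_Rintegral => //.
- exact: integrable_norm L1l.
- exact: integrable_norm Lf.
- by move=> x _; rewrite normrM ler_piMr.
Qed.

Definition Fcos g (xi : V) : R := \int[mu]_x (g x * cos (dotrV x xi)).
Definition Fsin g (xi : V) : R := \int[mu]_x (g x * sin (dotrV x xi)).

Let kcos (p : V * V) : R := cos (dotrV p.1 p.2).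
Let ksin (p : V * V) : R := sin (dotrV p.1 p.2).

Let mkcos : measurable_fun setT kcos.
Proof.
apply: measurableT_comp; last exact: measurable_dotrV2.
by apply: continuous_measurable_fun; exact: continuous_cos.
Qed.

Let mksin : measurable_fun setT ksin.
Proof.
apply: measurableT_comp; last exact: measurable_dotrV2.
by apply: continuous_measurable_fun; exact: continuous_sin.
Qed.

Let kcos1 p : `|kcos p| <= 1. Proof. exact: cos_max. Qed.
Let ksin1 p : `|ksin p| <= 1. Proof. exact: sin_max. Qed.

Lemma measurable_Fcos g : L1 g -> measurable_fun setT (Fcos g).
Proof. by move=> Lg; exact: (measurable_kernel_int Lg mkcos kcos1). Qed.

Lemma measurable_Fsin g : L1 g -> measurable_fun setT (Fsin g).
Proof. by move=> Lg; exact: (measurable_kernel_int Lg mksin ksin1). Qed.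

Lemma Fcos_bound g xi : L1 g -> `|Fcos g xi| <= \int[mu]_x `|g x|.
Proof. by move=> Lg; exact: (kernel_int_bound xi Lg mkcos kcos1). Qed.

Lemma Fsin_bound g xi : L1 g -> `|Fsin g xi| <= \int[mu]_x `|g x|.
Proof. by move=> Lg; exact: (kernel_int_bound xi Lg mksin ksin1). Qed.

Lemma L1_cos g (xi : V) : L1 g -> L1 (fun x => g x * cos (dotrV x xi)).
Proof.
move=> Lg; apply: (L1_mul_bounded (M := 1)) => //; last by move=> x; exact: cos_max.
exact: (measurable_kernel_l xi mkcos).
Qed.

Lemma L1_sin g (xi : V) : L1 g -> L1 (fun x => g x * sin (dotrV x xi)).
Proof.
move=> Lg; apply: (L1_mul_bounded (M := 1)) => //; last by move=> x; exact: sin_max.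
exact: (measurable_kernel_l xi mksin).
Qed.

Lemma dotrVBl (x y z : V) : dotrV (x - y) z = dotrV x z - dotrV y z.
Proof. by rewrite /dotrV -sumrB; apply: eq_bigr => i _; rewrite !mxE mulrBl. Qed.

Lemma dotrVC (x z : V) : dotrV x z = dotrV z x.
Proof. by rewrite /dotrV; apply: eq_bigr => i _; rewrite mulrC. Qed.

(** Fubini's theorem moves both transforms onto the kernel; the products of cosines and of sines
    recombine into cos((x - y).xi), which [expker e] integrates to [poisker e (x - y)]. *)
Lemma poisson_identity (e : R) g h : 0 < e -> L1 g -> L1 h ->
  \int[mu]_xi (expker e xi * (Fcos g xi * Fcos h xi + Fsin g xi * Fsin h xi)) =
  \int[mu]_x (g x * \int[mu]_y (h y * poisker e (x - y))).
Proof.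
move=> e0 Lg Lh; have iK := integrable_expker n e0.
have Lc : L1 (fun xi => expker e xi * Fcos h xi).
  by apply: (L1_mul_bounded iK (measurable_Fcos Lh)) => xi; exact: Fcos_bound.
have Ls : L1 (fun xi => expker e xi * Fsin h xi).
  by apply: (L1_mul_bounded iK (measurable_Fsin Lh)) => xi; exact: Fsin_bound.
have Lcc : L1 (fun xi => expker e xi * Fcos h xi * Fcos g xi).
  by apply: (L1_mul_bounded Lc (measurable_Fcos Lg)) => xi; exact: Fcos_bound.
have Lss : L1 (fun xi => expker e xi * Fsin h xi * Fsin g xi).
  by apply: (L1_mul_bounded Ls (measurable_Fsin Lg)) => xi; exact: Fsin_bound.
have -> : \int[mu]_xi (expker e xi * (Fcos g xi * Fcos h xi + Fsin g xi * Fsin h xi)) =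
    \int[mu]_xi (expker e xi * Fcos h xi * Fcos g xi) +
    \int[mu]_xi (expker e xi * Fsin h xi * Fsin g xi).
  by rewrite -RintegralD//; apply: eq_Rintegral => xi _; ring.
rewrite (Rintegral_swap Lg Lc mkcos kcos1) (Rintegral_swap Lg Ls mksin ksin1).
have mcs k f : measurable_fun setT k -> (forall p, `|k p| <= 1) -> L1 f ->
    L1 (fun x => g x * \int[mu]_y (f y * k (x, y))).
  move=> mk k1 Lf.
  pose k' p := k (p.2, p.1).
  have mk' : measurable_fun setT k'.
    apply: (measurableT_comp mk) => //; exact: measurable_swap.
  have k'1 p : `|k' p| <= 1 by exact: k1.
  apply: (L1_mul_bounded Lg (measurable_kernel_int Lf mk' k'1)) => x.
  exact: (kernel_int_bound x Lf mk' k'1).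
rewrite -RintegralD//; [|exact: mcs|exact: mcs].
apply: eq_Rintegral => x _; rewrite -mulrDr; congr (_ * _).
have L3 : L1 (fun xi => expker e xi * Fcos h xi * kcos (x, xi)).
  by apply: (L1_mul_bounded Lc (measurable_kernel_r x mkcos)) => xi; exact: kcos1.
have L4 : L1 (fun xi => expker e xi * Fsin h xi * ksin (x, xi)).
  by apply: (L1_mul_bounded Ls (measurable_kernel_r x mksin)) => xi; exact: ksin1.
rewrite -RintegralD//.
pose kx (p : V * V) : R := cos (dotrV (x - p.1) p.2).
have mkx : measurable_fun setT kx.
  have -> : kx = (fun p => kcos (x, p.2) * kcos p + ksin (x, p.2) * ksin p).
    by apply/funext => p; rewrite /kx dotrVBl cosB.
  have ms (k : V * V -> R) : measurable_fun setT k -> measurable_fun setT (fun p : V * V => k (x, p.2)).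
    move=> mk; apply: (measurableT_comp (measurable_kernel_r x mk)); exact: measurable_snd.
  by apply: measurable_funD; apply: measurable_funM => //; exact: ms.
have kx1 p : `|kx p| <= 1 by exact: cos_max.
have := Rintegral_swap Lh iK mkx kx1.
have -> : \int[mu]_x0 (h x0 * \int[mu]_y (expker e y * kx (x0, y))) =
    \int[mu]_y (h y * poisker e (x - y)).
  apply: eq_Rintegral => y _; congr (_ * _).
  by have [<- _] := Rintegral_expker (x - y) e0.
move=> <-; apply: eq_Rintegral => xi _.
rewrite -!mulrA -mulrDr; congr (_ * _).
rewrite /Fcos /Fsin -!RintegralZr//; [|exact: L1_sin|exact: L1_cos].
rewrite -RintegralD//; last 2 first.
- have := L1Z (kcos (x, xi)) (L1_cos xi Lh); apply: eq_integrable => // y _.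
  by rewrite /= mulrC.
- have := L1Z (ksin (x, xi)) (L1_sin xi Lh); apply: eq_integrable => // y _.
  by rewrite /= mulrC.
apply: eq_Rintegral => y _; rewrite /kx/= dotrVBl cosB /kcos /ksin/=; ring.
Qed.

(** A Schur test: |g(x) g(y)| is at most half the sum of the squares, and each square is integrated
    first in the other variable, where the kernel has mass at most (2 pi)^n whatever e is. *)
Lemma integral_expker_fourier_le (e : R) g : 0 < e -> L1 g -> L2on mu g ->
  (\int[mu]_xi (expker e xi * (Fcos g xi ^+ 2 + Fsin g xi ^+ 2))%:E <=
   ((2 * pi) ^+ n)%:E * L2norm2 mu g)%E.
Proof.
move=> e0 Lg L2g; have iK := integrable_expker n e0.
have mP : measurable_fun setT (fun p : V * V => poisker e (p.1 - p.2)).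
  apply: (measurableT_comp (@measurable_poisker R n e e0)).
  apply: measurable_rV => i.
  rewrite (_ : _ \o _ = fun p => rV_coord i p.1 - rV_coord i p.2); last first.
    by apply/funext => p; rewrite /= /rV_coord !mxE.
  apply: measurable_funB; apply: (measurableT_comp (measurable_rV_coord i)).
    exact: measurable_fst.
  exact: measurable_snd.
have P0 x y : 0 <= poisker e (x - y : V) by apply: poisker_ge0; exact: ltW.
have mg := L1_measurable Lg.
set M := (2 * pi) ^+ n : R.
have Lq : L1 (fun xi => expker e xi * (Fcos g xi ^+ 2 + Fsin g xi ^+ 2)).
  apply: (L1_mul_bounded (M := (\int[mu]_x `|g x|) ^+ 2 + (\int[mu]_x `|g x|) ^+ 2) iK).
    by apply: measurable_funD; apply: measurable_funX; [exact: measurable_Fcos|exact: measurable_Fsin].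
  move=> xi; rewrite ger0_norm ?addr_ge0 ?sqr_ge0// lerD// -[leLHS]real_normK ?num_real//.
    by rewrite lerXn2r ?nnegrE//; [apply: Rintegral_ge0|exact: Fcos_bound].
  by rewrite lerXn2r ?nnegrE//; [apply: Rintegral_ge0|exact: Fsin_bound].
rewrite -[leLHS]fineK; last exact: integrable_fin_num Lq.
rewrite -[fine _]/(Rintegral _ _ _).
have -> : \int[mu]_xi (expker e xi * (Fcos g xi ^+ 2 + Fsin g xi ^+ 2)) =
    \int[mu]_x (g x * \int[mu]_y (g y * poisker e (x - y))).
  by rewrite -poisson_identity//; apply: eq_Rintegral => xi _; rewrite !expr2.
pose G0 := fun p : V * V => (`|g p.1| * (`|g p.2| * poisker e (p.1 - p.2)))%:E.
have mF : measurable_fun setT G0.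
  apply/measurable_EFinP; apply: measurable_funM; last first.
    apply: measurable_funM => //; apply: measurableT_comp; first exact: normr_measurable.
    by apply: (measurableT_comp mg); exact: measurable_snd.
  apply: measurableT_comp; first exact: normr_measurable.
  by apply: (measurableT_comp mg); exact: measurable_fst.
pose G1 := fun p : V * V => (2^-1 * (g p.1 ^+ 2 * poisker e (p.1 - p.2)))%:E.
pose G2 := fun p : V * V => (2^-1 * (g p.2 ^+ 2 * poisker e (p.1 - p.2)))%:E.
have mG1 : measurable_fun setT G1.
  apply/measurable_EFinP; apply: measurable_funM => //; apply: measurable_funM => //.
  by apply: measurable_funX; apply: (measurableT_comp mg); exact: measurable_fst.
have mG2 : measurable_fun setT G2.
  apply/measurable_EFinP; apply: measurable_funM => //; apply: measurable_funM => //.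
  by apply: measurable_funX; apply: (measurableT_comp mg); exact: measurable_snd.
have G10 p : (0 <= G1 p)%E.
  by rewrite lee_fin; apply: mulr_ge0 => //; apply: mulr_ge0; [exact: sqr_ge0|exact: P0].
have G20 p : (0 <= G2 p)%E.
  by rewrite lee_fin; apply: mulr_ge0 => //; apply: mulr_ge0; [exact: sqr_ge0|exact: P0].
have m1 f : measurable_fun setT f -> measurable_fun setT (EFin \o f) by move/measurable_EFinP.
have mPr x : measurable_fun setT (fun y : V => poisker e (x - y)).
  by apply: (measurableT_comp (@measurable_poisker R n e e0)); exact: measurable_rVB.
have Psym (x y : V) : poisker e (x - y) = poisker e (y - x).
  apply: eq_bigr => i _; rewrite /poisson1 !mxE; congr (_ / (_ + _)).
  by rewrite -sqrrN opprB.
have mPl y : measurable_fun setT (fun x : V => poisker e (x - y)).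
  have -> : (fun x : V => poisker e (x - y)) = (fun x => poisker e (y - x)).
    by apply/funext => x; exact: Psym.
  exact: mPr.
have hb (f : R) (H : V -> R) : measurable_fun setT H -> (forall y, 0 <= H y) ->
    (\int[mu]_y (H y)%:E <= M%:E)%E -> f \is Num.nneg -> (\int[mu]_y (2^-1 * (f * H y))%:E <= (2^-1 * f)%:E * M%:E)%E.
  move=> mH H0 HM f0; under eq_integral do rewrite mulrA EFinM.
  rewrite ge0_integralZl_EFin//; last 3 first.
  - by move=> y _; rewrite lee_fin.
  - exact: m1.
  - by rewrite mulr_ge0// -nnegrE.
  by rewrite lee_wpmul2l// lee_fin mulr_ge0// -nnegrE.
have i2 : (\int[mu]_x (2^-1 * g x ^+ 2)%:E * M%:E = 2^-1%:E * (M%:E * L2norm2 mu g))%E.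
  under eq_integral do rewrite EFinM.
  rewrite ge0_integralZl_EFin//; last 2 first.
  - by move=> x _; rewrite lee_fin sqr_ge0.
  - by apply: m1; exact: measurable_funX.
  by rewrite -muleA [(M%:E * _)%E]muleC.
have M0 : 0 <= M by rewrite exprn_ge0// mulr_ge0// pi_ge0.
have i3 : (2^-1%:E * (M%:E * L2norm2 mu g) = \int[mu]_x ((2^-1 * g x ^+ 2)%:E * M%:E))%E.
  rewrite -i2 -ge0_integralZr//.
  - by apply: m1; apply: measurable_funM => //; exact: measurable_funX.
  - by move=> x _; rewrite lee_fin mulr_ge0// sqr_ge0.
have b1 : (\int[mu]_x \int[mu]_y G1 (x, y) <= 2^-1%:E * (M%:E * L2norm2 mu g))%E.
  rewrite i3.
  apply: ge0_le_integral => //.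
  - by move=> x _; apply: integral_ge0.
  - exact: (@measurable_fun_fubini_tonelli_F _ _ _ _ _ (lebesgue_rV n) G1).
  - apply: emeasurable_funM; last exact: measurable_cst.
    by apply: m1; apply: measurable_funM => //; exact: measurable_funX.
  - move=> x _; apply: (hb (g x ^+ 2) (fun y => poisker e (x - y))) => //.
      exact: integral_poisker_le.
    by rewrite nnegrE sqr_ge0.
have b2 : (\int[mu]_x \int[mu]_y G2 (x, y) <= 2^-1%:E * (M%:E * L2norm2 mu g))%E.
  (* In [G2] the square depends on y, so the order is exchanged to integrate the kernel in x
     first. *)
  have H := @fubini_tonelli _ _ _ _ _ (lebesgue_rV n) (lebesgue_rV n) G2 mG2 G20.
  apply: (@le_trans _ _ (\int[mu]_y \int[mu]_x G2 (x, y))%E).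
    by rewrite le_eqVlt; apply/orP; left; apply/eqP; exact: H.
  clear H.
  rewrite i3.
  apply: ge0_le_integral => //.
  - by move=> x _; apply: integral_ge0.
  - exact: (@measurable_fun_fubini_tonelli_G _ _ _ _ _ (lebesgue_rV n) G2).
  - apply: emeasurable_funM; last exact: measurable_cst.
    by apply: m1; apply: measurable_funM => //; exact: measurable_funX.
  - move=> y _; apply: (hb (g y ^+ 2) (fun x => poisker e (x - y))).
    + exact: mPl.
    + by move=> x; exact: P0.
    + by under eq_integral do rewrite Psym; exact: integral_poisker_le.
    + by rewrite nnegrE sqr_ge0.
have G00 p : (0 <= G0 p)%E.
  by rewrite lee_fin; apply: mulr_ge0 => //; apply: mulr_ge0 => //; exact: P0.
apply: (@le_trans _ _ (\int[mu]_x \int[mu]_y G0 (x, y))%E).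
  set c := fun x => \int[mu]_y (g y * poisker e (x - y)).
  pose B := (2 / e) ^+ n; have B0 : 0 < B by rewrite exprn_gt0// divr_gt0.
  have PB z : `|poisker e (z : V)| <= B.
    by rewrite ger0_norm; [exact: poisker_le|apply: poisker_ge0; exact: ltW].
  have LgP x : L1 (fun y => g y * poisker e (x - y)).
    by apply: (L1_mul_bounded (M := B)).
  have Lgc : L1 (fun x => g x * c x).
    (* Divided by its upper bound [B], the kernel meets the bound 1 required by
       [measurable_kernel_int]. *)
    pose k (p : V * V) := B^-1 * poisker e (p.2 - p.1).
    have mk : measurable_fun setT k.
      apply: measurable_funM => //.
      have -> : (fun p : V * V => poisker e (p.2 - p.1)) = (fun p => poisker e (p.1 - p.2)).
        by apply/funext => p; exact: Psym.
      exact: mP.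
    have k1 p : `|k p| <= 1.
      by rewrite normrM gtr0_norm ?invr_gt0// mulrC ler_pdivrMr// mul1r.
    have cE x : c x = B * \int[mu]_y (g y * k (y, x)).
      rewrite -RintegralZl//; last first.
        apply: (L1_mul_bounded (M := 1)) => //; exact: measurable_kernel_l.
      by apply: eq_Rintegral => y _; rewrite /k/= mulrCA mulVKf// gt_eqF.
    have -> : (fun x => g x * c x) = (fun x => B * (g x * \int[mu]_y (g y * k (y, x)))).
      by apply/funext => x; rewrite cE mulrCA.
    apply: L1Z; apply: (L1_mul_bounded Lg (measurable_kernel_int Lg mk k1)) => x.
    exact: kernel_int_bound.
  apply: (@le_trans _ _ (\int[mu]_x `|(g x * c x)%:E|)%E).
    apply: (@le_trans _ _ `|(\int[mu]_x (g x * c x))%:E|%E); first by rewrite lee_fin ler_norm.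
    rewrite /Rintegral fineK; last exact: integrable_fin_num Lgc.
    by apply: le_abse_integral => //; exact: measurable_int Lgc.
  apply: ge0_le_integral => //.
  - by apply: measurableT_comp => //; exact: measurable_int Lgc.
  - exact: (@measurable_fun_fubini_tonelli_F _ _ _ _ _ (lebesgue_rV n) G0 mF G00).
  - move=> x _; under [leRHS]eq_integral do rewrite /G0/= EFinM.
    rewrite ge0_integralZl_EFin//; last 2 first.
    + by move=> y _; rewrite lee_fin mulr_ge0.
    + apply: m1; apply: measurable_funM => //.
      by apply: measurableT_comp; first exact: normr_measurable.
    rewrite abse_EFin normrM EFinM lee_wpmul2l ?lee_fin//.
    rewrite -abse_EFin /c /Rintegral fineK; last exact: integrable_fin_num (LgP x).
    apply: le_trans (le_abse_integral _ _ _) _ => //; first exact: measurable_int (LgP x).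
    apply: ge0_le_integral => //.
    + by apply: measurableT_comp => //; exact: measurable_int (LgP x).
    + apply: m1; apply: measurable_funM => //.
      by apply: measurableT_comp; first exact: normr_measurable.
    + by move=> y _; rewrite abse_EFin normrM [`|poisker _ _|]ger0_norm.
apply: (@le_trans _ _ (\int[mu]_x (\int[mu]_y G1 (x, y) + \int[mu]_y G2 (x, y)))%E).
  apply: ge0_le_integral => //.
  - by move=> x _; apply: integral_ge0 => y _; exact: G00.
  - exact: (@measurable_fun_fubini_tonelli_F _ _ _ _ _ (lebesgue_rV n) G0 mF G00).
  - apply: emeasurable_funD.
      exact: (@measurable_fun_fubini_tonelli_F _ _ _ _ _ (lebesgue_rV n) G1).
    exact: (@measurable_fun_fubini_tonelli_F _ _ _ _ _ (lebesgue_rV n) G2).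
  - move=> x _; rewrite -ge0_integralD//; last 2 first.
    + by apply: (measurableT_comp mG1); exact: pair1_measurable.
    + by apply: (measurableT_comp mG2); exact: pair1_measurable.
    apply: ge0_le_integral => //.
    + by apply: (measurableT_comp mF); exact: pair1_measurable.
    + apply: emeasurable_funD.
        by apply: (measurableT_comp mG1); exact: pair1_measurable.
      by apply: (measurableT_comp mG2); exact: pair1_measurable.
    + move=> y _; rewrite /G0 /G1 /G2/= -EFinD lee_fin !mulrA -mulrDl ler_wpM2r//.
      rewrite -!mulrA -!expr2 -[g x ^+ 2]real_normK ?num_real// -[g y ^+ 2]real_normK ?num_real//.
      have := sqr_ge0 (`|g x| - `|g y|); nra.
rewrite ge0_integralD//; last 4 first.
- by move=> x _; apply: integral_ge0.
- exact: (@measurable_fun_fubini_tonelli_F _ _ _ _ _ (lebesgue_rV n) G1).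
- by move=> x _; apply: integral_ge0.
- exact: (@measurable_fun_fubini_tonelli_F _ _ _ _ _ (lebesgue_rV n) G2).
apply: (le_trans (leeD b1 b2)); rewrite -ge0_muleDl ?lee_fin// -EFinD.
have -> : 2^-1 + 2^-1 = 1 :> R by lra.
by rewrite mul1e.
Qed.

End fourier_integrable.

(** * Removing the smoothing; pairing with a box *)

Section plancherel_boxes.
Context {R : realType} (n : nat).
Local Notation V := 'rV[R]_n.
Local Notation mu := (lebesgue_rV n : {measure set 'rV[R]_n -> \bar R}).
Local Notation FC := (@fourier_const R n).
Implicit Types (f g h : V -> R).

Lemma Rintegral_dominated_cvg (f_ : nat -> V -> R) f g :
  (forall m, measurable_fun setT (f_ m)) -> measurable_fun setT f -> L1 g ->
  (forall m x, `|f_ m x| <= g x) ->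
  {ae mu, forall x, f_ ^~ x @ \oo --> f x} ->
  (\int[mu]_x (f_ m x)) @[m --> \oo] --> \int[mu]_x f x.
Proof.
move=> mf_ mf Lg fg cf.
have [||||| If _ cI] := @dominated_convergence _ _ _ mu setT measurableT
  (fun m => EFin \o f_ m) (EFin \o f) (EFin \o g).
- by move=> m; apply/measurable_EFinP.
- exact/measurable_EFinP.
- apply: filterS cf => x fx _; apply: cvg_EFin; first exact: nearW.
  exact: fx.
- exact: Lg.
- by apply: nearW => x m _; rewrite /= lee_fin.
apply: fine_cvg; rewrite fineK; first exact: cI.
exact: integrable_fin_num If.
Qed.

Lemma expkerE (e : R) (x : V) : expker e x = expR (- (e * \sum_i `|x ord0 i|)).
Proof.
rewrite /expker /expabs -expR_sum; congr expR.
by rewrite sumrN mulr_sumr.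
Qed.

Lemma cvg_expker (x : V) : expker (harmonic m) x @[m --> \oo] --> (1 : R).
Proof.
rewrite (_ : (fun m => _) = (fun m => expR (- (harmonic m * \sum_i `|x ord0 i|)))); last first.
  by apply/funext => m; rewrite expkerE.
rewrite -[X in _ --> X]expR0; apply: continuous_cvg; first exact: continuous_expR.
move: (\sum_i _) => S.
rewrite -[X in _ --> X]oppr0 -[X in _ --> - X](mul0r S).
by apply: cvgN; apply: cvgMr_tmp; exact: cvg_harmonic.
Qed.

Lemma integral_fourier_le g : L1 g -> L2on mu g ->
  (\int[mu]_xi (Fcos g xi ^+ 2 + Fsin g xi ^+ 2)%:E <=
   ((2 * pi) ^+ n)%:E * L2norm2 mu g)%E.
Proof.
move=> Lg L2g.
have mq : measurable_fun setT (fun xi => Fcos g xi ^+ 2 + Fsin g xi ^+ 2).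
  by apply: measurable_funD; apply: measurable_funX; [exact: measurable_Fcos|exact: measurable_Fsin].
apply: (@fatou_le _ _ _ _ (fun m xi => expker (harmonic m) xi * (Fcos g xi ^+ 2 + Fsin g xi ^+ 2))).
- by move=> m; apply: measurable_funM => //; exact: measurable_expker.
- exact: mq.
- by move=> m x; rewrite mulr_ge0 ?expker_ge0// addr_ge0// sqr_ge0.
- by move=> x; rewrite addr_ge0// sqr_ge0.
- apply: nearW => x; rewrite -[X in _ --> X]mul1r; apply: cvgMr_tmp; exact: cvg_expker.
- by move=> m; apply: integral_expker_fourier_le => //; exact: harmonic_gt0.
Qed.

(** Real part of the transform given by an absolutely convergent integral, defined at every point;
    [fourier_re] is only an L^2-limit of such functions. *)
Definition fre g : V -> R := fun xi => FC * Fcos g xi.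
Definition fim g : V -> R := fun xi => - (FC * Fsin g xi).

Lemma fourier_const_sqr : FC ^+ 2 * (2 * pi) ^+ n = 1.
Proof.
have p0 : 0 < 2 * pi :> R by rewrite mulr_gt0// pi_gt0.
rewrite /fourier_const exprVn -exprM mulnC exprM sqr_sqrtr ?ltW// mulVf//.
by rewrite expf_neq0// gt_eqF.
Qed.

Lemma fourier_const_gt0 : 0 < FC.
Proof. by rewrite /fourier_const invr_gt0 exprn_gt0// sqrtr_gt0 mulr_gt0// pi_gt0. Qed.

Lemma measurable_fre g : L1 g -> measurable_fun setT (fre g).
Proof. by move=> Lg; apply: measurable_funM => //; exact: measurable_Fcos. Qed.

Lemma measurable_fim g : L1 g -> measurable_fun setT (fim g).
Proof.
by move=> Lg; apply: measurableT_comp; [exact: oppr_measurable|apply: measurable_funM => //; exact: measurable_Fsin].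
Qed.

Lemma L2norm2_fourier_le g : L1 g -> L2on mu g ->
  (L2norm2 mu (fre g) + L2norm2 mu (fim g) <= L2norm2 mu g)%E.
Proof.
move=> Lg L2g; rewrite /L2norm2 -ge0_integralD//; last 4 first.
- by move=> x _; rewrite lee_fin sqr_ge0.
- by apply/measurable_EFinP; apply: measurable_funX; exact: measurable_fre.
- by move=> x _; rewrite lee_fin sqr_ge0.
- by apply/measurable_EFinP; apply: measurable_funX; exact: measurable_fim.
under eq_integral => x _.
  rewrite -EFinD.
  have -> : fre g x ^+ 2 + fim g x ^+ 2 = FC ^+ 2 * (Fcos g x ^+ 2 + Fsin g x ^+ 2).
    by rewrite /fre /fim; ring.
  rewrite EFinM; over.
rewrite ge0_integralZl_EFin//; last 3 first.
- by move=> x _; rewrite lee_fin addr_ge0// sqr_ge0.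
- apply/measurable_EFinP; apply: measurable_funD; apply: measurable_funX.
    exact: measurable_Fcos.
  exact: measurable_Fsin.
- exact: sqr_ge0.
apply: (@le_trans _ _ ((FC ^+ 2)%:E * (((2 * pi) ^+ n)%:E * L2norm2 mu g))%E).
  by rewrite lee_wpmul2l ?lee_fin ?sqr_ge0//; exact: integral_fourier_le.
by rewrite muleA -EFinM fourier_const_sqr mul1e.
Qed.

Lemma L2on_fre g : L1 g -> L2on mu g -> L2on mu (fre g).
Proof.
move=> Lg L2g; apply/L2onP; split; first exact: measurable_fre.
apply: le_lt_trans (L2norm2_lty L2g); apply: le_trans (L2norm2_fourier_le Lg L2g).
by rewrite leeDl// L2norm2_ge0.
Qed.

Lemma L2on_fim g : L1 g -> L2on mu g -> L2on mu (fim g).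
Proof.
move=> Lg L2g; apply/L2onP; split; first exact: measurable_fim.
apply: le_lt_trans (L2norm2_lty L2g); apply: le_trans (L2norm2_fourier_le Lg L2g).
by rewrite leeDr// L2norm2_ge0.
Qed.

Lemma L2dot_fourier_le g : L1 g -> L2on mu g ->
  L2dot mu (fre g) (fre g) + L2dot mu (fim g) (fim g) <= L2dot mu g g.
Proof.
move=> Lg L2g; rewrite -lee_fin EFinD !L2dot_norm2//; [exact: L2norm2_fourier_le|exact: L2on_fim|exact: L2on_fre].
Qed.

Lemma atan_ratio_cvg (y : R) : y != 0 ->
  atan (y / harmonic m) @[m --> \oo] --> if 0 < y then pi / 2 else - (pi / 2).
Proof.
have pos (z : R) : 0 < z -> atan (z / harmonic m) @[m --> \oo] --> pi / 2.
  move=> z0; apply: (@cvg_comp _ _ _ (fun m => z / harmonic m) (@atan R) _ (+oo)%R); last exact: cvgy_atan.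
  apply/cvgryPge => A; near=> m; rewrite /harmonic/= invrK mulrC -ler_pdivrMr//.
  apply: (@le_trans _ _ m%:R); last by rewrite ler_nat.
  by near: m; exact: nbhs_infty_ger.
move=> y0; case: ifPn => [yp|]; first exact: pos.
rewrite -leNgt => yle; have ny : 0 < - y by rewrite oppr_gt0 lt_neqAle y0.
have -> : (fun m => atan (y / harmonic m)) = (fun m => - atan (- y / harmonic m)).
  by apply/funext => m; rewrite mulNr atanN opprK.
by apply: cvgN; exact: pos.
Unshelve. all: by end_near. Qed.

(** On the faces of a box the limit of the Poisson integrals may differ from the indicator; this
    discards the faces. *)
Lemma hyperplane_null (c : R) (i : 'I_n) : {ae mu, forall x : V, x ord0 i != c}.
Proof.
pose A j := if j == i then [set c] else setT : set R.
have mA j : measurable (A j) by rewrite /A; case: ifP.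
exists [set x : V | forall j, A j (x ord0 j)]; split.
- exact: measurable_box.
- rewrite [LHS](lebesgue_rV_box mA) (bigD1 i)//= /A eqxx lebesgue_measure_set1.
  by rewrite mul0e.
- move=> x /= /negP; rewrite negbK => /eqP xc j; rewrite /A.
  by case: eqP => // ->.
Qed.

Lemma measurable_indic_box (a b : V) : measurable_fun setT (\1_(box a b) : V -> R).
Proof. by apply: measurable_indic; exact: measurable_rV_box. Qed.

Lemma L1_indic_box (a b : V) : L1 (\1_(box a b) : V -> R).
Proof.
apply/integrableP; split; first by apply/measurable_EFinP; exact: measurable_indic_box.
have h := integral_indic mu measurableT (measurable_rV_box a b).
rewrite setIT lebesgue_box in h.
rewrite (eq_integral (fun x => (\1_(box a b) x)%:E)) ?h ?ltry// => x _.
by rewrite /= ger0_norm// indicE.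
Qed.

Lemma L2on_indic_box (a b : V) : L2on mu (\1_(box a b) : V -> R).
Proof.
apply/L2onP; split; first exact: measurable_indic_box.
have /integrableP[_] := L1_indic_box a b; apply: le_lt_trans.
rewrite le_eqVlt; apply/orP; left; apply/eqP; apply: eq_integral => x _ /=.
by rewrite indicE; case: (x \in _); rewrite ?expr1n ?normr1// expr0n normr0.
Qed.

Lemma L1_fourier_mul g h : L1 g -> L2on mu g -> L1 h -> L2on mu h ->
  L1 (fun xi => fre g xi * fre h xi + fim g xi * fim h xi).
Proof.
move=> Lg L2g Lh L2h; apply: L1D.
  by apply: integrable_mul; exact: L2on_fre.
by apply: integrable_mul; exact: L2on_fim.
Qed.

(** Both sides of the Poisson identity, taken with e = 1/(m+1), converge by dominated convergence.
    On the right the inner integrals are explicit and bounded by (2 pi)^n, the value that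
    [fourier_const_sqr] cancels. *)
Lemma fourier_box_pairing g (a b : V) : (forall i, a ord0 i <= b ord0 i) ->
  L1 g -> L2on mu g ->
  L2dot mu (fre g) (fre \1_(box a b)) + L2dot mu (fim g) (fim \1_(box a b)) =
  L2dot mu g \1_(box a b).
Proof.
move=> ab Lg L2g; set h : V -> R := \1_(box a b).
have Lh : L1 h by exact: L1_indic_box.
have L2h : L2on mu h by exact: L2on_indic_box.
pose q xi := fre g xi * fre h xi + fim g xi * fim h xi.
have Lq : L1 q by exact: L1_fourier_mul.
have c1 : (\int[mu]_xi (expker (harmonic m) xi * q xi)) @[m --> \oo] --> \int[mu]_xi q xi.
  apply: (@Rintegral_dominated_cvg _ _ (fun xi => `|q xi|)).
  - by move=> m; apply: measurable_funM; [exact: measurable_expker|exact: L1_measurable].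
  - exact: L1_measurable.
  - exact: integrable_norm Lq.
  - move=> m x; rewrite normrM ler_piMl// ger0_norm ?expker_ge0//.
    by apply: expker_le1; exact/ltW/harmonic_gt0.
  - apply: nearW => x; rewrite -[X in _ --> X]mul1r; apply: cvgMr_tmp; exact: cvg_expker.
pose H (m : nat) (x : V) := \prod_i (2 * (atan ((b ord0 i - x ord0 i) / harmonic m) -
  atan ((a ord0 i - x ord0 i) / harmonic m))) : R.
have HE m : \int[mu]_xi (expker (harmonic m) xi * q xi) =
    FC ^+ 2 * \int[mu]_x (g x * H m x).
  have e0 : 0 < harmonic m :> R by exact: harmonic_gt0.
  have -> : \int[mu]_x (g x * H m x) = \int[mu]_x (g x * \int[mu]_y (h y * poisker (harmonic m) (x - y))).
    by apply: eq_Rintegral => x _; rewrite Rintegral_poisker_box.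
  rewrite -poisson_identity// -RintegralZl//.
    by apply: eq_Rintegral => xi _; rewrite /q /fre /fim; ring.
  have iK := integrable_expker n e0.
  apply: eq_integrable (_ : L1 (fun xi => (expker (harmonic m) xi * q xi) * (FC ^+ 2)^-1)) => //.
    move=> xi _ /=; congr (_%:E); rewrite /q /fre /fim; field.
    by rewrite gt_eqF// fourier_const_gt0.
  apply: (@L1_mul_bounded _ _ _ _ `|(FC ^+ 2)^-1|) => //.
  have -> : (fun xi => expker (harmonic m) xi * q xi) = (fun xi => q xi * expker (harmonic m) xi).
    by apply/funext => xi; rewrite mulrC.
  apply: (@L1_mul_bounded _ _ _ _ 1) => //; first exact: measurable_expker.
  by move=> x; rewrite ger0_norm ?expker_ge0//; apply: expker_le1; exact: ltW.
have c2 : (\int[mu]_x (g x * H m x)) @[m --> \oo] --> \int[mu]_x (g x * ((2 * pi) ^+ n * h x)).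
  have mH m : measurable_fun setT (H m).
    apply: (measurable_prod_coord (f := fun i t => 2 * (atan ((b ord0 i - t) / harmonic m) -
      atan ((a ord0 i - t) / harmonic m)))) => i.
    have mc (c : R) : measurable_fun setT (fun t : R => atan ((c - t) / harmonic m)).
      apply: continuous_measurable_fun => t.
      apply: (@continuous_comp _ _ _ (fun t => (c - t) / harmonic m) (@atan R)); last exact: continuous_atan.
      by apply: cvgMr_tmp; apply: cvgB; [exact: cvg_cst|exact: cvg_id].
    by apply: measurable_funM => //; apply: measurable_funB; exact: mc.
  have Hb m x : `|H m x| <= (2 * pi) ^+ n.
    rewrite /H normr_prod -[n in leRHS]card_ord -prodr_const; apply: ler_prod => i _.
    rewrite normr_ge0/= ler_norml.
    move: (_ / _) (_ / _) => y z; have := atan_ltpi2 z; have := atan_gtNpi2 z.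
    have := atan_ltpi2 y; have := atan_gtNpi2 y; lra.
  apply: (@Rintegral_dominated_cvg _ _ (fun x => `|g x| * (2 * pi) ^+ n)).
  - by move=> m; apply: measurable_funM; [exact: L1_measurable|exact: mH].
  - apply: measurable_funM; first exact: L1_measurable.
    by apply: measurable_funM => //; exact: L1_measurable.
  - apply: (@L1_mul_bounded _ _ _ _ `|(2 * pi) ^+ n|) => //; exact: integrable_norm Lg.
  - by move=> m x; rewrite normrM ler_wpM2l.
  have na : {ae mu, forall x : V, forall i, x ord0 i != a ord0 i}.
    by apply: filter_forall => i; exact: hyperplane_null.
  have nb : {ae mu, forall x : V, forall i, x ord0 i != b ord0 i}.
    by apply: filter_forall => i; exact: hyperplane_null.
  apply: filterS2 na nb => x xa xb; apply: cvgMl_tmp.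
  have Hlim : H m x @[m --> \oo] -->
      \prod_i (2 * ((if 0 < b ord0 i - x ord0 i then pi / 2 else - (pi / 2)) -
                    (if 0 < a ord0 i - x ord0 i then pi / 2 else - (pi / 2)))).
    apply: (@cvg_big R _ *%R 1 xpredT (@mul_continuous R)) => i _.
    apply: cvgMl_tmp; apply: cvgB; apply: atan_ratio_cvg; rewrite subr_eq0 eq_sym.
      exact: xb.
    exact: xa.
  suff <- : \prod_i (2 * ((if 0 < b ord0 i - x ord0 i then pi / 2 else - (pi / 2)) -
                    (if 0 < a ord0 i - x ord0 i then pi / 2 else - (pi / 2)))) = (2 * pi) ^+ n * h x.
    exact: Hlim.
  (* Inside the box every factor is 2 (pi/2 + pi/2); outside, some coordinate lies on one side of
     both endpoints and its factor is 0. *)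
  rewrite /h indicE; have [Hx|Hx] := pselect (box a b x).
    rewrite mem_set// mulr1 -[n in RHS]card_ord -prodr_const; apply: eq_bigr => i _.
    have := Hx i; rewrite /= in_itv/= => /andP[h1 h2].
    rewrite !subr_gt0 lt_neqAle xb h2/= ltNge (ltW h1)/=; lra.
  rewrite memNset// mulr0.
  have [i Hi] : exists i, ~ (`]a ord0 i, b ord0 i]%classic (x ord0 i)) by exact/existsNP.
  rewrite (bigD1 i)//= !subr_gt0; move: Hi; rewrite /= in_itv/= => /negP.
  have := xa i; have := xb i; rewrite negb_and -leNgt -ltNge => /negPf hb /negPf ha /orP[h1|h1].
    have ax : x ord0 i < a ord0 i by rewrite lt_neqAle ha h1.
    by rewrite ax (lt_le_trans ax (ab i)) subrr mulr0 mul0r.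
  rewrite ltNge (ltW h1)/= ltNge (le_trans (ab i) (ltW h1))/= opprK addNr mulr0 mul0r//.
have c1' : (FC ^+ 2 * \int[mu]_x (g x * H m x)) @[m --> \oo] --> \int[mu]_xi q xi.
  by under eq_fun do rewrite -HE.
have c2' : (FC ^+ 2 * \int[mu]_x (g x * H m x)) @[m --> \oo] -->
    FC ^+ 2 * \int[mu]_x (g x * ((2 * pi) ^+ n * h x)) by exact: cvgMl_tmp.
have : \int[mu]_xi q xi = FC ^+ 2 * \int[mu]_x (g x * ((2 * pi) ^+ n * h x)).
  exact: (cvg_unique _ c1' c2').
rewrite /L2dot -RintegralD//; last 2 first.
- by apply: integrable_mul; exact: L2on_fre.
- by apply: integrable_mul; exact: L2on_fim.
move=> ->; rewrite -RintegralZl//.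
  apply: eq_Rintegral => x _; have := fourier_const_sqr.
  move: (FC ^+ 2) ((2 * pi) ^+ n) => P Q PQ.
  by rewrite mulrCA [P * _]mulrA PQ mul1r.
apply: (@L1_mul_bounded _ _ _ _ ((2 * pi) ^+ n)) => //.
  by apply: measurable_funM => //; exact: L1_measurable.
have p0 : 0 <= (2 * pi) ^+ n :> R by rewrite exprn_ge0// mulr_ge0// pi_ge0.
move=> x; rewrite normrM ger0_norm// ler_piMr// /h indicE.
by case: (x \in _); rewrite ?normr1 ?normr0.
Qed.

End plancherel_boxes.

(** * The Fourier transform on L^2 *)

Section truncation.
Context {R : realType} (n : nat).
Local Notation V := 'rV[R]_n.
Local Notation mu := (lebesgue_rV n : {measure set 'rV[R]_n -> \bar R}).
Local Notation dot := (@L2dot _ _ _ mu).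
Local Notation L2V := (@L2on _ _ _ mu).
Implicit Types (u v f g h : V -> R).

Definition trunc (k : nat) u : V -> R := u \_ (eball k%:R).

Lemma measurable_restrict_rV (A : set V) u : measurable A -> measurable_fun setT u ->
  measurable_fun setT (u \_ A).
Proof. by move=> mA mu_; apply/(measurable_restrictT _ mA); exact: measurable_funTS. Qed.

Lemma L2on_restrict (A : set V) u : measurable A -> L2V u -> L2V (u \_ A).
Proof.
move=> mA Lu; have mu_ := measurable_restrict_rV mA (L2on_measurable Lu).
apply: L2on_le mu_ _ Lu.
by move=> x; rewrite patchE; case: ifP => //; rewrite normr0.
Qed.

Lemma L2on_trunc k u : L2V u -> L2V (trunc k u).
Proof. by apply: L2on_restrict; exact: measurable_eball. Qed.

Lemma L1_restrict (A : set V) u : measurable A -> (mu A < +oo)%E -> L2V u -> L1 (u \_ A).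
Proof.
move=> mA fA Lu; have LA : L2V (\1_A : V -> R).
  apply/L2onP; split; first exact: measurable_indic.
  rewrite /L2norm2 (eq_integral (fun x => (\1_A x)%:E)).
    by rewrite (integral_indic mu measurableT mA) setIT.
  by move=> x _; rewrite indicE; case: (x \in A); rewrite ?expr1n// expr0n.
have := integrable_mul Lu LA; apply: eq_integrable => // x _ /=.
by rewrite patchE indicE; case: ifP => _; rewrite ?mulr1 ?mulr0.
Qed.

Lemma L1_trunc k u : L2V u -> L1 (trunc k u).
Proof. by apply: L1_restrict; [exact: measurable_eball|exact: lebesgue_eball_lty]. Qed.

Lemma trunc_linear k a u v : trunc k (a *: u + v) = a *: trunc k u + trunc k v.
Proof.
apply/funext => x; rewrite /trunc -[RHS]/(a * (u \_ _) x + (v \_ _) x) !patchE.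
by case: ifP => _ //; rewrite mulr0 addr0.
Qed.

Lemma Fcos_linear a g h xi : L1 g -> L1 h ->
  Fcos (a *: g + h) xi = a * Fcos g xi + Fcos h xi.
Proof.
move=> Lg Lh; rewrite /Fcos -RintegralZl//; last exact: L1_cos.
rewrite -RintegralD//; last 2 first.
- by apply: (@L1Z _ _ a (fun x => g x * cos (dotrV x xi))); exact: L1_cos.
- exact: L1_cos.
by apply: eq_Rintegral => x _ /=; rewrite mulrDl -mulrA.
Qed.

Lemma Fsin_linear a g h xi : L1 g -> L1 h ->
  Fsin (a *: g + h) xi = a * Fsin g xi + Fsin h xi.
Proof.
move=> Lg Lh; rewrite /Fsin -RintegralZl//; last exact: L1_sin.
rewrite -RintegralD//; last 2 first.
- by apply: (@L1Z _ _ a (fun x => g x * sin (dotrV x xi))); exact: L1_sin.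
- exact: L1_sin.
by apply: eq_Rintegral => x _ /=; rewrite mulrDl -mulrA.
Qed.

Lemma fre_linear a g h : L1 g -> L1 h -> fre (a *: g + h) = a *: fre g + fre h.
Proof.
move=> Lg Lh; apply/funext => xi; rewrite /fre Fcos_linear//.
by rewrite mulrDr mulrCA.
Qed.

Lemma fim_linear a g h : L1 g -> L1 h -> fim (a *: g + h) = a *: fim g + fim h.
Proof.
move=> Lg Lh; apply/funext => xi; rewrite /fim Fsin_linear//.
by rewrite mulrDr mulrCA opprD -mulrN.
Qed.

Lemma freB g h : L1 g -> L1 h -> fre (g - h) = fre g - fre h.
Proof. by move=> Lg Lh; rewrite addrC -scaleN1r fre_linear// scaleN1r addrC. Qed.

Lemma fimB g h : L1 g -> L1 h -> fim (g - h) = fim g - fim h.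
Proof. by move=> Lg Lh; rewrite addrC -scaleN1r fim_linear// scaleN1r addrC. Qed.

Lemma trunc_cvg u : L2V u -> converges_to dot (trunc ^~ u) u.
Proof.
move=> Lu; apply/(converges_cvg (@subspace_L2 _ _ _ mu) (fun x _ => L2dot_ge0 mu x)) => //.
  by move=> k; exact: L2on_trunc.
have -> : (0 : R) = \int[mu]_x (cst 0 x : R) by rewrite /Rintegral integral0.
have LB k := subspaceB (@subspace_L2 _ _ _ mu) (L2on_trunc k Lu) Lu.
apply: (@Rintegral_dominated_cvg _ _ _ _ (fun x => u x * u x)).
- by move=> k; exact: L1_measurable (integrable_mul (LB k) (LB k)).
- exact: measurable_cst.
- exact: integrable_mul.
- move=> k x; rewrite ger0_norm -?expr2 ?sqr_ge0//.
  rewrite /trunc -[(_ - _) x]/(_ x - u x) patchE; case: ifP => _.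
    by rewrite subrr expr0n sqr_ge0.
  by rewrite sub0r sqrrN.
- apply: nearW => x; apply: cvg_near_cst.
  near=> k; rewrite /= /trunc -[(_ - _) x]/(_ x - u x) patchE mem_set ?subrr ?mul0r//.
  by rewrite /eball/=; near: k; exact: nbhs_infty_ger.
Unshelve. all: by end_near. Qed.

Lemma fourier_re_truncE u k : fourier_re_trunc u k = fre (trunc k u).
Proof.
apply/funext => xi; rewrite /fourier_re_trunc /fre /Fcos; congr (_ * _).
rewrite Rintegral_mkcond; apply: eq_Rintegral => x _.
by rewrite /trunc !patchE; case: ifP => // _; rewrite mul0r.
Qed.

Lemma fourier_im_truncE u k : fourier_im_trunc u k = fim (trunc k u).
Proof.
apply/funext => xi; rewrite /fourier_im_trunc /fim /Fsin; congr (- (_ * _)).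
rewrite Rintegral_mkcond; apply: eq_Rintegral => x _.
by rewrite /trunc !patchE; case: ifP => // _; rewrite mul0r.
Qed.

Lemma Lnorm_cvg0 (f : nat -> V -> R) : (forall k, L2V (f k)) ->
  ((fun k => 'N[mu]_2%:E[EFin \o f k])%E @ \oo --> 0%E) <->
  (dot (f k) (f k) @[k --> \oo] --> (0 : R)).
Proof.
move=> Lf.
have NE : (fun k => 'N[mu]_2%:E[EFin \o f k])%E = (fun k => (Num.sqrt (dot (f k) (f k)))%:E).
  by apply/funext => k; rewrite LnormE -L2dot_norm2// poweR12_sqrt// lee_fin L2dot_ge0.
rewrite NE; split => [/fine_cvg /= h|h].
  have -> : (fun k => dot (f k) (f k)) = (fun k => Num.sqrt (dot (f k) (f k)) * Num.sqrt (dot (f k) (f k))).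
    by apply/funext => k; rewrite -expr2 sqr_sqrtr// L2dot_ge0.
  by rewrite -[X in _ --> X](mulr0 (0 : R)); apply: cvgM; exact: h.
apply: cvg_EFin; first exact: nearW.
rewrite -[X in _ --> X]sqrtr0; apply: continuous_cvg h; exact: sqrt_continuous.
Qed.

Lemma fre_trunc_cauchy u : L2V u -> cauchy_for dot (fun k => fre (trunc k u)).
Proof.
move=> Lu e e0.
have [N H] := converges_cauchy (@subspace_L2 _ _ _ mu) (symbilinear_L2dot mu)
  (fun x _ => L2dot_ge0 mu x) (fun k => L2on_trunc k Lu) Lu (trunc_cvg Lu) e0.
exists N => i j Ni Nj; apply: le_lt_trans (H i j Ni Nj).
rewrite -freB; [|exact: L1_trunc..].
have LB := subspaceB (@subspace_L2 _ _ _ mu) (L2on_trunc i Lu) (L2on_trunc j Lu).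
apply: le_trans (L2dot_fourier_le (L1B (L1_trunc i Lu) (L1_trunc j Lu)) LB).
by rewrite lerDl L2dot_ge0.
Qed.

Lemma fim_trunc_cauchy u : L2V u -> cauchy_for dot (fun k => fim (trunc k u)).
Proof.
move=> Lu e e0.
have [N H] := converges_cauchy (@subspace_L2 _ _ _ mu) (symbilinear_L2dot mu)
  (fun x _ => L2dot_ge0 mu x) (fun k => L2on_trunc k Lu) Lu (trunc_cvg Lu) e0.
exists N => i j Ni Nj; apply: le_lt_trans (H i j Ni Nj).
rewrite -fimB; [|exact: L1_trunc..].
have LB := subspaceB (@subspace_L2 _ _ _ mu) (L2on_trunc i Lu) (L2on_trunc j Lu).
apply: le_trans (L2dot_fourier_le (L1B (L1_trunc i Lu) (L1_trunc j Lu)) LB).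
by rewrite lerDr L2dot_ge0.
Qed.

Lemma L2on_fre_trunc k u : L2V u -> L2V (fre (trunc k u)).
Proof. by move=> Lu; apply: L2on_fre; [exact: L1_trunc|exact: L2on_trunc]. Qed.

Lemma L2on_fim_trunc k u : L2V u -> L2V (fim (trunc k u)).
Proof. by move=> Lu; apply: L2on_fim; [exact: L1_trunc|exact: L2on_trunc]. Qed.

(** Here the chosen pair is shown to exist: the transforms of the truncations are Cauchy by the
    upper half of Plancherel's formula, and L^2 is complete. *)
Lemma fourierP u : L2V u -> [/\ L2V (fourier_re u), L2V (fourier_im u),
  converges_to dot (fun k => fre (trunc k u)) (fourier_re u) &
  converges_to dot (fun k => fim (trunc k u)) (fourier_im u)].
Proof.
move=> Lu; have Lre k := L2on_fre_trunc k Lu; have Lim k := L2on_fim_trunc k Lu.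
have sL := @subspace_L2 _ _ _ mu.
have [a La ha] := L2_complete Lre (fre_trunc_cauchy Lu).
have [b Lb hb] := L2_complete Lim (fim_trunc_cauchy Lu).
have : is_fourier u (fourier u).
  apply: getPex; exists (a, b); split => //=.
    rewrite (_ : (fun k => _) = (fun k => 'N[mu]_2%:E[EFin \o (fre (trunc k u) - a)%R])%E); last first.
      by apply/funext => k; rewrite fourier_re_truncE.
    apply/Lnorm_cvg0; first by move=> k; exact: (subspaceB sL (Lre k) La).
    by apply/(converges_cvg sL (fun x _ => L2dot_ge0 mu x)).
  rewrite (_ : (fun k => _) = (fun k => 'N[mu]_2%:E[EFin \o (fim (trunc k u) - b)%R])%E); last first.
    by apply/funext => k; rewrite fourier_im_truncE.
  apply/Lnorm_cvg0; first by move=> k; exact: (subspaceB sL (Lim k) Lb).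
  by apply/(converges_cvg sL (fun x _ => L2dot_ge0 mu x)).
move=> [L1' L2' h1 h2]; split => //.
  apply/(converges_cvg sL (fun x _ => L2dot_ge0 mu x)) => //.
  apply/Lnorm_cvg0; first by move=> k; exact: (subspaceB sL (Lre k) L1').
  rewrite (_ : (fun k => _) = (fun k => 'N[mu]_2%:E[EFin \o (fourier_re_trunc u k \- (fourier u).1)%R])%E)//.
  by apply/funext => k; rewrite fourier_re_truncE.
apply/(converges_cvg sL (fun x _ => L2dot_ge0 mu x)) => //.
apply/Lnorm_cvg0; first by move=> k; exact: (subspaceB sL (Lim k) L2').
rewrite (_ : (fun k => _) = (fun k => 'N[mu]_2%:E[EFin \o (fourier_im_trunc u k \- (fourier u).2)%R])%E)//.
by apply/funext => k; rewrite fourier_im_truncE.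
Qed.

Lemma L2on_fourier_re u : L2V u -> L2V (fourier_re u).
Proof. by case/fourierP. Qed.

Lemma L2on_fourier_im u : L2V u -> L2V (fourier_im u).
Proof. by case/fourierP. Qed.

Lemma L2_limit_unique (f : nat -> V -> R) g h : (forall k, L2V (f k)) -> L2V g -> L2V h ->
  converges_to dot f g -> converges_to dot f h -> g = h %[ae mu].
Proof.
move=> Lf Lg Lh fg fh; have sL := @subspace_L2 _ _ _ mu.
have LB := subspaceB sL Lg Lh.
have := L2dot_eq0 LB (converges_unique sL (symbilinear_L2dot mu)
  (fun x _ => L2dot_ge0 mu x) Lf Lg Lh fg fh).
by apply: filterS => x /[apply] /eqP; rewrite subr_eq0 => /eqP.
Qed.

(** The three transforms are independent choices of representatives, so equality holds off a null
    set only; it follows from uniqueness of L^2-limits. *)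
Lemma fourier_re_linear a u v : L2V u -> L2V v ->
  fourier_re (a *: u + v) = a *: fourier_re u + fourier_re v %[ae mu].
Proof.
move=> Lu Lv; have sL := @subspace_L2 _ _ _ mu.
have Luv : L2V (a *: u + v) by exact: sL.2.
have [Lr _ hr _] := fourierP Luv; have [Lr1 _ h1 _] := fourierP Lu.
have [Lr2 _ h2 _] := fourierP Lv.
apply: (L2_limit_unique (fun k => L2on_fre_trunc k Luv) Lr _ hr); first exact: sL.2.
rewrite (_ : (fun k => _) = (fun k => a *: fre (trunc k u) + fre (trunc k v))); last first.
  by apply/funext => k; rewrite trunc_linear fre_linear//; exact: L1_trunc.
apply: (converges_linear sL (symbilinear_L2dot mu) (fun x _ => L2dot_ge0 mu x)) => // k;
  exact: L2on_fre_trunc.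
Qed.

Lemma fourier_im_linear a u v : L2V u -> L2V v ->
  fourier_im (a *: u + v) = a *: fourier_im u + fourier_im v %[ae mu].
Proof.
move=> Lu Lv; have sL := @subspace_L2 _ _ _ mu.
have Luv : L2V (a *: u + v) by exact: sL.2.
have [_ Lr _ hr] := fourierP Luv; have [_ Lr1 _ h1] := fourierP Lu.
have [_ Lr2 _ h2] := fourierP Lv.
apply: (L2_limit_unique (fun k => L2on_fim_trunc k Luv) Lr _ hr); first exact: sL.2.
rewrite (_ : (fun k => _) = (fun k => a *: fim (trunc k u) + fim (trunc k v))); last first.
  by apply/funext => k; rewrite trunc_linear fim_linear//; exact: L1_trunc.
apply: (converges_linear sL (symbilinear_L2dot mu) (fun x _ => L2dot_ge0 mu x)) => // k;
  exact: L2on_fim_trunc.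
Qed.

Lemma Rintegral_ae f g : measurable_fun setT f -> measurable_fun setT g ->
  f = g %[ae mu] -> \int[mu]_x f x = \int[mu]_x g x.
Proof.
move=> mf mg fg; congr fine; apply: ae_eq_integral => //; try exact/measurable_EFinP.
by apply: filterS fg => x + _ => /(_ Logic.I) ->.
Qed.

(** A true equality, in contrast to linearity: the truncated integrals of u and v agree at every
    point, so both choices are made from the same predicate. *)
Lemma fourier_ae u v : L2V u -> L2V v -> u = v %[ae mu] -> fourier u = fourier v.
Proof.
move=> Lu Lv uv.
have tuv k : trunc k u = trunc k v %[ae mu].
  by apply: filterS uv => x /= + _ => /(_ Logic.I) e; rewrite /trunc !patchE e.
have re k : fourier_re_trunc u k = fourier_re_trunc v k.
  rewrite !fourier_re_truncE; apply/funext => xi; congr (_ * _).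
  apply: Rintegral_ae; [exact: L1_measurable (L1_cos _ (L1_trunc k _))..|].
  by apply: filterS (tuv k) => x /= + _ => /(_ Logic.I) ->.
have im k : fourier_im_trunc u k = fourier_im_trunc v k.
  rewrite !fourier_im_truncE; apply/funext => xi; congr (- (_ * _)).
  apply: Rintegral_ae; [exact: L1_measurable (L1_sin _ (L1_trunc k _))..|].
  by apply: filterS (tuv k) => x /= + _ => /(_ Logic.I) ->.
rewrite /fourier; congr get; apply/funext => g; rewrite /is_fourier.
by rewrite (funext re) (funext im).
Qed.

(** The truncations are eventually u itself, so the constant sequence [fre u] determines the
    limit. *)
Lemma fourier_re_bounded u k : L2V u -> (forall x, ~ eball k%:R x -> u x = 0) ->
  fourier_re u = fre u %[ae mu].
Proof.
move=> Lu uk; have [Lr _ hr _] := fourierP Lu.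
have tu j : (k <= j)%N -> trunc j u = u.
  move=> kj; apply/funext => x; rewrite /trunc patchE; case: ifPn => // /negP xj.
  rewrite uk// => xk; apply: xj; rewrite mem_set//; apply: le_trans xk _; rewrite ler_nat//.
have Lru : L2V (fre u) by rewrite -(tu k)//; exact: L2on_fre_trunc.
apply: (L2_limit_unique (fun j => L2on_fre_trunc j Lu) Lr Lru hr).
apply: (converges_eventually (@subspace_L2 _ _ _ mu) (symbilinear_L2dot mu) (N := k)) => [j|j kj].
  exact: L2on_fre_trunc.
by rewrite tu.
Qed.

Lemma fourier_im_bounded u k : L2V u -> (forall x, ~ eball k%:R x -> u x = 0) ->
  fourier_im u = fim u %[ae mu].
Proof.
move=> Lu uk; have [_ Lr _ hr] := fourierP Lu.
have tu j : (k <= j)%N -> trunc j u = u.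
  move=> kj; apply/funext => x; rewrite /trunc patchE; case: ifPn => // /negP xj.
  rewrite uk// => xk; apply: xj; rewrite mem_set//; apply: le_trans xk _; rewrite ler_nat//.
have Lru : L2V (fim u) by rewrite -(tu k)//; exact: L2on_fim_trunc.
apply: (L2_limit_unique (fun j => L2on_fim_trunc j Lu) Lr Lru hr).
apply: (converges_eventually (@subspace_L2 _ _ _ mu) (symbilinear_L2dot mu) (N := k)) => [j|j kj].
  exact: L2on_fim_trunc.
by rewrite tu.
Qed.

End truncation.

(** * Plancherel's formula *)

Section plancherel.
Context {R : realType} (n : nat).
Local Notation V := 'rV[R]_n.
Local Notation mu := (lebesgue_rV n : {measure set 'rV[R]_n -> \bar R}).
Local Notation dot := (@L2dot _ _ _ mu).
Local Notation L2V := (@L2on _ _ _ mu).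
Implicit Types (u v f g h : V -> R).

(** Dynkin's lemma for the sets whose part in a fixed cube has integral 0; the cube is there because
    z, being in L^2, is integrable only on sets of finite measure. *)
Lemma integral_box_eq0 z : L2V z -> (forall a b : V, dot z \1_(box a b) = 0) ->
  forall (k : nat) (A : set V), measurable A ->
  (\int[mu]_(x in A `&` cube k%:R) (z x)%:E = 0)%E.
Proof.
move=> Lz z0 k.
have mC (r : R) : measurable (cube r : set V) by exact: measurable_rV_box.
have iz : mu.-integrable (cube k%:R) (EFin \o z).
  have := L1_restrict (mC k%:R) (lebesgue_cube_lty n k%:R) Lz.
  by rewrite /L1 -restrict_EFin; move/(integrable_mkcond _ (mC _)).
have izA (A : set V) : measurable A -> mu.-integrable (A `&` cube k%:R) (EFin \o z).
  move=> mA; apply: (integrableS (mC k%:R)) iz; last exact: subIsetr.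
  exact: measurableI.
have zb a b : (\int[mu]_(x in box a b) (z x)%:E = 0)%E.
  have mB := measurable_rV_box a b.
  have := z0 a b; rewrite /L2dot /Rintegral.
  rewrite (eq_integral ((EFin \o z) \_ (box a b))); last first.
    move=> x _; rewrite patchE indicE; case: ifP => _; first by rewrite mulr1.
    by rewrite mulr0.
  rewrite -integral_mkcond => h; rewrite -[LHS]fineK; first by rewrite [fine _]h.
  apply: integrable_fin_num => //; apply/(integrable_mkcond _ mB).
  rewrite restrict_EFin; apply: L1_restrict => //.
  by rewrite lebesgue_box ltry.
have := @dynkin_induction _ V (@boxes R n) (fun A => \int[mu]_(x in A `&` cube k%:R) (z x)%:E = 0)%E
  (@measurable_rVE R n) (@boxes_setI R n).
move=> H A mA; have {mA} : <<s @boxes R n >> A by rewrite -measurable_rVE.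
apply: H => {A}.
- by rewrite setTI; exact: zb.
- move=> A BA; have [p _ <-] := boxes_setI BA (ex_intro2 _ _ (const_mx (- k%:R), const_mx k%:R) Logic.I erefl : boxes (cube k%:R)).
  exact: zb.
- move=> A mA A0.
  have := @integral_setU _ _ _ mu (A `&` cube k%:R) (~` A `&` cube k%:R) (EFin \o z).
  rewrite -setIUl setUv setTI [X in _ = (X + _)%E]A0 add0e => <-.
  + exact: zb.
  + exact: measurableI.
  + by apply: measurableI => //; exact: measurableC.
  + exact: measurable_int iz.
  + by apply/disj_set2P; rewrite setIACA setICr set0I.
- move=> F mF tF F0; rewrite setI_bigcupl integral_bigcup.
  + by rewrite eseries0// => i _ _; exact: F0.
  + apply/trivIsetP => i j _ _ ij; rewrite setIACA.
    by move/trivIsetP : tF => /(_ i j Logic.I Logic.I ij) ->; rewrite set0I.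
  + by move=> i; exact: measurableI.
  + by rewrite -setI_bigcupl; apply: izA; exact: bigcup_measurable.
Qed.

Lemma L2_box_eq0 z : L2V z -> (forall a b : V, dot z \1_(box a b) = 0) ->
  z = cst 0 %[ae mu].
Proof.
move=> Lz z0; have zi := integral_box_eq0 Lz z0.
have mC (r : R) : measurable (cube r : set V) by exact: measurable_rV_box.
have zk k : {ae mu, forall x, cube k%:R x -> z x = 0}.
  have iz : mu.-integrable (cube k%:R) (EFin \o z).
    have := L1_restrict (mC k%:R) (lebesgue_cube_lty n k%:R) Lz.
    by rewrite /L1 -restrict_EFin; move/(integrable_mkcond _ (mC _)).
  have : ae_eq mu (cube k%:R) (EFin \o z) (cst 0%E).
    apply: (integral_ae_eq (mC k%:R) iz) => // A AC mA.
    by rewrite integral0 -(setIidl AC); exact: zi.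
  by apply: filterS => x /= + xk => /(_ xk) [].
have : mu.-negligible (\bigcup_k ~` [set x | cube k%:R x -> z x = 0]).
  by apply: negligible_bigcup => k; exact: zk.
apply: negligibleS => x /= nz; apply: contrapT => H; apply: nz => _.
have [k _ xk] : (\bigcup_k cube k%:R) x by rewrite cube_cover.
by apply: contrapT => zx; apply: H; exists k => // /(_ xk).
Qed.

Opaque L2dot L2on fourier fourier_re fourier_im.

Definition fourier_dot u v :=
  dot (fourier_re u) (fourier_re v) + dot (fourier_im u) (fourier_im v).

Let sL : subspace L2V := @subspace_L2 _ _ _ mu.
Let bL : symbilinear_on L2V dot := symbilinear_L2dot mu.
Let dot0 : forall x, L2V x -> 0 <= dot x x := fun x _ => L2dot_ge0 mu x.

Lemma symbilinear_fourier_dot : symbilinear_on L2V fourier_dot.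
Proof.
split=> [u v Lu Lv|v Lv a u w Lu Lw].
  rewrite /fourier_dot (bL.1 _ _ (L2on_fourier_re Lu) (L2on_fourier_re Lv)).
  by rewrite (bL.1 _ _ (L2on_fourier_im Lu) (L2on_fourier_im Lv)).
have Luw := sL.2 a _ _ Lu Lw.
have Lr := @L2on_fourier_re R n; have Li := @L2on_fourier_im R n.
have er : dot (a *: fourier_re u + fourier_re w) (fourier_re v) =
    a * dot (fourier_re u) (fourier_re v) + dot (fourier_re w) (fourier_re v).
  by apply: (bL.2 _ (Lr _ Lv)); exact: Lr.
have ei : dot (a *: fourier_im u + fourier_im w) (fourier_im v) =
    a * dot (fourier_im u) (fourier_im v) + dot (fourier_im w) (fourier_im v).
  by apply: (bL.2 _ (Li _ Lv)); exact: Li.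
rewrite /fourier_dot (L2dot_ae _ _ _ _ (fourier_re_linear a Lu Lw) (ae_eq_refl mu setT (fourier_re v))).
- rewrite (L2dot_ae _ _ _ _ (fourier_im_linear a Lu Lw) (ae_eq_refl mu setT (fourier_im v))).
  + rewrite er ei.
    move: (dot (fourier_re u) (fourier_re v)) (dot (fourier_im u) (fourier_im v))
      (dot (fourier_re w) (fourier_re v)) (dot (fourier_im w) (fourier_im v)).
    by move=> A B C D; ring.
  + exact: Li.
  + by apply: sL.2; exact: Li.
  + exact: Li.
  + exact: Li.
- exact: Lr.
- by apply: sL.2; exact: Lr.
- exact: Lr.
- exact: Lr.
Qed.

Lemma fourier_dot_le u : L2V u -> fourier_dot u u <= dot u u.
Proof.
move=> Lu; have [Lr Li hr hi] := fourierP Lu.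
have c1 := form_cvg sL bL dot0 (fun k => L2on_fre_trunc k Lu) (fun k => L2on_fre_trunc k Lu) Lr Lr hr hr.
have c2 := form_cvg sL bL dot0 (fun k => L2on_fim_trunc k Lu) (fun k => L2on_fim_trunc k Lu) Li Li hi hi.
have c3 := form_cvg sL bL dot0 (fun k => L2on_trunc k Lu) (fun k => L2on_trunc k Lu) Lu Lu (trunc_cvg Lu) (trunc_cvg Lu).
have c12 : (dot (fre (trunc k u)) (fre (trunc k u)) + dot (fim (trunc k u)) (fim (trunc k u)))
  @[k --> \oo] --> fourier_dot u u by exact: cvgD.
rewrite -(cvg_lim (@Rhausdorff R) c12) -(cvg_lim (@Rhausdorff R) c3).
apply: ler_lim; [by apply/cvg_ex; eexists; exact: c12|by apply/cvg_ex; eexists; exact: c3|].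
by apply: nearW => k; apply: L2dot_fourier_le; [exact: L1_trunc|exact: L2on_trunc].
Qed.

Lemma fourier_dot_box g (a b : V) : L2V g -> fourier_dot g \1_(box a b) = dot g \1_(box a b).
Proof.
(* If some lower bound exceeds the upper one, the box is empty and both sides vanish. *)
move=> Lg; have [ab|nab] := pselect (forall i, a ord0 i <= b ord0 i); last first.
  have -> : \1_(box a b) = 0 :> (V -> R).
    have [i /negP] : exists i, ~ (a ord0 i <= b ord0 i) by exact/existsNP.
    rewrite -ltNge => ba; apply/funext => x; rewrite indicE memNset// => /(_ i).
    by rewrite /= in_itv/= => /andP[h1 h2]; move: (lt_trans (lt_le_trans h1 h2) ba); rewrite ltxx.
  have L0 := sL.1.
  rewrite (linear_on0 sL (linear_onr sL symbilinear_fourier_dot Lg)).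
  by rewrite (linear_on0 sL (linear_onr sL bL Lg)).
set h : V -> R := \1_(box a b).
have Lh : L2V h by exact: L2on_indic_box.
have L1h : L1 h by exact: L1_indic_box.
have [k hk] : exists k : nat, box a b `<=` eball k%:R.
  apply: bounded_sub_eball; exists (\sum_i (`|a ord0 i| + `|b ord0 i|)); split; first exact: num_real.
  move=> M hM x xab; apply: le_trans (ltW hM).
  have M0 : 0 <= \sum_i (`|a ord0 i| + `|b ord0 i|) by apply: sumr_ge0 => i _; rewrite addr_ge0.
  rewrite -[leLHS]/(mx_norm x) mx_normrE; apply: bigmax_le => // -[i j] _ /=; rewrite ord1.
  rewrite (bigD1 j)//=; apply: ler_wpDr; first by apply: sumr_ge0 => l _; rewrite addr_ge0.
  have := xab j; rewrite /= in_itv/= => /andP[h1 h2].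
  rewrite ler_norml; have := ler_norm (b ord0 j); have := ler_norm (- a ord0 j).
  have := normr_ge0 (a ord0 j); have := normr_ge0 (b ord0 j); rewrite normrN.
  by move=> *; apply/andP; split; lra.
have hout x : ~ eball k%:R x -> h x = 0.
  by move=> xk; rewrite /h indicE memNset// => /hk.
have hre := fourier_re_bounded Lh hout; have him := fourier_im_bounded Lh hout.
have [Lr Li cr ci] := fourierP Lg.
have Lfr : L2V (fre h) by exact: L2on_fre.
have Lfi : L2V (fim h) by exact: L2on_fim.
have cc f (Lf : L2V f) : converges_to dot (fun=> f) f.
  exact: (converges_eventually sL bL (N := 0%N) (fun=> Lf)).
have c1 := form_cvg sL bL dot0 (fun k => L2on_fre_trunc k Lg) (fun=> Lfr) Lr Lfr cr (cc _ Lfr).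
have c2 := form_cvg sL bL dot0 (fun k => L2on_fim_trunc k Lg) (fun=> Lfi) Li Lfi ci (cc _ Lfi).
have c3 := form_cvg sL bL dot0 (fun k => L2on_trunc k Lg) (fun=> Lh) Lg Lh (trunc_cvg Lg) (cc _ Lh).
have c12 : (dot (fre (trunc k g)) (fre h) + dot (fim (trunc k g)) (fim h))
  @[k --> \oo] --> dot (fourier_re g) (fre h) + dot (fourier_im g) (fim h) by exact: cvgD.
have -> : fourier_dot g h = dot (fourier_re g) (fre h) + dot (fourier_im g) (fim h).
  rewrite /fourier_dot (L2dot_ae Lr Lr (L2on_fourier_re Lh) Lfr (ae_eq_refl mu setT _) hre).
  by rewrite (L2dot_ae Li Li (L2on_fourier_im Lh) Lfi (ae_eq_refl mu setT _) him).
apply: (cvg_unique _ c12).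
  exact: Rhausdorff.
rewrite /= (_ : (fun k => _ + _) = (fun k => dot (trunc k g) h)); first exact: c3.
by apply/funext => j; apply: fourier_box_pairing => //; [exact: L1_trunc|exact: L2on_trunc].
Qed.

(** The functions h for which the formula holds against every g form a subspace that contains the
    indicators of boxes and so is dense. Both forms are bounded by the L^2 norm, by
    [fourier_dot_le], and the defect is therefore continuous. *)
Lemma plancherel u v : L2V u -> L2V v -> fourier_dot u v = dot u v.
Proof.
move=> Lu; have bF := symbilinear_fourier_dot.
pose M := [set h | L2V h /\ forall g, L2V g -> fourier_dot g h = dot g h].
have subM : subspace M.
  split; first split; first exact: sL.1.
    move=> g Lg; rewrite (linear_on0 sL (linear_onr sL bF Lg)).
    by rewrite (linear_on0 sL (linear_onr sL bL Lg)).
  move=> a x y [Lx hx] [Ly hy]; split; first exact: sL.2.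
  move=> g Lg; rewrite (linear_onr sL bF Lg)// (linear_onr sL bL Lg)//.
  by rewrite hx// hy.
have dense : L2V `<=` closure_in L2V dot M.
  apply: dense_of_orthogonal => //; [exact: hilbert_L2|by move=> x []|].
  move=> z Lz zM; rewrite (_ : dot z z = dot z (0 : V -> R)); last first.
    apply: (L2dot_ae Lz Lz Lz sL.1 (ae_eq_refl mu setT z)).
    apply: L2_box_eq0 => // a b; apply: zM; split; first exact: L2on_indic_box.
    by move=> g Lg; exact: fourier_dot_box.
  by rewrite (linear_on0 sL (linear_onr sL bL Lz)).
move=> Lv; apply/eqP; rewrite -subr_eq0; apply/eqP.
(* The factor 4 comes from (p - q)^2 <= 2 p^2 + 2 q^2, each square being at most e times
   [dot u u]. *)
apply: (@eq0_of_sqr_le _ _ (4 * dot u u)) => e e0.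
have [_ /(_ e e0)[m [[_ Mm] Lm hm]]] := dense _ Lv.
have Lvm := subspaceB sL Lv Lm.
have -> : fourier_dot u v - dot u v = fourier_dot u (v - m) - dot u (v - m).
  rewrite (linear_onB (linear_onr sL bF Lu))// (linear_onB (linear_onr sL bL Lu))//.
  by rewrite Mm//; ring.
have F0 x : L2V x -> 0 <= fourier_dot x x.
  by move=> Lx; rewrite addr_ge0// L2dot_ge0.
have h1 := form_cauchy_schwarz sL bF F0 Lu Lvm.
have h2 := form_cauchy_schwarz sL bL dot0 Lu Lvm.
have l1 := fourier_dot_le Lu; have l2 := fourier_dot_le Lvm.
have f1 := F0 _ Lu; have f2 := F0 _ Lvm; have d1 := dot0 Lu; have d2 := dot0 Lvm.
have h1' := le_trans h1 (ler_pM f2 f1 l2 l1).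
move: (fourier_dot u (v - m)) (dot u (v - m)) h1' h2 => p q h1' h2.
move: (dot (v - m) (v - m)) (dot u u) d1 d2 hm h1' h2 => A B d1 d2 hm h1' h2.
have : A * B <= e * B by apply: ler_wpM2r => //; exact: ltW.
by clear -h1' h2; have := sqr_ge0 (p + q); lra.
Qed.

End plancherel.

(** * Sobolev spaces *)

Section sobolev_hilbert.
Context {R : realType} (n : nat).
Local Notation V := 'rV[R]_n.
Local Notation mu := (lebesgue_rV n : {measure set 'rV[R]_n -> \bar R}).
Local Notation dot := (@L2dot _ _ _ mu).
Local Notation L2V := (@L2on _ _ _ mu).
Local Notation sL := (@subspace_L2 _ _ _ mu).
Local Notation bL := (symbilinear_L2dot mu).
Local Notation dot0 := (fun x _ => L2dot_ge0 mu x).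
Implicit Types (u v w f g h m : V -> R).

Lemma L2dotRE f g : dot f g = \int[mu]_x (f x * g x).
Proof. by []. Qed.

Variable s : R.
Hypothesis s01 : 0 < s < 1.

Definition Hs_weight (xi : V) : R := (1 + enorm xi ^+ 2) `^ s.

Lemma enorm1_ge1 (xi : V) : 1 <= 1 + enorm xi ^+ 2 :> R.
Proof. by rewrite lerDl sqr_ge0. Qed.

Lemma Hs_weight_ge1 xi : 1 <= Hs_weight xi.
Proof.
rewrite /Hs_weight -[leLHS](powRr0 (1 + enorm xi ^+ 2)).
by apply: ler_powR; [exact: enorm1_ge1|case/andP: s01 => /ltW].
Qed.

Lemma Hs_weight_gt0 xi : 0 < Hs_weight xi.
Proof. exact: lt_le_trans (Hs_weight_ge1 xi). Qed.

Lemma Hs_weight_le xi : Hs_weight xi <= 1 + enorm xi ^+ 2.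
Proof. by apply: ler1_powR; [exact: enorm1_ge1|case/andP: s01 => _ /ltW]. Qed.

Lemma measurable_Hs_weight : measurable_fun setT Hs_weight.
Proof.
apply: (measurableT_comp (measurable_powR s)).
by apply: measurable_funD => //; apply: measurable_funX; exact: measurable_enorm.
Qed.

(** With [wim], this turns the H^s norm into an unweighted L^2 norm, so that integrability and
    completeness are inherited from L^2. *)
Definition wre u : V -> R := fun xi => Num.sqrt (Hs_weight xi) * fourier_re u xi.
Definition wim u : V -> R := fun xi => Num.sqrt (Hs_weight xi) * fourier_im u xi.

Lemma measurable_sqrt_weight : measurable_fun setT (fun xi => Num.sqrt (Hs_weight xi)).
Proof.
apply: measurableT_comp; last exact: measurable_Hs_weight.
by apply: continuous_measurable_fun; exact: sqrt_continuous.
Qed.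

Lemma measurable_Hs_weightV : measurable_fun setT (fun xi => (Hs_weight xi)^-1).
Proof.
rewrite (_ : (fun _ => _) = fun xi => (1 + enorm xi ^+ 2) `^ (- s)); last first.
  by apply/funext => xi; rewrite powRN.
apply: (measurableT_comp (measurable_powR (- s))).
by apply: measurable_funD => //; apply: measurable_funX; exact: measurable_enorm.
Qed.

Lemma measurable_sqrt_weightV : measurable_fun setT (fun xi => (Num.sqrt (Hs_weight xi))^-1).
Proof.
rewrite (_ : (fun _ => _) = fun xi => Num.sqrt (Hs_weight xi)^-1); last first.
  by apply/funext => xi; rewrite sqrtrV// ltW// Hs_weight_gt0.
apply: measurableT_comp; last exact: measurable_Hs_weightV.
by apply: continuous_measurable_fun; exact: sqrt_continuous.
Qed.

Lemma measurable_wre u : L2V u -> measurable_fun setT (wre u).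
Proof.
by move=> Lu; apply: measurable_funM; [exact: measurable_sqrt_weight|exact: L2on_measurable (L2on_fourier_re Lu)].
Qed.

Lemma measurable_wim u : L2V u -> measurable_fun setT (wim u).
Proof.
by move=> Lu; apply: measurable_funM; [exact: measurable_sqrt_weight|exact: L2on_measurable (L2on_fourier_im Lu)].
Qed.

Lemma sqr_wre u xi : wre u xi ^+ 2 = Hs_weight xi * fourier_re u xi ^+ 2.
Proof. by rewrite /wre exprMn sqr_sqrtr// ltW// Hs_weight_gt0. Qed.

Lemma sqr_wim u xi : wim u xi ^+ 2 = Hs_weight xi * fourier_im u xi ^+ 2.
Proof. by rewrite /wim exprMn sqr_sqrtr// ltW// Hs_weight_gt0. Qed.

Lemma Hs_energyE u : L2V u ->
  Hs_energy s u = (L2norm2 mu (wre u) + L2norm2 mu (wim u))%E.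
Proof.
move=> Lu; rewrite /L2norm2 -ge0_integralD//; first last.
- by apply/measurable_EFinP; apply: measurable_funX; exact: measurable_wim.
- by move=> x _; rewrite lee_fin sqr_ge0.
- by apply/measurable_EFinP; apply: measurable_funX; exact: measurable_wre.
- by move=> x _; rewrite lee_fin sqr_ge0.
by apply: eq_integral => xi _; rewrite -EFinD sqr_wre sqr_wim mulrDr.
Qed.

Lemma HsP u : Hs s u <-> [/\ L2V u, L2V (wre u) & L2V (wim u)].
Proof.
split=> [[Lu]|[Lu Lr Li]].
  rewrite Hs_energyE// => E; have mr := measurable_wre Lu; have mi := measurable_wim Lu.
  split => //; apply/L2onP; split => //; apply: le_lt_trans E.
    by rewrite leeDl// L2norm2_ge0.
  by rewrite leeDr// L2norm2_ge0.
split => //; rewrite Hs_energyE//.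
by apply: lte_add_pinfty; exact: L2norm2_lty.
Qed.

Opaque L2dot L2on fourier fourier_re fourier_im.

Lemma Hs_L2 u : Hs s u -> L2V u. Proof. by case/HsP. Qed.

Lemma wre_linear a u v : L2V u -> L2V v -> wre (a *: u + v) = a *: wre u + wre v %[ae mu].
Proof.
move=> Lu Lv; apply: filterS (fourier_re_linear a Lu Lv) => x + _ => /(_ Logic.I).
rewrite /wre => ->; rewrite -[RHS]/(a * (_ * _) + _ * _) -[(_ + _) x]/(a * _ + _).
by rewrite mulrDr mulrCA.
Qed.

Lemma wim_linear a u v : L2V u -> L2V v -> wim (a *: u + v) = a *: wim u + wim v %[ae mu].
Proof.
move=> Lu Lv; apply: filterS (fourier_im_linear a Lu Lv) => x + _ => /(_ Logic.I).
rewrite /wim => ->; rewrite -[RHS]/(a * (_ * _) + _ * _) -[(_ + _) x]/(a * _ + _).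
by rewrite mulrDr mulrCA.
Qed.

Lemma subspace_Hs : subspace (Hs s : set (V -> R)).
Proof.
split=> [|a u v /HsP[Lu ur ui] /HsP[Lv vr vi]]; last first.
  have Luv := sL.2 a _ _ Lu Lv; apply/HsP; split; first exact: Luv.
    apply: (L2on_ae (measurable_wre Luv)); last exact: (sL.2 a _ _ ur vr).
    exact: ae_eq_sym (wre_linear a Lu Lv).
  apply: (L2on_ae (measurable_wim Luv)); last exact: (sL.2 a _ _ ui vi).
  exact: ae_eq_sym (wim_linear a Lu Lv).
have L0 := sL.1; apply/HsP; split; first exact: L0.
  apply: (L2on_ae (measurable_wre L0)); last exact: L0.
  (* The transform of 0 is again a chosen representative; linearity with coefficient -1 shows that
     it vanishes almost everywhere. *)
  have := wre_linear (-1) L0 L0; rewrite scaler0 addr0; apply: filterS => x + _ => /(_ Logic.I) h.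
  by rewrite h -[RHS]/(-1 * wre 0 x + wre 0 x) mulN1r addNr.
apply: (L2on_ae (measurable_wim L0)); last exact: L0.
have := wim_linear (-1) L0 L0; rewrite scaler0 addr0; apply: filterS => x + _ => /(_ Logic.I) h.
by rewrite h -[RHS]/(-1 * wim 0 x + wim 0 x) mulN1r addNr.
Qed.

Definition Hs_form u v : R := form_L Hs_weight u v.

Lemma form_integrandE u v xi : Hs_weight xi * (fourier_re u xi * fourier_re v xi +
  fourier_im u xi * fourier_im v xi) = wre u xi * wre v xi + wim u xi * wim v xi.
Proof.
have h : Hs_weight xi = Num.sqrt (Hs_weight xi) * Num.sqrt (Hs_weight xi).
  by rewrite -expr2 sqr_sqrtr// ltW// Hs_weight_gt0.
rewrite {1}h /wre /wim; move: (Num.sqrt _) (fourier_re u xi) (fourier_re v xi) (fourier_im u xi) (fourier_im v xi).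
by clear => q a b c d; ring.
Qed.

Lemma L1_form_weight u v : Hs s u -> Hs s v ->
  L1 (fun xi => wre u xi * wre v xi + wim u xi * wim v xi).
Proof.
move=> /HsP[_ ur ui] /HsP[_ vr vi].
by apply: L1D; exact: integrable_mul.
Qed.

(** The quotient of [m] by the weight is bounded, which reduces the claim to a product of weighted
    transforms. It covers the H^s form, the fractional Laplacian and [L] alike. *)
Lemma L1_form m c u v : measurable_fun setT m ->
  (forall xi, `|m xi| <= c * Hs_weight xi) -> Hs s u -> Hs s v ->
  L1 (fun xi => m xi * (fourier_re u xi * fourier_re v xi +
                        fourier_im u xi * fourier_im v xi)).
Proof.
move=> mm mc Hu Hv; have mw : measurable_fun setT (fun xi => m xi / Hs_weight xi).
  by apply: measurable_funM; [exact: mm|exact: measurable_Hs_weightV].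
have := @L1_mul_bounded _ _ _ _ c (L1_form_weight Hu Hv) mw.
have h xi : `|m xi / Hs_weight xi| <= c.
  by rewrite normrM normfV (ger0_norm (ltW (Hs_weight_gt0 xi))) ler_pdivrMr ?Hs_weight_gt0.
move=> /(_ h); apply: eq_integrable => // xi _ /=; congr (_%:E).
rewrite -form_integrandE mulrC mulrA divfK//.
by rewrite gt_eqF// Hs_weight_gt0.
Qed.

Lemma L1_Hs_form u v : Hs s u -> Hs s v ->
  L1 (fun xi => Hs_weight xi * (fourier_re u xi * fourier_re v xi +
                        fourier_im u xi * fourier_im v xi)).
Proof.
move=> Hu Hv; have := L1_form_weight Hu Hv.
by apply: eq_integrable => // xi _ /=; rewrite form_integrandE.
Qed.

Lemma symbilinear_form m c : measurable_fun setT m ->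
  (forall xi, `|m xi| <= c * Hs_weight xi) ->
  symbilinear_on (Hs s) (form_L m).
Proof.
move=> mm mc; split=> [u v _ _|v Hv a u w Hu Hw].
  by apply: eq_Rintegral => xi _; rewrite (mulrC (fourier_re u xi)) (mulrC (fourier_im u xi)).
have Iu := L1_form mm mc Hu Hv; have Iw := L1_form mm mc Hw Hv.
have Huw := subspace_Hs.2 a _ _ Hu Hw.
rewrite /form_L -(RintegralZl a measurableT Iu) -(RintegralD measurableT (L1Z a Iu) Iw).
apply: Rintegral_ae.
- exact: L1_measurable (L1_form mm mc Huw Hv).
- exact: L1_measurable (L1D (L1Z a Iu) Iw).
apply: filterS2 (fourier_re_linear a (Hs_L2 Hu) (Hs_L2 Hw)) (fourier_im_linear a (Hs_L2 Hu) (Hs_L2 Hw)).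
move=> x + + _ => /(_ Logic.I) -> /(_ Logic.I) ->.
rewrite -[(_ + fourier_re w) x]/(a * fourier_re u x + fourier_re w x).
rewrite -[(_ + fourier_im w) x]/(a * fourier_im u x + fourier_im w x).
move: (m x) (fourier_re u x) (fourier_re v x) (fourier_im u x) (fourier_im v x)
  (fourier_re w x) (fourier_im w x).
by clear => *; ring.
Qed.

Lemma Hs_weight_bound xi : `|Hs_weight xi| <= 1 * Hs_weight xi.
Proof. by rewrite mul1r ger0_norm// ltW// Hs_weight_gt0. Qed.

Lemma symbilinear_Hs : symbilinear_on (Hs s) Hs_form.
Proof. exact: symbilinear_form measurable_Hs_weight Hs_weight_bound. Qed.

Lemma Hs_formE u v : Hs s u -> Hs s v ->
  Hs_form u v = dot (wre u) (wre v) + dot (wim u) (wim v).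
Proof.
move=> Hu Hv; rewrite !L2dotRE -RintegralD//; first last.
- by case/HsP: Hu => _ _ ui; case/HsP: Hv => _ _ vi; exact: integrable_mul.
- by case/HsP: Hu => _ ui _; case/HsP: Hv => _ vi _; exact: integrable_mul.
by apply: eq_Rintegral => xi _; rewrite form_integrandE.
Qed.

Lemma Hs_form_ge0 u : 0 <= Hs_form u u.
Proof.
apply: Rintegral_ge0 => xi _; rewrite mulr_ge0 ?(ltW (Hs_weight_gt0 xi))//.
by rewrite -!expr2 addr_ge0// sqr_ge0.
Qed.

Lemma Hs_normE u : Hs_norm s u = Num.sqrt (Hs_form u u).
Proof. by congr (Num.sqrt (fine _)); apply: eq_integral => xi _; rewrite !expr2. Qed.

Lemma form_le m1 m2 c u : measurable_fun setT m1 -> measurable_fun setT m2 ->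
  (forall xi, `|m1 xi| <= c * Hs_weight xi) -> (forall xi, `|m2 xi| <= c * Hs_weight xi) ->
  (forall xi, m1 xi <= m2 xi) -> Hs s u -> form_L m1 u u <= form_L m2 u u.
Proof.
move=> mm1 mm2 c1 c2 m12 Hu; apply: le_Rintegral => //.
- exact: (L1_form mm1 c1 Hu Hu).
- exact: (L1_form mm2 c2 Hu Hu).
- by move=> xi _; apply: ler_wpM2r => //; rewrite -!expr2 addr_ge0// sqr_ge0.
Qed.

Lemma form_scale a m u v : L1 (fun xi => m xi * (fourier_re u xi * fourier_re v xi +
                        fourier_im u xi * fourier_im v xi)) ->
  form_L (fun xi => a * m xi) u v = a * form_L m u v.
Proof.
by move=> Im; rewrite /form_L -RintegralZl//; apply: eq_Rintegral => xi _; rewrite mulrA.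
Qed.

Lemma dot_wre_ge u : Hs s u -> dot (fourier_re u) (fourier_re u) <= dot (wre u) (wre u).
Proof.
move=> /HsP[Lu ur ui]; have Lr := L2on_fourier_re Lu.
rewrite !L2dotRE; apply: le_Rintegral => //; [exact: integrable_mul..|].
move=> xi _; rewrite -!expr2 sqr_wre ler_peMl ?sqr_ge0//; exact: Hs_weight_ge1.
Qed.

Lemma dot_wim_ge u : Hs s u -> dot (fourier_im u) (fourier_im u) <= dot (wim u) (wim u).
Proof.
move=> /HsP[Lu ur ui]; have Lr := L2on_fourier_im Lu.
rewrite !L2dotRE; apply: le_Rintegral => //; [exact: integrable_mul..|].
move=> xi _; rewrite -!expr2 sqr_wim ler_peMl ?sqr_ge0//; exact: Hs_weight_ge1.
Qed.

(** Plancherel's formula enters here: the H^s energy controls the transform only, and the weight is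
    at least 1. *)
Lemma L2dot_le_Hs u : Hs s u -> dot u u <= Hs_form u u.
Proof.
move=> Hu; have Lu := Hs_L2 Hu; rewrite -(plancherel Lu Lu) Hs_formE// lerD//.
  exact: dot_wre_ge.
exact: dot_wim_ge.
Qed.

Lemma fourier_re_ae u v : L2V u -> L2V v -> u = v %[ae mu] -> fourier_re u = fourier_re v.
Proof. by move=> Lu Lv uv; rewrite -[LHS]/((fourier u).1) (fourier_ae Lu Lv uv). Qed.

Lemma fourier_im_ae u v : L2V u -> L2V v -> u = v %[ae mu] -> fourier_im u = fourier_im v.
Proof. by move=> Lu Lv uv; rewrite -[LHS]/((fourier u).2) (fourier_ae Lu Lv uv). Qed.

Lemma Hs_ae u v : measurable_fun setT v -> u = v %[ae mu] -> Hs s u -> Hs s v.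
Proof.
move=> mv uv /HsP[Lu ur ui]; have Lv := L2on_ae mv uv Lu; apply/HsP; split; first exact: Lv.
  by rewrite /wre -(fourier_re_ae Lu Lv uv).
by rewrite /wim -(fourier_im_ae Lu Lv uv).
Qed.

Lemma form_aer m u v v' : L2V v -> L2V v' -> v = v' %[ae mu] ->
  form_L m u v = form_L m u v'.
Proof.
by move=> Lv Lv' vv; rewrite /form_L (fourier_re_ae Lv Lv' vv) (fourier_im_ae Lv Lv' vv).
Qed.

Lemma form_ael m u u' v : L2V u -> L2V u' -> u = u' %[ae mu] ->
  form_L m u v = form_L m u' v.
Proof.
by move=> Lv Lv' vv; rewrite /form_L (fourier_re_ae Lv Lv' vv) (fourier_im_ae Lv Lv' vv).
Qed.

Lemma dot_sub_ae f f' : L2V f -> L2V f' -> f = f' %[ae mu] -> dot f f = dot f' f'.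
Proof. by move=> Lf Lf' ff; exact: L2dot_ae. Qed.

Lemma fourier_sub_dot (T : (V -> R) -> V -> R) (uk : nat -> V -> R) u :
  (forall a f g, L2V f -> L2V g -> T (a *: f + g) = a *: T f + T g %[ae mu]) ->
  (forall f, L2V f -> L2V (T f)) ->
  (forall f, L2V f -> dot (T f) (T f) <= dot f f) ->
  (forall k, L2V (uk k)) -> L2V u -> converges_to dot uk u ->
  converges_to dot (T \o uk) (T u).
Proof.
move=> Tlin TL Tle Luk Lu cu e e0; have [N HN] := cu e e0; exists N => k Nk.
apply: le_lt_trans (HN k Nk).
have LB := subspaceB sL (Luk k) Lu.
apply: le_trans (Tle _ LB); rewrite le_eqVlt; apply/orP; left; apply/eqP.
have LT := TL _ (Luk k); have LTu := TL _ Lu.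
apply: (dot_sub_ae (subspaceB sL LT LTu) (TL _ LB)).
have := Tlin (-1) _ _ Lu (Luk k); rewrite !scaleN1r addrC [- T u + _]addrC.
exact: ae_eq_sym.
Qed.

(** The sequence and its two weighted transforms are Cauchy in L^2. What remains is that
    multiplication by the weight after the transform is a closed operation, so that the limits
    belong to the same function. *)
Lemma Hs_complete : complete_on (Hs s) Hs_form.
Proof.
move=> u Hu cu; have Lu k := Hs_L2 (Hu k).
have [Lr Li] : (forall k, L2V (wre (u k))) /\ (forall k, L2V (wim (u k))).
  by split=> k; have /HsP[] := Hu k.
have wsub (i j : nat) : [/\ Hs s (u i - u j),
    dot (wre (u i) - wre (u j)) (wre (u i) - wre (u j)) <= Hs_form (u i - u j) (u i - u j) &
    dot (wim (u i) - wim (u j)) (wim (u i) - wim (u j)) <= Hs_form (u i - u j) (u i - u j)].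
  have Hij := subspaceB subspace_Hs (Hu i) (Hu j); split => //; rewrite Hs_formE//.
    have /HsP[_ hr _] := Hij.
    rewrite (dot_sub_ae (subspaceB sL (Lr i) (Lr j)) hr) ?lerDl ?L2dot_ge0//.
    have := wre_linear (-1) (Lu j) (Lu i); rewrite !scaleN1r addrC [- wre _ + _]addrC.
    exact: ae_eq_sym.
  have /HsP[_ _ hr] := Hij.
  rewrite (dot_sub_ae (subspaceB sL (Li i) (Li j)) hr) ?lerDr ?L2dot_ge0//.
  have := wim_linear (-1) (Lu j) (Lu i); rewrite !scaleN1r addrC [- wim _ + _]addrC.
  exact: ae_eq_sym.
have [v Lv cv] : exists2 v, L2V v & converges_to dot u v.
  apply: L2_complete => // e e0; have [N HN] := cu e e0; exists N => i j Ni Nj.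
  by have [Hij _ _] := wsub i j; apply: le_lt_trans (L2dot_le_Hs Hij) (HN i j Ni Nj).
have [A LA cA] : exists2 A, L2V A & converges_to dot (wre \o u) A.
  apply: L2_complete => // e e0; have [N HN] := cu e e0; exists N => i j Ni Nj.
  by have [_ h _] := wsub i j; apply: le_lt_trans h (HN i j Ni Nj).
have [B LB cB] : exists2 B, L2V B & converges_to dot (wim \o u) B.
  apply: L2_complete => // e e0; have [N HN] := cu e e0; exists N => i j Ni Nj.
  by have [_ _ h] := wsub i j; apply: le_lt_trans h (HN i j Ni Nj).
(* Closedness, for T either part of the transform: dividing by the root of the weight, which is at
   least 1, only decreases L^2 distances, so the unweighted transforms converge too, and their limit
   is T v. *)
have lim (T : (V -> R) -> V -> R) (F : V -> R) : L2V F ->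
    (forall a f g, L2V f -> L2V g -> T (a *: f + g) = a *: T f + T g %[ae mu]) ->
    (forall f, L2V f -> L2V (T f)) ->
    (forall f, L2V f -> dot (T f) (T f) <= dot f f) ->
    (forall k, L2V (fun xi => Num.sqrt (Hs_weight xi) * T (u k) xi)) ->
    converges_to dot (fun k xi => Num.sqrt (Hs_weight xi) * T (u k) xi) F ->
    F = (fun xi => Num.sqrt (Hs_weight xi) * T v xi) %[ae mu].
  move=> LF Tlin TL Tle wL cF.
  have q0 xi : 0 < Num.sqrt (Hs_weight xi) by rewrite sqrtr_gt0 Hs_weight_gt0.
  have q1 xi : 1 <= Num.sqrt (Hs_weight xi).
    by rewrite -[leLHS]sqrtr1 ler_wsqrtr// Hs_weight_ge1.
  pose G xi := F xi / Num.sqrt (Hs_weight xi).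

  have qle f xi : `|f xi / Num.sqrt (Hs_weight xi)| <= `|f xi| :> R.
    by rewrite normrM ler_piMr// normfV ger0_norm ?invf_le1// ltW.
  have LG : L2V G.
    apply: (L2on_le (g := F)) => //; last by move=> xi; exact: qle.
    by apply: measurable_funM; [exact: (L2on_measurable LF)|exact: measurable_sqrt_weightV].
  have cG : converges_to dot (T \o u) G.
    move=> e e0; have [N HN] := cF e e0; exists N => k Nk; apply: le_lt_trans (HN k Nk).
    have LkG := subspaceB sL (TL _ (Lu k)) LG; have LkF := subspaceB sL (wL k) LF.
    rewrite !L2dotRE; apply: le_Rintegral => //; [exact: integrable_mul..|].
    move=> xi _; rewrite -!expr2 -[leLHS]real_normK ?num_real// -[leRHS]real_normK ?num_real//.
    rewrite lerXn2r ?nnegrE//.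
    have -> : (T (u k) - G) xi = (fun xi => Num.sqrt (Hs_weight xi) * T (u k) xi - F xi) xi / Num.sqrt (Hs_weight xi).
      by rewrite -[LHS]/(T (u k) xi - F xi / _) mulrBl mulrAC divff ?mul1r// gt_eqF.
    exact: qle.
  have := L2_limit_unique (fun k => TL _ (Lu k)) LG (TL _ Lv) cG (fourier_sub_dot Tlin TL Tle Lu Lv cv).
  apply: filterS => xi + _ => /(_ Logic.I) <-.
  by rewrite /G mulrCA divff ?mulr1// gt_eqF.
have hA : A = wre v %[ae mu].
  apply: (lim _ _ LA (@fourier_re_linear _ _) (@L2on_fourier_re _ _)) => // f Lf.
  by apply: le_trans (fourier_dot_le Lf); rewrite lerDl L2dot_ge0.
have hB : B = wim v %[ae mu].
  apply: (lim _ _ LB (@fourier_im_linear _ _) (@L2on_fourier_im _ _)) => // f Lf.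
  by apply: le_trans (fourier_dot_le Lf); rewrite lerDr L2dot_ge0.
have Lrv : L2V (wre v) by exact: L2on_ae (measurable_wre Lv) hA LA.
have Liv : L2V (wim v) by exact: L2on_ae (measurable_wim Lv) hB LB.
have Hv : Hs s v by apply/HsP.
exists v => // e e0.
have [N1 HN1] := cA (e / 2) (divr_gt0 e0 (ltr0Sn _ _)).
have [N2 HN2] := cB (e / 2) (divr_gt0 e0 (ltr0Sn _ _)).
exists (maxn N1 N2) => k; rewrite geq_max => /andP[k1 k2].
have Hkv := subspaceB subspace_Hs (Hu k) Hv; rewrite Hs_formE//.
have /HsP[_ hr hi] := Hkv; rewrite (splitr e); apply: ltrD.
  rewrite (dot_sub_ae hr (subspaceB sL (Lr k) LA)); first exact: HN1.
  have := wre_linear (-1) Lv (Lu k); rewrite !scaleN1r addrC [- wre _ + _]addrC.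
  by apply: filterS2 hA => x + + _ => /(_ Logic.I) h /(_ Logic.I) ->; rewrite -[RHS]/(_ - A x) h.
rewrite (dot_sub_ae hi (subspaceB sL (Li k) LB)); first exact: HN2.
have := wim_linear (-1) Lv (Lu k); rewrite !scaleN1r addrC [- wim _ + _]addrC.
by apply: filterS2 hB => x + + _ => /(_ Logic.I) h /(_ Logic.I) ->; rewrite -[RHS]/(_ - B x) h.
Qed.

Lemma hilbert_Hs : hilbert (Hs s : set (V -> R)) Hs_form.
Proof.
split; [exact: subspace_Hs|exact: symbilinear_Hs| |exact: Hs_complete].
by move=> u _; exact: Hs_form_ge0.
Qed.

Lemma Hs_closureE (A : set (V -> R)) : Hs_closure s A = closure_in (Hs s) Hs_form A.
Proof.
have sq u (e : R) : 0 < e -> (Num.sqrt (Hs_form u u) < e) = (Hs_form u u < e ^+ 2).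
  move=> e0; rewrite -[in RHS](sqr_sqrtr (Hs_form_ge0 u)) ltr_pXn2r// ?nnegrE ?sqrtr_ge0//.
  exact: ltW.
apply/seteqP; split=> u [Hu H]; split => // e e0.
  have [v [Av Hv]] := H (Num.sqrt e) ltac:(by rewrite sqrtr_gt0).
  rewrite Hs_normE sq ?sqrtr_gt0// sqr_sqrtr ?ltW// => h.
  by exists v.
have [v [Av Hv h]] := H (e ^+ 2) (exprn_gt0 _ e0).
by exists v; split => //; rewrite Hs_normE sq.
Qed.

End sobolev_hilbert.

(** * Test functions belong to H^s *)

Section test_functions.
Context {R : realType} (n : nat).
Local Notation V := 'rV[R]_n.
Local Notation mu := (lebesgue_rV n : {measure set 'rV[R]_n -> \bar R}).
Local Notation dot := (@L2dot _ _ _ mu).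
Local Notation L2V := (@L2on _ _ _ mu).
Implicit Types (U : set V) (u v w f g h : V -> R).

Lemma foldr_partial_linear a f g l : smooth f -> smooth g ->
  foldr (@partial R n) (a *: f + g) l =
  a *: foldr (@partial R n) f l + foldr (@partial R n) g l.
Proof.
move=> sf sg; elim: l => //= i l ->; apply/funext => x.
have [_ df] := sf l; have [_ dg] := sg l.
rewrite -[RHS]/(a *: partial i (foldr (@partial R n) f l) x + partial i (foldr (@partial R n) g l) x).
by rewrite /partial -(deriveZ _ (df i x)) -deriveD//; exact: derivableZ.
Qed.

Lemma smooth_linear a f g : smooth f -> smooth g -> smooth (a *: f + g).
Proof.
move=> sf sg l; have [cf df] := sf l; have [cg dg] := sg l.
rewrite (foldr_partial_linear a l sf sg); split=> [x|i x].
  have : (a * foldr (@partial R n) f l y + foldr (@partial R n) g l y) @[y --> x] -->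
      a * foldr (@partial R n) f l x + foldr (@partial R n) g l x.
    apply: (@continuousD _ _ _ (fun y => a * foldr (@partial R n) f l y) _ x _ (cg x)).
    by apply: continuousM; [exact: cst_continuous|exact: cf].
  exact.
by apply: derivableD => //; exact: derivableZ.
Qed.

Lemma smooth0 : smooth (0 : V -> R).
Proof.
move=> l; have -> : foldr (@partial R n) 0 l = 0.
  by elim: l => //= i l ->; apply/funext => x; rewrite /partial derive_cst.
by move=> g; split=> [x|i x]; [exact: cst_continuous|exact: derivable_cst].
Qed.

Lemma subspace_Cc U : subspace (Cc_infty U).
Proof.
split=> [|a f g [sf cf fU] [sg cg gU]].
  have e0 : [set x : V | (0 : V -> R) x != 0] = set0.
    by apply/seteqP; split=> x //=; rewrite eqxx.
  by split; [exact: smooth0|rewrite e0 closure0; exact: compact0|rewrite e0 closure0].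
have sub : closure [set x | (a *: f + g) x != 0] `<=`
    closure [set x | f x != 0] `|` closure [set x | g x != 0].
  rewrite -closureU; apply: closureS => x /=.
  rewrite -[(a *: f + g) x]/(a * f x + g x) => h.
  have [fx|fx] := eqVneq (f x) 0; last by left.
  by right; move: h; rewrite fx mulr0 add0r.
split; first exact: smooth_linear.
  by apply: subclosed_compact sub; [exact: closed_closure|exact: compactU].
by apply: subset_trans sub _; rewrite subUset.
Qed.

Lemma Cc_continuous U f : Cc_infty U f -> continuous f.
Proof. by case=> sf _ _; have [] := sf [::]. Qed.

Lemma Cc_derivable U f i x : Cc_infty U f -> derivable f x (delta_mx ord0 i).
Proof. by case=> sf _ _; have [_] := sf [::]. Qed.

Lemma Cc_support U f : Cc_infty U f -> exists k : nat, forall x, ~ eball k%:R x -> f x = 0.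
Proof.
move=> [_ cf _]; have [k hk] := bounded_sub_eball (compact_bounded cf).
exists k => x xk; apply: contrapT => /eqP fx; apply: xk; apply: hk.
exact: subset_closure.
Qed.

Lemma Cc_outside U f x : Cc_infty U f -> ~ U x -> f x = 0.
Proof.
move=> [_ _ fU] Ux; apply: contrapT => /eqP fx; apply: Ux; apply: fU.
exact: subset_closure.
Qed.

Lemma bounded_of_support (K : set V) g : compact K -> continuous g ->
  (forall x, ~ K x -> g x = 0) -> exists M : R, forall x, `|g x| <= M.
Proof.
move=> cK cg g0.
have [M [_ HM]] := compact_bounded (continuous_compact (continuous_subspaceT cg) cK).
exists (`|M| + 1) => x; have [Kx|Kx] := pselect (K x); last first.
  by rewrite g0// normr0 addr_ge0.
by apply: HM; [rewrite (le_lt_trans (ler_norm M))// ltrDl|exists x].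
Qed.

Lemma Cc_bounded U f : Cc_infty U f -> exists M : R, forall x, `|f x| <= M.
Proof.
move=> Cf; have [_ cf _] := Cf.
apply: (bounded_of_support cf (Cc_continuous Cf)) => x xK.
by apply: contrapT => /eqP fx; apply: xK; exact: subset_closure.
Qed.

Lemma Cc_partial_bounded U f i : Cc_infty U f ->
  exists M : R, forall x, `|partial i f x| <= M.
Proof.
move=> Cf; have [sf cf _] := Cf; have [cg _] := sf [:: i].
apply: (bounded_of_support cf cg) => x xK; rewrite /= /partial.
rewrite (@near_eq_derive _ _ _ _ (cst 0)) ?derive_cst//.
have : nbhs x (~` closure [set x | f x != 0]).
  by apply: open_nbhs_nbhs; split => //; apply: closed_openC; exact: closed_closure.
apply: filterS => y yK; apply: contrapT => /eqP fy; apply: yK; exact: subset_closure.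
Qed.

Lemma L2on_bounded f (k : nat) (M : R) : measurable_fun setT f ->
  (forall x, `|f x| <= M) -> (forall x, ~ eball k%:R x -> f x = 0) -> L2V f.
Proof.
move=> mf fM f0; apply/L2onP; split => //.
pose c := (M ^+ 2)%:E; apply: (@le_lt_trans _ _ (\int[mu]_x (c * (\1_(eball k%:R) x)%:E))%E).
  apply: ge0_le_integral => //.
  - by move=> x _; rewrite lee_fin sqr_ge0.
  - by apply/measurable_EFinP; exact: measurable_funX.
  - apply: measurable_funeM; apply/measurable_EFinP; apply: measurable_indic.
    exact: measurable_eball.
  - move=> x _; rewrite -EFinM lee_fin indicE.
    have [xk|xk] := pselect (eball k%:R x); last by rewrite f0// expr0n mulr_ge0// sqr_ge0.
    rewrite mem_set// mulr1 -[leLHS]real_normK ?num_real//.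
    by rewrite lerXn2r ?nnegrE// (le_trans _ (fM x)).
rewrite ge0_integralZl_EFin//; first last.
- exact: sqr_ge0.
- by apply/measurable_EFinP; apply: measurable_indic; exact: measurable_eball.
- rewrite integral_indic//; last exact: measurable_eball.
  rewrite setIT lte_mul_pinfty ?lee_fin ?sqr_ge0//; exact: lebesgue_eball_lty.
Qed.

Lemma Cc_L2 U f : Cc_infty U f -> L2V f.
Proof.
move=> Cf; have [M fM] := Cc_bounded Cf; have [k fk] := Cc_support Cf.
apply: (L2on_bounded _ fM fk); apply: continuous_measurable_rV; exact: Cc_continuous Cf.
Qed.

Lemma L1_bounded_support f (k : nat) : L2V f ->
  (forall x, ~ eball k%:R x -> f x = 0) -> L1 f.
Proof.
move=> Lf f0; have -> : f = trunc k f; last exact: L1_trunc.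
apply/funext => x; rewrite /trunc patchE; case: ifPn => // /negP xk.
by rewrite f0// => /mem_set.
Qed.

Lemma Cc_L1 U f : Cc_infty U f -> L1 f.
Proof.
by move=> Cf; have [k fk] := Cc_support Cf; exact: L1_bounded_support (Cc_L2 Cf) fk.
Qed.

Lemma Rintegral_translation (y : V) f : measurable_fun setT f ->
  \int[mu]_x f (x + y) = \int[mu]_x f x.
Proof.
move=> mf; congr fine; apply: (@integral_translation _ _ y (EFin \o f)).
exact/measurable_EFinP.
Qed.

Lemma L1_translation (y : V) f : L1 f -> L1 (fun x => f (x + y)).
Proof.
move=> /integrableP[mf If]; apply/integrableP; split.
  by apply: measurableT_comp mf _; exact: measurable_translation.
rewrite (@integral_translation _ _ y (fun x => `|(EFin \o f) x|%E))//.
exact: measurableT_comp.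
Qed.

(** Translation multiplies the transform by exp(i y.xi), and |exp(i a) - 1|^2 = 2 - 2 cos a. *)
Lemma difference_fourier f (y xi : V) : L1 f ->
  fre (fun x => f (x + y) - f x) xi ^+ 2 + fim (fun x => f (x + y) - f x) xi ^+ 2 =
  (2 - 2 * cos (dotrV y xi)) * (fre f xi ^+ 2 + fim f xi ^+ 2).
Proof.
move=> Lf; have Lfy := L1_translation y Lf; have mf := L1_measurable Lf.
have hc : \int[mu]_x (f (x + y) * cos (dotrV x xi)) =
    cos (dotrV y xi) * Fcos f xi + sin (dotrV y xi) * Fsin f xi.
  have -> : \int[mu]_x (f (x + y) * cos (dotrV x xi)) =
      \int[mu]_x (f x * cos (dotrV (x - y) xi)).
    rewrite -(@Rintegral_translation y (fun x => f x * cos (dotrV (x - y) xi))).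
      by apply: eq_Rintegral => x _ /=; rewrite addrK.
    apply: measurable_funM => //.
    rewrite (_ : (fun x => cos _) = (fun z => cos (dotrV xi z)) \o (fun x => x - y)).
      by apply: measurableT_comp; [exact: measurable_cos_dotrV|exact: measurable_translation].
    by apply/funext => x /=; rewrite dotrVC.
  rewrite /Fcos /Fsin -!RintegralZl//; [|exact: L1_sin|exact: L1_cos].
  rewrite -RintegralD//; [|apply: (@L1Z _ _ _ (fun x => f x * cos (dotrV x xi))); exact: L1_cos
    |apply: (@L1Z _ _ _ (fun x => f x * sin (dotrV x xi))); exact: L1_sin].
  by apply: eq_Rintegral => x _; rewrite dotrVBl cosB; ring.
have hs : \int[mu]_x (f (x + y) * sin (dotrV x xi)) =
    cos (dotrV y xi) * Fsin f xi - sin (dotrV y xi) * Fcos f xi.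
  have -> : \int[mu]_x (f (x + y) * sin (dotrV x xi)) =
      \int[mu]_x (f x * sin (dotrV (x - y) xi)).
    rewrite -(@Rintegral_translation y (fun x => f x * sin (dotrV (x - y) xi))).
      by apply: eq_Rintegral => x _ /=; rewrite addrK.
    apply: measurable_funM => //.
    rewrite (_ : (fun x => sin _) = (fun z => sin (dotrV xi z)) \o (fun x => x - y)).
      by apply: measurableT_comp; [exact: measurable_sin_dotrV|exact: measurable_translation].
    by apply/funext => x /=; rewrite dotrVC.
  rewrite /Fcos /Fsin -!RintegralZl//; [|exact: L1_cos|exact: L1_sin].
  rewrite -RintegralB//; [|apply: (@L1Z _ _ _ (fun x => f x * sin (dotrV x xi))); exact: L1_sin
    |apply: (@L1Z _ _ _ (fun x => f x * cos (dotrV x xi))); exact: L1_cos].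
  by apply: eq_Rintegral => x _; rewrite dotrVBl sinB; ring.
have hC : Fcos (fun x => f (x + y) - f x) xi =
    \int[mu]_x (f (x + y) * cos (dotrV x xi)) - Fcos f xi.
  rewrite /Fcos -RintegralB//; [|exact: L1_cos|exact: L1_cos].
  by apply: eq_Rintegral => x _; rewrite mulrBl.
have hS : Fsin (fun x => f (x + y) - f x) xi =
    \int[mu]_x (f (x + y) * sin (dotrV x xi)) - Fsin f xi.
  rewrite /Fsin -RintegralB//; [|exact: L1_sin|exact: L1_sin].
  by apply: eq_Rintegral => x _; rewrite mulrBl.
rewrite /fre /fim hC hS hc hs; clear.
have := cos2Dsin2 (dotrV y xi).
move: (cos _) (sin _) (Fcos _ _) (Fsin _ _) (fourier_const _) => c d A B F cd.
have e : d ^+ 2 = 1 - c ^+ 2 by rewrite -cd; ring.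
have -> : (F * (c * A + d * B - A)) ^+ 2 + (- (F * (c * B - d * A - B))) ^+ 2 =
  F ^+ 2 * ((c - 1) ^+ 2 + d ^+ 2) * (A ^+ 2 + B ^+ 2) by ring.
by rewrite e; ring.
Qed.

Lemma cvg_sin_ratio (y : R) : sin (harmonic k * y) / harmonic k @[k --> \oo] --> y.
Proof.
have [->|y0] := eqVneq y 0.
  rewrite (_ : (fun k => _) = cst 0); first exact: cvg_cst.
  by apply/funext => k; rewrite mulr0 sin0 mul0r.
have h0 k : harmonic k != 0 :> R by rewrite gt_eqF// harmonic_gt0.
(* The derivative of the sine at 0 is a limit over punctured neighbourhoods, hence the separate case
   y = 0. *)
have cu : harmonic k * y @[k --> \oo] --> 0^'.
  have c0 : harmonic k * y @[k --> \oo] --> (0 : R).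
    by rewrite -[X in _ --> X](mul0r y); apply: cvgMr_tmp; exact: cvg_harmonic.
  move=> A A0.
  apply: (@filterS nat \oo _ (fun k => harmonic k * y != 0 -> A (harmonic k * y))); last exact: c0 _ A0.
  by move=> k; apply; exact: mulf_neq0.
have ds : h^-1 *: ((sin \o shift 0) (h *: 1) - sin 0) @[h --> (0 : R)^'] --> (1 : R).
  have [D E] := is_derive_sin (0 : R); rewrite cos0 in E.
  by move: D; rewrite /derivable => D; have := D; rewrite [X in _ --> X]E.
have : y * ((harmonic k * y)^-1 *: ((sin \o shift 0) ((harmonic k * y) *: 1) - sin 0)) @[k --> \oo] --> y * 1.
  by apply: cvgMl_tmp; exact: (cvg_comp _ _ cu ds).
rewrite mulr1; apply: cvg_trans; apply: near_eq_cvg; apply: nearW => k /=.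
rewrite addr0 sin0 subr0 /GRing.scale/= mulr1 invfM mulrA mulrCA divff// mulr1.
by rewrite mulrC.
Qed.

Lemma Cc_line_derive U f i (x : V) t : Cc_infty U f ->
  is_derive t (1 : R) (fun r : R => f (x + r *: delta_mx ord0 i)) (partial i f (x + t *: delta_mx ord0 i)).
Proof.
move=> Cf; have D := @Cc_derivable U f i (x + t *: delta_mx ord0 i) Cf.
have E : (fun h : R => h^-1 *: (((fun r : R => f (x + r *: delta_mx ord0 i)) \o shift t) (h *: 1) -
    f (x + t *: delta_mx ord0 i))) =
    (fun h : R => h^-1 *: ((f \o shift (x + t *: delta_mx ord0 i)) (h *: delta_mx ord0 i) - f (x + t *: delta_mx ord0 i))).
  apply/funext => h /=; congr (_ *: (f _ - _)).
  by rewrite -[h *: 1]/(h * 1) mulr1 scalerDl addrCA.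
by apply: DeriveDef; rewrite /partial /derivable /derive E.
Qed.

Lemma Cc_difference_le U f i : Cc_infty U f -> exists2 M : R, 0 <= M &
  exists k : nat, forall t x, 0 < t <= 1 ->
    `|f (x + t *: delta_mx ord0 i) - f x| <= M * t * \1_(cube (k%:R : R)) x.
Proof.
move=> Cf; have [M fM] := Cc_partial_bounded i Cf; have [k fk] := Cc_support Cf.
have M0 : 0 <= M := le_trans (normr_ge0 _) (fM 0).
(* A step of length at most 1 cannot lead from outside this cube into the ball of radius k. The
   margin is 2 and not 1 because cubes are open on their lower faces. *)
exists M => //; exists k.+2 => t x /andP[t0 t1]; rewrite indicE.
have [xk|xk] := pselect (cube (k.+2%:R : R) x); last first.
  have far y : ~ eball k%:R y -> f y = 0 by exact: fk.
  have sub y : eball k%:R y -> (forall j, `|x ord0 j - y ord0 j| <= 1) -> False.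
    move=> yk xy; apply: xk => j; rewrite /= in_itv/= !mxE.
    have := le_trans (coord_le_enorm y j) yk; have := xy j; rewrite !ler_norml.
    have -> : k.+2%:R = k%:R + 2 :> R by rewrite -addn2 natrD.
    by move=> /andP[? ?] /andP[? ?]; apply/andP; split; lra.
  rewrite (far x); last first.
    by move=> yk; apply: (sub x yk) => j; rewrite subrr normr0.
  rewrite (far (x + _)) ?subrr ?normr0; last first.
    move=> yk; apply: (sub _ yk) => j; rewrite !mxE eqxx/= opprD addrA subrr sub0r normrN.
    by case: eqP => _; rewrite ?mulr1 ?mulr0 ?normr0// ger0_norm// ltW.
  by rewrite !mulr_ge0// ltW.
rewrite mem_set// mulr1.
have [c _ Hc] : exists2 c : R, c \in `[0, t] &
    f (x + t *: delta_mx ord0 i) - f (x + 0 *: delta_mx ord0 i) =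
    partial i f (x + c *: delta_mx ord0 i) * (t - 0).
  apply: (@MVT_segment R (fun r : R => f (x + r *: delta_mx ord0 i))
    (fun r : R => partial i f (x + r *: delta_mx ord0 i))); first exact: ltW.
    by move=> r _; exact: Cc_line_derive Cf.
  apply: continuous_subspaceT => r.
  apply: differentiable_continuous; apply/derivable1_diffP.
  by have [] := Cc_line_derive i x r Cf.
rewrite scale0r addr0 subr0 in Hc; rewrite Hc normrM (gtr0_norm t0).
by apply: ler_wpM2r; [exact: ltW|exact: fM].
Qed.

(* Difference quotients: the multiplier (2 - 2 cos(t xi_i)) / t^2 of the transform is
   bounded in energy uniformly in t, and tends to xi_i^2 as t -> 0.  *)
Lemma Cc_gradient_energy U f i : Cc_infty U f ->
  (\int[mu]_xi (xi ord0 i ^+ 2 * (fre f xi ^+ 2 + fim f xi ^+ 2))%:E < +oo)%E.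
Proof.
move=> Cf; have Lf := Cc_L2 Cf; have L1f := Cc_L1 Cf; have mf := L2on_measurable Lf.
have [M M0 [k fk]] := Cc_difference_le i Cf.
pose e := delta_mx ord0 i : V.
pose g (t : R) x := f (x + t *: e) - f x.
pose c : \bar R := ((M ^+ 2)%:E * mu (cube (k%:R : R)))%E.
have mC : measurable (cube (k%:R : R) : set V) by exact: measurable_rV_box.
have clty : (c < +oo)%E.
  by rewrite lte_mul_pinfty ?lee_fin ?sqr_ge0//; exact: lebesgue_cube_lty.
have mg t : measurable_fun setT (g t).
  by apply: measurable_funB => //; apply: measurableT_comp mf _; exact: measurable_translation.
have gle t : 0 < t <= 1 -> (L2norm2 mu (g t) <= (t ^+ 2)%:E * c)%E.
  move=> t01; have /andP[t0 _] := t01.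
  have -> : ((t ^+ 2)%:E * c = \int[mu]_x (((M * t) ^+ 2)%:E * (\1_(cube (k%:R : R)) x)%:E))%E.
    rewrite ge0_integralZl_EFin//; first last.
    - exact: sqr_ge0.
    - by apply/measurable_EFinP; exact: measurable_indic.
    - by rewrite (integral_indic mu measurableT mC) setIT /c muleA -EFinM exprMn [in RHS]mulrC.
  apply: ge0_le_integral => //.
  - by move=> x _; rewrite lee_fin sqr_ge0.
  - by apply/measurable_EFinP; exact: measurable_funX.
  - by apply: measurable_funeM; apply/measurable_EFinP; exact: measurable_indic.
  - move=> x _; rewrite -EFinM lee_fin -[leLHS]real_normK ?num_real//.
    have -> : (M * t) ^+ 2 * \1_(cube (k%:R : R)) x = (M * t * \1_(cube (k%:R : R)) x) ^+ 2.
      by rewrite indicE; case: (x \in _); rewrite ?mulr1// !mulr0 expr0n.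
    rewrite lerXn2r ?nnegrE//; first by rewrite mulr_ge0// mulr_ge0// ltW.
    exact: fk.
have Lg t : 0 < t <= 1 -> L2V (g t).
  move=> t01; apply/L2onP; split => //; apply: le_lt_trans (gle t t01) _.
  by rewrite lte_mul_pinfty ?lee_fin ?sqr_ge0.
have h01 m : 0 < (harmonic m : R) <= 1.
  by rewrite harmonic_gt0/= /harmonic/= invf_le1// ler1n.
(* (2 - 2 cos(t xi_i)) / t^2 rewritten as 4 sin^2(t xi_i / 2) / t^2, whose limit follows from
   [cvg_sin_ratio]. *)
pose F (m : nat) (xi : V) := (4 * (sin (harmonic m * (xi ord0 i / 2)) / harmonic m) ^+ 2) * (fre f xi ^+ 2 + fim f xi ^+ 2).
have m_i : measurable_fun setT (fun xi : V => xi ord0 i) by exact: measurable_rV_coord.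
have mS : measurable_fun setT (fun xi : V => fre f xi ^+ 2 + fim f xi ^+ 2).
  apply: measurable_funD; apply: measurable_funX; [exact: measurable_fre|exact: measurable_fim].
have S0 xi : 0 <= fre f xi ^+ 2 + fim f xi ^+ 2 by rewrite addr_ge0// sqr_ge0.
have FE m xi : F m xi = (fre (g (harmonic m)) xi ^+ 2 + fim (g (harmonic m)) xi ^+ 2) / harmonic m ^+ 2.
  rewrite /g difference_fourier// /F.
  have -> : dotrV (harmonic m *: e) xi = (harmonic m * (xi ord0 i / 2)) *+ 2.
    rewrite -mulr_natl /dotrV (bigD1 i)//= big1 => [|j ji].
      by rewrite !mxE !eqxx mulr1 addr0 mulrCA [2 * _]mulrC divfK.
    by rewrite !mxE eqxx/= (negbTE ji) mulr0 mul0r.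
  rewrite cos_mulr2n; have := cos2Dsin2 (harmonic m * (xi ord0 i / 2)).
  have hm : harmonic m != 0 :> R by rewrite gt_eqF// harmonic_gt0.
  move: (cos _) (sin _) (fre f xi ^+ 2 + fim f xi ^+ 2) => a b S ab.
  move: hm; move: (harmonic m) => h hm.
  have -> : a ^+ 2 = 1 - b ^+ 2 by rewrite -ab addrK.
  by field.
apply: le_lt_trans clty; apply: (@fatou_le _ _ _ mu F).
- move=> m; apply: measurable_funM => //; apply: measurable_funM => //; apply: measurable_funX.
  apply: measurable_funM => //; apply: (measurableT_comp (continuous_measurable_fun (@continuous_sin R))).
  by apply: measurable_funM => //; exact: measurable_funM.
- by apply: measurable_funM => //; exact: measurable_funX.
- move=> m xi; apply: mulr_ge0; last exact: S0.
  by apply: mulr_ge0 => //; exact: sqr_ge0.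
- by move=> xi; rewrite mulr_ge0// sqr_ge0.
- apply: nearW => xi; apply: cvgMr_tmp.
  have -> : xi ord0 i ^+ 2 = 4 * (xi ord0 i / 2) ^+ 2 by field.
  by apply: cvgMl_tmp; apply: cvgM; exact: cvg_sin_ratio.
move=> m; have h0 := h01 m; have /andP[hp _] := h0.
have mr : measurable_fun setT (fre (g (harmonic m))).
  by apply: measurable_fre; exact: (L1B (L1_translation (harmonic m *: e) L1f) L1f).
have mi : measurable_fun setT (fim (g (harmonic m))).
  by apply: measurable_fim; exact: (L1B (L1_translation (harmonic m *: e) L1f) L1f).
have -> : (\int[mu]_x (F m x)%:E = ((harmonic m ^+ 2)^-1)%:E * (L2norm2 mu (fre (g (harmonic m))) + L2norm2 mu (fim (g (harmonic m)))))%E.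
  rewrite /L2norm2 -ge0_integralD//; first last.
  - by apply/measurable_EFinP; exact: measurable_funX.
  - by move=> x _; rewrite lee_fin sqr_ge0.
  - by apply/measurable_EFinP; exact: measurable_funX.
  - by move=> x _; rewrite lee_fin sqr_ge0.
  rewrite -ge0_integralZl_EFin; first last.
  - by rewrite invr_ge0 sqr_ge0.
  - by apply: emeasurable_funD; apply/measurable_EFinP; exact: measurable_funX.
  - by move=> x _; rewrite adde_ge0// lee_fin sqr_ge0.
  - exact: measurableT.
  by apply: eq_integral => x _; rewrite FE -EFinD -EFinM mulrC.
have H := le_trans (L2norm2_fourier_le (L1B (L1_translation (harmonic m *: e) L1f) L1f) (Lg _ h0)) (gle _ h0).
apply: (@le_trans _ _ (((harmonic m ^+ 2)^-1)%:E * ((harmonic m ^+ 2)%:E * c))%E).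
  by apply: lee_wpmul2l => //; rewrite lee_fin invr_ge0 sqr_ge0.
by rewrite muleA -EFinM mulVf ?mul1e// expf_neq0// gt_eqF.
Qed.

(** For s < 1 the weight is at most 1 + |xi|^2, so it suffices that the transform and its products
    with each xi_i are square-integrable. *)
Lemma Cc_sub_Hs (s : R) U : 0 < s < 1 -> Cc_infty U `<=` Hs s.
Proof.
move=> s01 f Cf; have Lf := Cc_L2 Cf; have L1f := Cc_L1 Cf; split; first exact: Lf.
have [k fk] := Cc_support Cf.
have mr := measurable_fre L1f; have mi := measurable_fim L1f.
have mS : measurable_fun setT (fun xi : V => fre f xi ^+ 2 + fim f xi ^+ 2).
  by apply: measurable_funD; exact: measurable_funX.
have S0 xi : 0 <= fre f xi ^+ 2 + fim f xi ^+ 2 by rewrite addr_ge0// sqr_ge0.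
have mW := @measurable_Hs_weight R n s.
have mfr := L2on_measurable (L2on_fourier_re Lf); have mfi := L2on_measurable (L2on_fourier_im Lf).
rewrite /Hs_energy (ge0_ae_eq_integral (g := fun xi => (Hs_weight s xi * (fre f xi ^+ 2 + fim f xi ^+ 2))%:E))//; first last.
- apply: filterS2 (fourier_re_bounded Lf fk) (fourier_im_bounded Lf fk) => xi + + _.
  by move=> /(_ Logic.I) -> /(_ Logic.I) ->.
- by move=> xi _; rewrite lee_fin mulr_ge0// ltW// Hs_weight_gt0.
- by move=> xi _; rewrite lee_fin mulr_ge0// ?powR_ge0// addr_ge0// sqr_ge0.
- by apply/measurable_EFinP; exact: measurable_funM.
- apply/measurable_EFinP; apply: measurable_funM => //.
  by apply: measurable_funD; exact: measurable_funX.
pose T (i : 'I_n) (xi : V) : \bar R := (xi ord0 i ^+ 2 * (fre f xi ^+ 2 + fim f xi ^+ 2))%:E.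
have mT i : measurable_fun setT (T i).
  apply/measurable_EFinP; apply: measurable_funM => //; apply: measurable_funX.
  exact: measurable_rV_coord.
have T0 i xi : (0 <= T i xi)%E by rewrite lee_fin mulr_ge0// sqr_ge0.
apply: (@le_lt_trans _ _ (\int[mu]_xi ((fre f xi ^+ 2)%:E + (fim f xi ^+ 2)%:E + \sum_i T i xi))%E).
  apply: ge0_le_integral => //.
  - by move=> xi _; rewrite lee_fin mulr_ge0// ltW// Hs_weight_gt0.
  - by apply/measurable_EFinP; exact: measurable_funM.
  - apply: emeasurable_funD; last exact: emeasurable_sum.
    by apply: emeasurable_funD; apply/measurable_EFinP; exact: measurable_funX.
  - move=> xi _; rewrite -EFinD /T sumEFin -EFinD lee_fin -mulr_suml.
    apply: (@le_trans _ _ ((1 + \sum_i xi ord0 i ^+ 2) * (fre f xi ^+ 2 + fim f xi ^+ 2))); last first.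
      by rewrite mulrDl mul1r.
    apply: ler_wpM2r => //; apply: le_trans (Hs_weight_le s01 xi) _; rewrite enorm_sqr lerD2l.
    by rewrite /dotrV; apply: ler_sum => i _; rewrite expr2.
rewrite ge0_integralD//; first last.
- exact: emeasurable_sum.
- by move=> xi _; exact: sume_ge0.
- by apply: emeasurable_funD; apply/measurable_EFinP; exact: measurable_funX.
- by move=> xi _; rewrite adde_ge0// lee_fin sqr_ge0.
rewrite ge0_integralD//; first last.
- by apply/measurable_EFinP; exact: measurable_funX.
- by move=> xi _; rewrite lee_fin sqr_ge0.
- by apply/measurable_EFinP; exact: measurable_funX.
- by move=> xi _; rewrite lee_fin sqr_ge0.
apply: lte_add_pinfty.
  apply: lte_add_pinfty.
    exact: L2norm2_lty (L2on_fre L1f Lf).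
  exact: L2norm2_lty (L2on_fim L1f Lf).
rewrite ge0_integral_sum//; apply: lte_sum_pinfty => i _; exact: Cc_gradient_energy Cf.
Qed.

End test_functions.

(** * Compactness and support in Htilde *)

Section compactness.
Context {R : realType} (n : nat).
Local Notation V := 'rV[R]_n.
Local Notation mu := (lebesgue_rV n : {measure set 'rV[R]_n -> \bar R}).
Local Notation dot := (@L2dot _ _ _ mu).
Local Notation L2V := (@L2on _ _ _ mu).
Local Notation sL := (@subspace_L2 _ _ _ mu).
Local Notation bL := (symbilinear_L2dot mu).
Local Notation dot0 := (fun x _ => L2dot_ge0 mu x).
Implicit Types (U : set V) (u v w f g h : V -> R).

Lemma lipschitz1 (f df : R -> R) (a b : R) :
  (forall x, is_derive x (1 : R) f (df x)) -> (forall x, `|df x| <= 1) ->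
  `|f a - f b| <= `|a - b|.
Proof.
move=> Df f1; wlog ab : a b / b <= a => [H|].
  by have [|/ltW] := leP b a => ?; [exact: H|rewrite distrC [leRHS]distrC; exact: H].
have [c _ ->] : exists2 c : R, c \in `[b, a] & f a - f b = df c * (a - b).
  apply: (@MVT_segment R f df) => //; apply: continuous_subspaceT => r.
  by apply: differentiable_continuous; apply/derivable1_diffP; have [] := Df r.
by rewrite normrM ler_piMl.
Qed.

Lemma cos_lipschitz (a b : R) : `|cos a - cos b| <= `|a - b|.
Proof.
apply: (lipschitz1 (df := fun x => - sin x)) => x.
by rewrite normrN ler_norml sin_geN1 sin_le1.
Qed.

Lemma sin_lipschitz (a b : R) : `|sin a - sin b| <= `|a - b|.
Proof.
by apply: (lipschitz1 (df := cos)) => x; rewrite ler_norml cos_geN1 cos_le1.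
Qed.

Let vol (k : nat) : R := fine (mu (eball (k%:R : R))).

Lemma eball_vol k : (vol k)%:E = mu (eball (k%:R : R)).
Proof. by rewrite /vol fineK// ge0_fin_numE// lebesgue_eball_lty. Qed.

Lemma vol_ge0 k : 0 <= vol k. Proof. exact: fine_ge0. Qed.

(** Cauchy-Schwarz on the ball. With h a cosine or a sine it bounds point values of the transform;
    with h a difference of two of them, it bounds their variation. *)
Lemma trunc_pairing_le (k : nat) (c : R) u h : L2V u -> measurable_fun setT h ->
  (forall x, eball k%:R x -> `|h x| <= c) ->
  (\int[mu]_x (trunc k u x * h x)) ^+ 2 <= c ^+ 2 * vol k * dot u u.
Proof.
move=> Lu mh hc; have mB := @measurable_eball R n k%:R.
have c0 : 0 <= c.
  apply: le_trans (hc 0 _) => //; rewrite /eball/= /enorm /dotrV big1 ?sqrtr0// => i _.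
  by rewrite mxE mul0r.
have Lh : L2V (trunc k h).
  apply: (@L2on_bounded _ _ _ k c); first exact: measurable_restrict_rV.
    move=> x; rewrite /trunc patchE; case: ifPn => [/set_mem/hc//|_].
    by rewrite normr0.
  by move=> x xk; rewrite /trunc patchE memNset.
have -> : \int[mu]_x (trunc k u x * h x) = dot u (trunc k h).
  rewrite L2dotRE; apply: eq_Rintegral => x _; rewrite /trunc !patchE.
  by case: ifP => // _; rewrite mul0r mulr0.
apply: le_trans (form_cauchy_schwarz sL bL dot0 Lu Lh) _.
apply: ler_wpM2r; first exact: L2dot_ge0.
rewrite -lee_fin L2dot_norm2// EFinM eball_vol.
apply: (@le_trans _ _ (\int[mu]_x ((c ^+ 2)%:E * (\1_(eball (k%:R : R)) x)%:E))%E).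
  apply: ge0_le_integral => //.
  - by move=> x _; rewrite lee_fin sqr_ge0.
  - by apply/measurable_EFinP; apply: measurable_funX; exact: L2on_measurable Lh.
  - by apply: measurable_funeM; apply/measurable_EFinP; exact: measurable_indic.
  - move=> x _; rewrite -EFinM lee_fin indicE /trunc patchE.
    case: ifPn => [/set_mem xk|_]; last by rewrite expr0n mulr0.
    by rewrite mulr1 -[leLHS]real_normK ?num_real// lerXn2r ?nnegrE// hc.
rewrite ge0_integralZl_EFin//; first last.
- exact: sqr_ge0.
- by apply/measurable_EFinP; exact: measurable_indic.
- by rewrite (integral_indic mu measurableT mB) setIT.
Qed.

Lemma measurable_cosr (xi : V) : measurable_fun setT (fun x : V => cos (dotrV x xi)).
Proof.
rewrite (_ : (fun x => _) = fun x => cos (dotrV xi x)); first exact: measurable_cos_dotrV.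
by apply/funext => x; rewrite dotrVC.
Qed.

Lemma measurable_sinr (xi : V) : measurable_fun setT (fun x : V => sin (dotrV x xi)).
Proof.
rewrite (_ : (fun x => _) = fun x => sin (dotrV xi x)); first exact: measurable_sin_dotrV.
by apply/funext => x; rewrite dotrVC.
Qed.

Local Notation FC := (@fourier_const R n).

Lemma fre_trunc_bounded k xi u : L2V u ->
  fre (trunc k u) xi ^+ 2 <= FC ^+ 2 * vol k * dot u u.
Proof.
move=> Lu; rewrite /fre exprMn -mulrA ler_wpM2l ?sqr_ge0//.
have := @trunc_pairing_le k 1 _ _ Lu (measurable_cosr xi); rewrite expr1n mul1r; apply.
by move=> x _; rewrite ler_norml cos_geN1 cos_le1.
Qed.

Lemma fim_trunc_bounded k xi u : L2V u ->
  fim (trunc k u) xi ^+ 2 <= FC ^+ 2 * vol k * dot u u.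
Proof.
move=> Lu; rewrite /fim sqrrN exprMn -mulrA ler_wpM2l ?sqr_ge0//.
have := @trunc_pairing_le k 1 _ _ Lu (measurable_sinr xi); rewrite expr1n mul1r; apply.
by move=> x _; rewrite ler_norml sin_geN1 sin_le1.
Qed.

Lemma dotrV_dist_le k (d : R) (x xi eta : V) : eball k%:R x ->
  (forall i, `|xi ord0 i - eta ord0 i| <= d) ->
  `|dotrV x xi - dotrV x eta| <= n%:R * k%:R * d.
Proof.
move=> xk xe; rewrite /dotrV -sumrB.
apply: le_trans (ler_norm_sum _ _ _) _.
apply: (@le_trans _ _ (\sum_(i < n) k%:R * d)); last first.
  by rewrite sumr_const card_ord -[leLHS]mulr_natl mulrA.
apply: ler_sum => i _; rewrite -mulrBr normrM; apply: ler_pM => //.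
exact: le_trans (coord_le_enorm x i) xk.
Qed.

Lemma fre_trunc_dist k (d : R) (xi eta : V) u : L2V u ->
  (forall i, `|xi ord0 i - eta ord0 i| <= d) ->
  (fre (trunc k u) xi - fre (trunc k u) eta) ^+ 2 <=
  FC ^+ 2 * ((n%:R * k%:R * d) ^+ 2 * vol k) * dot u u.
Proof.
move=> Lu xe; rewrite /fre -mulrBr exprMn -mulrA ler_wpM2l ?sqr_ge0//.
have Lt := L1_trunc k Lu.
have -> : Fcos (trunc k u) xi - Fcos (trunc k u) eta =
    \int[mu]_x (trunc k u x * (cos (dotrV x xi) - cos (dotrV x eta))).
  rewrite /Fcos -RintegralB//; [|exact: L1_cos|exact: L1_cos].
  by apply: eq_Rintegral => x _; rewrite mulrBr.
apply: trunc_pairing_le => //.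
  by apply: measurable_funB; exact: measurable_cosr.
move=> x xk; apply: le_trans (cos_lipschitz _ _) _.
exact: dotrV_dist_le.
Qed.

Lemma fim_trunc_dist k (d : R) (xi eta : V) u : L2V u ->
  (forall i, `|xi ord0 i - eta ord0 i| <= d) ->
  (fim (trunc k u) xi - fim (trunc k u) eta) ^+ 2 <=
  FC ^+ 2 * ((n%:R * k%:R * d) ^+ 2 * vol k) * dot u u.
Proof.
move=> Lu xe.
have -> : fim (trunc k u) xi - fim (trunc k u) eta = FC * (Fsin (trunc k u) eta - Fsin (trunc k u) xi).
  by rewrite /fim; ring.
rewrite exprMn -mulrA ler_wpM2l ?sqr_ge0//.
have Lt := L1_trunc k Lu.
have -> : Fsin (trunc k u) eta - Fsin (trunc k u) xi =
    \int[mu]_x (trunc k u x * (sin (dotrV x eta) - sin (dotrV x xi))).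
  rewrite /Fsin -RintegralB//; [|exact: L1_sin|exact: L1_sin].
  by apply: eq_Rintegral => x _; rewrite mulrBr.
apply: trunc_pairing_le => //.
  by apply: measurable_funB; exact: measurable_sinr.
move=> x xk; apply: le_trans (sin_lipschitz _ _) _.
by apply: dotrV_dist_le => // i; rewrite distrC.
Qed.

Lemma finite_net (rho : nat) (d : R) : 0 < d ->
  exists (N : nat) (p : 'I_N -> V), forall xi, eball (rho%:R : R) xi ->
    exists j, forall i, `|xi ord0 i - p j ord0 i| <= d.
Proof.
move=> d0.
pose K : set V := [set x | forall i, `[- rho%:R, rho%:R]%classic (x ord0 i)].
have cK : compact K.
  exact: (@rV_compact R n (fun=> `[- rho%:R, rho%:R]%classic) (fun=> @segment_compact R _ _)).
move: cK; rewrite compact_cover => /(_ V setT (fun x => ball x d)).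
have o (x : V) : setT x -> open (ball x d) by move=> _; exact: ball_open.
move=> /(_ o) [|D _ KD].
  by move=> x _; exists x => //; exact: ballxx.
exists (size (finmap.enum_fset D)), (tnth (in_tuple (finmap.enum_fset D))) => xi xk.
have /KD[x /= xD] : K xi.
  move=> i /=; rewrite in_itv/= -ler_norml; exact: le_trans (coord_le_enorm xi i) xk.
have {}xD : x \in finmap.enum_fset D by exact: xD.
have /tnthP[j jx] : x \in in_tuple (finmap.enum_fset D) by [].
rewrite -ball_normE /ball_/= => xd; exists j => i; rewrite -jx distrC.
apply: le_trans (ltW xd); rewrite -[leRHS]/(mx_norm (x - xi)) mx_normrE.
apply/bigmax_geP; right => /=; exists (ord0, i) => //=.
by rewrite !mxE.
Qed.

Variable s : R.
Hypothesis s01 : 0 < s < 1.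

(** Symbol of the fractional Laplacian of order 2s, with which ellipticity compares [L]. *)
Definition riesz_weight (xi : V) : R := enorm xi `^ (2 * s).

Lemma measurable_riesz_weight : measurable_fun setT riesz_weight.
Proof. by apply: (measurableT_comp (measurable_powR (2 * s))); exact: measurable_enorm. Qed.

Lemma riesz_weightE xi : riesz_weight xi = (enorm xi ^+ 2) `^ s.
Proof. by rewrite /riesz_weight powRrM powR_mulrn// enorm_ge0. Qed.

Lemma riesz_weight_ge0 xi : 0 <= riesz_weight xi. Proof. exact: powR_ge0. Qed.

Let s_ge0 : 0 <= s. Proof. by case/andP: s01 => /ltW. Qed.

Lemma riesz_weight_le xi : riesz_weight xi <= Hs_weight s xi.
Proof.
rewrite riesz_weightE /Hs_weight; apply: ge0_ler_powR => //; rewrite ?nnegrE ?sqr_ge0//.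
  by rewrite addr_ge0// sqr_ge0.
by rewrite lerDr.
Qed.

(** 1 + |xi|^2 is at most twice the larger of 1 and |xi|^2, and 2^s <= 2. *)
Lemma Hs_weight_le_riesz xi : Hs_weight s xi <= 2 * (1 + riesz_weight xi).
Proof.
rewrite riesz_weightE /Hs_weight; set t := enorm xi ^+ 2.
have t0 : 0 <= t by exact: sqr_ge0.
have p2 (x : R) : 0 <= x -> (2 * x) `^ s <= 2 * x `^ s.
  move=> x0; rewrite powRM// ler_wpM2r ?powR_ge0//.
  by apply: ler1_powR; [rewrite ler1n|case/andP: s01 => _ /ltW].
have [t1|t1] := leP t 1.
  apply: (@le_trans _ _ ((2 * 1) `^ s)).
    by apply: ge0_ler_powR => //; rewrite ?nnegrE; lra.
  by apply: le_trans (p2 1 ler01) _; rewrite powR1 ler_wpM2l// lerDl powR_ge0.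
apply: (@le_trans _ _ ((2 * t) `^ s)).
  by apply: ge0_ler_powR => //; rewrite ?nnegrE; lra.
by apply: le_trans (p2 t t0) _; rewrite ler_wpM2l// lerDr.
Qed.

Definition fourier_sqr u xi : R := fourier_re u xi ^+ 2 + fourier_im u xi ^+ 2.

Lemma fourier_sqr_ge0 u xi : 0 <= fourier_sqr u xi.
Proof. by rewrite addr_ge0// sqr_ge0. Qed.

Lemma L1_fourier_sqr u : L2V u -> L1 (fourier_sqr u).
Proof.
move=> Lu; have Lr := L2on_fourier_re Lu; have Li := L2on_fourier_im Lu.
have := L1D (integrable_mul Lr Lr) (integrable_mul Li Li).
by apply: eq_integrable => // xi _ /=; rewrite /fourier_sqr !expr2.
Qed.

Lemma dot_fourier_sqr u : L2V u -> dot u u = \int[mu]_xi fourier_sqr u xi.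
Proof.
move=> Lu; have Lr := L2on_fourier_re Lu; have Li := L2on_fourier_im Lu.
by rewrite -(plancherel Lu Lu) /fourier_dot !L2dotRE -RintegralD//; exact: integrable_mul.
Qed.

Lemma L1_riesz u : Hs s u -> L1 (fun xi => riesz_weight xi * fourier_sqr u xi).
Proof.
move=> Hu; have b xi : `|riesz_weight xi| <= 1 * Hs_weight s xi.
  by rewrite mul1r ger0_norm ?riesz_weight_ge0 ?riesz_weight_le.
have := L1_form s01 measurable_riesz_weight b Hu Hu.
by apply: eq_integrable => // xi _ /=; rewrite /fourier_sqr !expr2.
Qed.

Lemma riesz_formE u : form_L riesz_weight u u = \int[mu]_xi (riesz_weight xi * fourier_sqr u xi).
Proof. by apply: eq_Rintegral => xi _; rewrite /fourier_sqr !expr2. Qed.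

Lemma Hs_form_le_riesz u : Hs s u ->
  Hs_form s u u <= 2 * (dot u u + form_L riesz_weight u u).
Proof.
move=> Hu; have Lu := Hs_L2 s01 Hu; have I1 := L1_fourier_sqr Lu; have I2 := L1_riesz Hu.
rewrite riesz_formE (dot_fourier_sqr Lu) -RintegralD// -RintegralZl//; last exact: L1D.
apply: le_Rintegral => //.
- exact: L1_Hs_form.
- exact: (L1Z 2 (L1D I1 I2)).
move=> xi _; rewrite -!expr2 -/(fourier_sqr u xi) -[X in X + _]mul1r -mulrDl mulrA.
by apply: ler_wpM2r; [exact: fourier_sqr_ge0|exact: Hs_weight_le_riesz].
Qed.

(** Point values of [fourier_re u] are meaningless, as it is a representative; those of
    [fre (trunc k u)] are given by an integral. This permits sampling the transform at points. *)
Lemma fourier_sqr_trunc u k : L2V u -> {ae mu, forall x, ~ eball k%:R x -> u x = 0} ->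
  {ae mu, forall xi, fourier_sqr u xi = fre (trunc k u) xi ^+ 2 + fim (trunc k u) xi ^+ 2}.
Proof.
move=> Lu u0; have Lt := L2on_trunc k Lu.
have ut : u = trunc k u %[ae mu].
  apply: filterS u0 => x xk _; rewrite /trunc patchE; case: ifPn => // /negP xk'.
  by apply: xk => h; apply: xk'; rewrite mem_set.
have out x : ~ eball k%:R x -> trunc k u x = 0.
  by move=> xk; rewrite /trunc patchE memNset.
apply: filterS2 (fourier_re_bounded Lt out) (fourier_im_bounded Lt out) => xi.
move=> /(_ Logic.I) hr /(_ Logic.I) hi.
by rewrite /fourier_sqr (fourier_re_ae Lu Lt ut) (fourier_im_ae Lu Lt ut) hr hi.
Qed.

Lemma small_power (e : R) : 0 < e -> exists2 rho : nat, (0 < rho)%N & (rho%:R `^ (2 * s))^-1 <= e.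
Proof.
move=> e0; have s2 : 0 < 2 * s by case/andP: s01 => h _; rewrite mulr_gt0.
pose r : nat := (Num.truncn (e^-1 `^ (2 * s)^-1)).+1; exists r => //.
have h : e^-1 <= r%:R `^ (2 * s).
  have e1 : 0 <= e^-1 by rewrite invr_ge0 ltW.
  have -> : e^-1 = (e^-1 `^ (2 * s)^-1) `^ (2 * s).
    by rewrite -powRrM mulVf ?powRr1// gt_eqF.
  apply: ge0_ler_powR; rewrite ?nnegrE ?powR_ge0//; first exact: ltW.
  by apply: ltW; exact: truncnS_gt.
by rewrite -[leRHS]invrK lef_pV2 ?posrE ?invr_gt0// powR_gt0// ltr0n.
Qed.

(* Rellich's theorem in quantitative form: the transform of a function supported
   in a fixed ball is Lipschitz, hence on low frequencies it is determined, up to a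
   small error, by its values at finitely many points.  *)
Lemma compact_embedding (k : nat) (eta : R) : 0 < eta ->
  exists (N : nat) (p : 'I_N -> V) (K : R), 0 <= K /\ forall u, Hs s u ->
    {ae mu, forall x, ~ eball k%:R x -> u x = 0} ->
    dot u u <= eta * form_L riesz_weight u u +
      K * \sum_j (fre (trunc k u) (p j) ^+ 2 + fim (trunc k u) (p j) ^+ 2).
Proof.
(* Beyond the radius [rho] the Riesz weight is at least 2 / eta, so the high frequencies cost at
   most eta / 2 times the Riesz form. *)
move=> eta0; have [rho rho0 hrho] := small_power (divr_gt0 eta0 (ltr0Sn R 1)).
pose Z := 4 * FC ^+ 2 * ((n%:R * k%:R) ^+ 2 * vol k) * vol rho.
have Z0 : 0 <= Z.
  apply: mulr_ge0 (vol_ge0 _); apply: mulr_ge0; first by rewrite mulr_ge0// sqr_ge0.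
  by apply: mulr_ge0 (vol_ge0 _); exact: sqr_ge0.
(* Mesh of the net: it makes the interpolation error on low frequencies, [Z * d ^+ 2 * dot u u], at
   most half of [dot u u], to be absorbed on the left. *)
pose d := Num.min 1 (2 * (Z + 1))^-1.
have d0 : 0 < d by rewrite /d lt_min ltr01/= invr_gt0 mulr_gt0// ltr_wpDl.
have Zd : Z * d ^+ 2 <= 2^-1.
  have h1 : d <= 1 by rewrite /d ge_min lexx.
  have h2 : d <= (2 * (Z + 1))^-1 by rewrite /d ge_min lexx orbT.
  have h3 : d * (2 * (Z + 1)) <= 1 by rewrite -ler_pdivlMr ?div1r// mulr_gt0// ltr_wpDl.
  have h4 : d ^+ 2 <= d by rewrite expr2 ler_piMl// ltW.
  have h5 : Z * d ^+ 2 <= Z * d by exact: ler_wpM2l.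
  by move: h3 h5 d0; clear; lra.
have [N [p hp]] := finite_net rho d0.
(* The low frequencies contribute 2 [vol rho] times the sum of samples; absorbing half of the left
   side doubles this constant, and doubles eta / 2 to eta. *)
exists N, p, (4 * vol rho); split; first by rewrite mulr_ge0// vol_ge0.
move=> u Hu u0; have Lu := Hs_L2 s01 Hu.
set S := \sum_j _; have S0 : 0 <= S by apply: sumr_ge0 => j _; rewrite addr_ge0// sqr_ge0.
pose A := 2 * S + 4 * FC ^+ 2 * ((n%:R * k%:R * d) ^+ 2 * vol k) * dot u u.
have A0 : 0 <= A.
  apply: addr_ge0; first exact: mulr_ge0.
  apply: mulr_ge0 (L2dot_ge0 _ _); apply: mulr_ge0; first by rewrite mulr_ge0// sqr_ge0.
  by apply: mulr_ge0 (vol_ge0 _); exact: sqr_ge0.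
have low : {ae mu, forall xi, eball (rho%:R : R) xi -> fourier_sqr u xi <= A}.
  apply: filterS (fourier_sqr_trunc Lu u0) => xi -> xirho.
  have [j hj] := hp xi xirho.
  have hr := fre_trunc_dist k Lu hj; have hi := fim_trunc_dist k Lu hj.
  have Sj : fre (trunc k u) (p j) ^+ 2 + fim (trunc k u) (p j) ^+ 2 <= S.
    rewrite /S (bigD1 j)//= lerDl; apply: sumr_ge0 => i _.
    by rewrite addr_ge0// sqr_ge0.
  rewrite /A; move: hr hi Sj.
  have -> : 4 * FC ^+ 2 * ((n%:R * k%:R * d) ^+ 2 * vol k) * dot u u =
    4 * (FC ^+ 2 * ((n%:R * k%:R * d) ^+ 2 * vol k) * dot u u) by ring.
  move: (FC ^+ 2 * _ * _) (fre _ xi) (fre _ (p j)) (fim _ xi) (fim _ (p j)) (S).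
  clear => Y a b c e T ha hc hS.
  have := sqr_ge0 (a - 2 * b); have := sqr_ge0 (c - 2 * e); nra.
have I2 := L1_riesz Hu; have I1 := L1_fourier_sqr Lu.
have mB := @measurable_eball R n rho%:R.
have I1B : L1 (\1_(eball (rho%:R : R)) : V -> R).
  apply/integrableP; split.
    by apply/measurable_EFinP; exact: measurable_indic.
  rewrite (eq_integral (fun x => (\1_(eball (rho%:R : R)) x)%:E)).
    by rewrite (integral_indic mu measurableT mB) setIT lebesgue_eball_lty.
  by move=> x _; rewrite /= ger0_norm.
have IA : L1 (fun xi : V => A * \1_(eball (rho%:R : R)) xi) by exact: L1Z.
pose G (xi : V) := A * \1_(eball (rho%:R : R)) xi + eta / 2 * (riesz_weight xi * fourier_sqr u xi).
have IG : L1 G by apply: L1D => //; exact: L1Z.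
have SG : {ae mu, forall xi, fourier_sqr u xi <= G xi}.
  apply: filterS low => xi lo; rewrite /G indicE.
  have F0 := fourier_sqr_ge0 u xi; have w0 := riesz_weight_ge0 xi.
  have [xirho|xirho] := pselect (eball (rho%:R : R) xi).
    rewrite mem_set// mulr1; apply: le_trans (lo xirho) _.
    by rewrite lerDl !mulr_ge0// ltW// divr_gt0.
  rewrite memNset// mulr0 add0r mulrA ler_peMl//.
  have r0 : 0 < rho%:R `^ (2 * s) :> R by rewrite powR_gt0// ltr0n.
  have h1 : rho%:R `^ (2 * s) <= riesz_weight xi.
    apply: ge0_ler_powR; rewrite ?nnegrE ?enorm_ge0 ?mulr_ge0//.
    by move/negP: xirho; rewrite -ltNge => /ltW.
  apply: le_trans (_ : (rho%:R `^ (2 * s))^-1 * rho%:R `^ (2 * s) <= _).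
    by rewrite mulVf// gt_eqF.
  by apply: ler_pM => //; exact: ltW.
have HI : dot u u <= A * vol rho + eta / 2 * form_L riesz_weight u u.
  have -> : A * vol rho + eta / 2 * form_L riesz_weight u u = \int[mu]_xi G xi.
    rewrite /G RintegralD//; last exact: L1Z.
    rewrite RintegralZl// riesz_formE; congr (_ + _); last by rewrite RintegralZl.
    congr (_ * _); rewrite /Rintegral (integral_indic mu measurableT mB) setIT.
    by [].
  rewrite dot_fourier_sqr// -lee_fin /Rintegral !fineK; [|exact: integrable_fin_num..].
  apply: ae_ge0_le_integral => //.
  - by move=> x _; rewrite lee_fin fourier_sqr_ge0.
  - exact: measurable_int I1.
  - move=> x _; rewrite lee_fin /G addr_ge0 ?mulr_ge0 ?riesz_weight_ge0 ?fourier_sqr_ge0//.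
    by rewrite ltW// divr_gt0.
  - exact: measurable_int IG.
  - by apply: filterS SG => x xG _; rewrite lee_fin.
have AE : A * vol rho = 2 * vol rho * S + Z * d ^+ 2 * dot u u by rewrite /A /Z; ring.
have D0 := L2dot_ge0 mu u.
have : Z * d ^+ 2 * dot u u <= 2^-1 * dot u u by apply: ler_wpM2r.
move: HI; rewrite AE; move: (Z * d ^+ 2 * dot u u) (dot u u) (form_L _ u u) (vol rho * S) => *.
by nra.
Qed.

Lemma Htilde_Hs U : Htilde s U `<=` Hs s.
Proof. by move=> u []. Qed.

Lemma HtildeE U : Htilde s U = closure_in (Hs s) (Hs_form s) (Cc_infty U).
Proof. exact: Hs_closureE. Qed.

Lemma hilbert_Htilde U : hilbert (Htilde s U) (Hs_form s).
Proof.
rewrite HtildeE; apply: hilbert_closure_in; [exact: hilbert_Hs|exact: subspace_Cc].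
Qed.

(** Test functions vanish outside [U], so the squared L^2 norm of u there is bounded by the squared
    H^s distance from u to any of them. No regularity of [U] enters. *)
Lemma Htilde_outside U u : measurable U -> Htilde s U u ->
  {ae mu, forall x, ~ U x -> u x = 0}.
Proof.
move=> mU; rewrite HtildeE => -[Hu uU]; have Lu := Hs_L2 s01 Hu.
have mUc : measurable (~` U) by exact: measurableC.
have Lw := L2on_restrict mUc Lu.
suff w0 : dot (u \_ (~` U)) (u \_ (~` U)) = 0.
  apply: filterS (L2dot_eq0 Lw w0) => x /(_ Logic.I) + Ux.
  by rewrite patchE mem_set.
apply/eqP; rewrite eq_le L2dot_ge0 andbT; apply/ler_addgt0Pl => e e0; rewrite addr0.
have [v [Cv Hv uv]] := uU e e0; apply: le_trans (ltW uv).
have Huv := subspaceB (subspace_Hs n s01) Hu Hv.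
apply: le_trans (L2dot_le_Hs s01 Huv); have Luv := Hs_L2 s01 Huv.
rewrite !L2dotRE; apply: le_Rintegral => //; [exact: integrable_mul..|].
move=> x _; rewrite -!expr2 patchE; case: ifPn => [/set_mem Ux|_]; last by rewrite expr0n sqr_ge0.
by rewrite -[(u - v) x]/(u x - v x) (Cc_outside Cv Ux) subr0.
Qed.

End compactness.

(** * The Dirichlet problem *)

Section dirichlet.
Opaque L2dot L2on fourier fourier_re fourier_im.
Context {R : realType} (n : nat).
Local Notation V := 'rV[R]_n.
Local Notation mu := (lebesgue_rV n : {measure set 'rV[R]_n -> \bar R}).
Local Notation dot := (@L2dot _ _ _ mu).
Local Notation L2V := (@L2on _ _ _ mu).
Local Notation sL := (@subspace_L2 _ _ _ mu).
Local Notation bL := (symbilinear_L2dot mu).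
Implicit Types (C Om U W : set V) (u v w f g h q : V -> R).

Lemma Linfty_bounded g : g \in Lfun mu +oo%E -> measurable_fun setT g /\
  exists2 Q : R, 0 <= Q & {ae mu, forall x, `|g x| <= Q}.
Proof.
move=> /andP[/= mg]; rewrite inE/= => ng; split; first by have := set_mem mg.
move: ng; rewrite /finite_norm unlock; case: ifPn => [_ ess|]; last first.
  (* The whole space has measure zero here and the norm is 0 by convention, but every bound holds
     almost everywhere. *)
  rewrite -leNgt => m0 _; exists 0 => //; exists setT; split => //.
  by apply/eqP; rewrite eq_le m0 measure_ge0.
have E := @ess_sup_ge _ _ _ mu (abse \o (EFin \o g)).
have [Q HQ] : exists Q : R, (ess_sup mu (abse \o (EFin \o g)) <= Q%:E)%E.
  case: (ess_sup mu _) ess => [r _|//|_]; first by exists r.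
  by exists 0; rewrite leNye.
exists `|Q| => //; apply: filterS E => x /= h; rewrite -lee_fin.
by apply: le_trans h (le_trans HQ _); rewrite lee_fin ler_norm.
Qed.

(** Clamping the extension of q by zero to [-Q, Q] changes it on a null set and makes the bound hold
    everywhere, so that products with L^1 functions are integrable. *)
Lemma potential_bounded Om q : measurable Om -> q \_ Om \in Lfun mu +oo%E ->
  exists (p : V -> R) (Q : R), [/\ measurable_fun setT p, 0 <= Q,
    forall x, `|p x| <= Q & forall u v, L2V u -> L2V v ->
      \int[mu]_(x in Om) (q x * u x * v x) = \int[mu]_x (u x * v x * p x)].
Proof.
move=> mOm /Linfty_bounded[mq [Q Q0 qQ]].
pose p x := Num.max (- Q) (Num.min Q ((q \_ Om) x)).
have mp : measurable_fun setT p.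
  by apply: measurable_maxr => //; exact: measurable_minr.
exists p, Q; split => //.
  by move=> x; rewrite /p ler_norml le_max lexx/= ge_max ge_min lexx/= ge0_cp.
move=> u v Lu Lv; rewrite Rintegral_mkcond; apply: Rintegral_ae.
- rewrite (_ : _ \_ _ = fun x => (q \_ Om) x * u x * v x); last first.
    by apply/funext => x; rewrite !patchE; case: ifP => // _; rewrite !mul0r.
  by apply: measurable_funM (L2on_measurable Lv); apply: measurable_funM (L2on_measurable Lu).
- by apply: measurable_funM => //; apply: measurable_funM (L2on_measurable Lu) (L2on_measurable Lv).
apply: filterS qQ => x; rewrite ler_norml => /andP[h1 h2] _.
rewrite /p min_r// max_r// !patchE; case: ifP => _; last by rewrite mulr0.
by rewrite -mulrA mulrC.
Qed.

Lemma potential_ae Om q u1 u2 v : measurable Om -> measurable_fun setT (q \_ Om) ->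
  measurable_fun setT u1 -> measurable_fun setT u2 -> measurable_fun setT v ->
  u1 = u2 %[ae mu in Om] ->
  \int[mu]_(x in Om) (q x * u1 x * v x) = \int[mu]_(x in Om) (q x * u2 x * v x).
Proof.
move=> mOm mq m1 m2 mv u12.
have E u : (fun x => q x * u x * v x) \_ Om = fun x => (q \_ Om) x * u x * v x.
  by apply/funext => x; rewrite !patchE; case: ifP => // _; rewrite !mul0r.
rewrite [LHS]Rintegral_mkcond [RHS]Rintegral_mkcond !E; apply: Rintegral_ae.
- by apply: measurable_funM => //; exact: measurable_funM.
- by apply: measurable_funM => //; exact: measurable_funM.
apply: filterS u12 => x xD _; rewrite patchE; case: ifPn => [/set_mem xOm|_].
  by rewrite xD.
by rewrite !mul0r.
Qed.

(** For c in the cone, x = (x - t c) + t c, and x - t c stays in the open set [Om] for small t >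
    0. *)
Lemma sub_cone_dom C Om : open Om -> C !=set0 -> is_cone C -> Om `<=` cone_dom C Om.
Proof.
move=> oOm [c Cc] coneC x Omx.
have cx : (x - (t : R) *: c) @[t --> (0 : R)] --> x.
  rewrite -[X in _ --> X]subr0 -(scale0r c); apply: cvgB; first exact: cvg_cst.
  by apply: cvgZr_tmp; exact: cvg_id.
have := cx _ (open_nbhs_nbhs (conj oOm Omx)).
move=> /nbhs_ballP[e /= e0 he].
have h : Om (x - (e / 2) *: c).
  apply: (he (e / 2)); rewrite -ball_normE /ball_/= sub0r normrN ger0_norm ?divr_ge0 ?(ltW e0)//.
  by rewrite ltr_pdivrMr// ltr_pMr// ltr1n.
exists (x - (e / 2) *: c) => //; exists ((e / 2) *: c); last by rewrite subrK.
by right; apply: coneC => //; rewrite divr_gt0.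
Qed.

Lemma open_cone_dom C Om : open Om -> open (cone_dom C Om).
Proof.
move=> oOm; have -> : cone_dom C Om =
    \bigcup_(y in [set - z | z in C] `|` C) ((fun z => z - y) @^-1` Om).
  apply/seteqP; split=> [_ [x Omx [y Cy] <-]|z [y Cy Omz]].
    by exists y => //=; rewrite addrK.
  by exists (z - y) => //; exists y => //; rewrite subrK.
apply: bigcup_open => y _; apply: open_comp => // z _.
have c1 : {for z, continuous (fun t : V => t)} by move=> A.
have c2 : {for z, continuous (fun _ : V => y)} by exact: cst_continuous.
exact: (@continuousB R V V (fun t => t) (fun=> y) z c1 c2).
Qed.

Lemma measurable_fun_restrict U u : measurable U -> measurable_fun U u ->
  measurable_fun setT (u \_ U).
Proof. by move=> mU mu_; apply/(measurable_restrictT _ mU). Qed.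

Lemma Htilde_ae (s : R) U u v : 0 < s < 1 -> measurable_fun setT v -> u = v %[ae mu] ->
  Htilde s U u -> Htilde s U v.
Proof.
move=> s01 mv uv; rewrite (HtildeE s01 U) => -[Hu uU]; have Hv := Hs_ae s01 mv uv Hu.
have Lu := Hs_L2 s01 Hu; have Lv := Hs_L2 s01 Hv.
split; first exact: Hv.
move=> e e0; have [y [Uy Hy h]] := uU e e0; exists y; split; [exact: Uy|exact: Hy|].
have Hvy := subspaceB (subspace_Hs n s01) Hv Hy; have Huy := subspaceB (subspace_Hs n s01) Hu Hy.
have vyuy : v - y = u - y %[ae mu].
  by apply: filterS uv => x + _ => /(_ Logic.I) e1; rewrite -[LHS]/(v x - y x) -e1.
rewrite /Hs_form (form_ael _ _ (Hs_L2 s01 Hvy) (Hs_L2 s01 Huy) vyuy).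
by rewrite (form_aer _ _ (Hs_L2 s01 Hvy) (Hs_L2 s01 Huy) vyuy).
Qed.

Lemma Hs_self s U u : 0 < s < 1 -> Hs s u -> Hs_on s U u.
Proof.
move=> s01 Hu; split.
  by apply: measurable_funTS; exact: L2on_measurable (Hs_L2 s01 Hu).
by exists u; split => //; exact: ae_eq_refl.
Qed.

(** * The exterior problem, its solvability and the two implications *)

Section exterior_problem.
Variables (s : R) (C Om W : set V) (L q : V -> R).
Hypotheses (s01 : 0 < s < 1) (C_nonempty : C !=set0) (C_cone : is_cone C)
  (Om_open : open Om) (Om_bounded : bounded_set Om)
  (W_sub : W `<=` ~` closure Om `&` cone_dom C Om)
  (q_Linfty : q \_ Om \in Lfun (lebesgue_rV n) +oo%E)
  (L_elliptic : elliptic_symbol s L)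
  (L_dependence : domain_of_dependence s C Om L)
  (Dirichlet_well_posed : well_posed s C Om L q).

Local Notation H := (Htilde s Om).
Local Notation D := (cone_dom C Om).
Local Notation B := (Btilde Om L q).
Local Notation sH := (subspace_Hs n s01).

Let mOm : measurable Om. Proof. exact: open_measurable_rV. Qed.
Let mD : measurable D. Proof. by apply: open_measurable_rV; exact: open_cone_dom. Qed.
Let OmD : Om `<=` D. Proof. exact: sub_cone_dom. Qed.

Let sHt : subspace H. Proof. by have [] := hilbert_Htilde s01 Om. Qed.

Lemma symbol_bound : exists2 lam : R, 1 <= lam & [/\ measurable_fun setT L,
  forall xi, lam^-1 * riesz_weight s xi <= L xi,
  forall xi, `|L xi| <= lam * Hs_weight s xi & forall xi, L xi <= lam * riesz_weight s xi].
Proof.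
have [mL _ [lam lam1 HL]] := L_elliptic; exists lam => //.
have l0 : 0 < lam by exact: lt_le_trans lam1.
split => // xi; have /andP[h1 h2] := HL xi => //.
rewrite ger0_norm; last by apply: le_trans h1; rewrite mulr_ge0 ?powR_ge0// invr_ge0 ltW.
by apply: le_trans h2 _; apply: ler_wpM2l; [exact: ltW|exact: riesz_weight_le].
Qed.

Lemma symbilinear_L : symbilinear_on (Hs s) (form_L L).
Proof. by have [lam _ [mL _ bnd _]] := symbol_bound; exact: symbilinear_form mL bnd. Qed.

Lemma symbilinear_Btilde : symbilinear_on (Hs s) B.
Proof.
have [p [Q [mp Q0 pQ pE]]] := potential_bounded mOm q_Linfty.
have [L1' L2'] := symbilinear_L; split=> [u v Hu Hv|v Hv a u w Hu Hw].
  rewrite /Btilde (L1' _ _ Hu Hv); congr (_ + _); apply: eq_Rintegral => x _.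
  by rewrite mulrAC.
have Huw := sH.2 a _ _ Hu Hw.
have Lu := Hs_L2 s01 Hu; have Lv := Hs_L2 s01 Hv; have Lw := Hs_L2 s01 Hw.
rewrite /Btilde (L2' _ Hv a _ _ Hu Hw) !pE//; last exact: Hs_L2 Huw.
have I1 : L1 (fun x => u x * v x * p x) by apply: L1_mul_bounded pQ => //; exact: integrable_mul.
have I2 : L1 (fun x => w x * v x * p x) by apply: L1_mul_bounded pQ => //; exact: integrable_mul.
have -> : \int[mu]_x ((a *: u + w) x * v x * p x) =
    a * \int[mu]_x (u x * v x * p x) + \int[mu]_x (w x * v x * p x).
  rewrite -(RintegralZl a measurableT I1) -(RintegralD measurableT (L1Z a I1) I2).
  by apply: eq_Rintegral => x _; rewrite -[(_ + w) x]/(a * u x + w x); ring.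
by rewrite mulrDr; exact: addrACA.
Qed.

Lemma Btilde_ael u u' v : Hs s u -> Hs s u' -> u = u' %[ae mu] -> Hs s v -> B u v = B u' v.
Proof.
move=> Hu Hu' uu' Hv; have [p [Q [mp Q0 pQ pE]]] := potential_bounded mOm q_Linfty.
have Lu := Hs_L2 s01 Hu; have Lu' := Hs_L2 s01 Hu'; have Lv := Hs_L2 s01 Hv.
rewrite /Btilde (form_ael _ _ Lu Lu' uu'); congr (_ + _); rewrite !pE//; apply: Rintegral_ae.
- by apply: measurable_funM => //; apply: measurable_funM (L2on_measurable Lu) (L2on_measurable Lv).
- by apply: measurable_funM => //; apply: measurable_funM (L2on_measurable Lu') (L2on_measurable Lv).
by apply: filterS uu' => x + _ => /(_ Logic.I) ->.
Qed.

(** Frees [Bform] from its choice of an extension: the nonlocal part by domain of dependence, the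
    potential because [Om] lies in [D]. *)
Lemma Btilde_extension u1 u2 phi : Hs s u1 -> Hs s u2 -> u1 = u2 %[ae mu in D] ->
  H phi -> B u1 phi = B u2 phi.
Proof.
move=> H1 H2 u12 Hphi; have Hp := Htilde_Hs Hphi.
have e1 : form_L L u1 phi = form_L L u2 phi.
  apply/eqP; rewrite -subr_eq0; apply/eqP.
  rewrite -(linear_onB (linear_onl symbilinear_L Hp) H1 H2).
  apply: (L_dependence (subspaceB sH H1 H2) _ Hphi).
  apply: filterS u12 => x xD /xD e.
  by rewrite -[LHS]/(u1 x - u2 x) e subrr.
rewrite /Btilde e1; apply: f_equal.
apply: (potential_ae mOm (Linfty_bounded q_Linfty).1 (L2on_measurable (Hs_L2 s01 H1))
  (L2on_measurable (Hs_L2 s01 H2)) (L2on_measurable (Hs_L2 s01 Hp))).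
by apply: filterS u12 => x xD /OmD; exact: xD.
Qed.

Lemma Cc_W_Om0 f x : Cc_infty W f -> Om x -> f x = 0.
Proof.
move=> Cf xOm; apply: (Cc_outside Cf) => /W_sub[+ _]; apply; exact: subset_closure.
Qed.

(** As f is supported in [W], outside [Om], it extends its own datum, and u - f on [D] agrees almost
    everywhere with u on [Om]. So u is extended by f plus an element of Htilde; in the equation for
    u, the potential does not see f and only - <L f, phi> remains. *)
Lemma weak_solution_restrict f u : Cc_infty W f -> weak_solution s C Om L q f u ->
  H (u \_ Om) /\ forall phi, H phi -> B (u \_ Om) phi = - form_L L f phi.
Proof.
move=> Cf [[mu_ extu] Bu Hu]; have Hf := Cc_sub_Hs s01 Cf.
have Hh : H ((u \- f) \_ D).
  by apply: Hu; [exact: Hs_self|exact: ae_eq_refl].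
have Hhs := Htilde_Hs Hh.
have mg : measurable_fun setT (u \_ Om).
  by apply: measurable_fun_restrict => //; exact: measurable_funS mu_.
have hg : (u \- f) \_ D = u \_ Om %[ae mu].
  apply: filterS (Htilde_outside s01 mOm Hh) => x h0 _.
  have [xOm|xOm] := pselect (Om x); last by rewrite h0// patchE memNset.
  rewrite !patchE mem_set ?mem_set//; last exact: OmD.
  by rewrite /= (Cc_W_Om0 Cf xOm) subr0.
have Hg : H (u \_ Om) by exact: Htilde_ae mg hg Hh.
split => // phi Hphi; have Hp := Htilde_Hs Hphi; have Hgs := Htilde_Hs Hg.
have ext : Hs_ext s D u (f + (u \- f) \_ D).
  split; first exact: (subspaceD sH Hf Hhs).
  apply: nearW => x xD; rewrite -[LHS]/(f x + ((u \- f) \_ D) x) patchE mem_set//=.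
  by rewrite addrC subrK.
have [Hget getE] : Hs_ext s D u (get (Hs_ext s D u)) by exact: getPex.
have eB : B (get (Hs_ext s D u)) phi = B (f + (u \- f) \_ D) phi.
  apply: (Btilde_extension Hget ext.1 _ Hphi).
  by apply: filterS2 getE ext.2 => x h1 h2 xD; rewrite (h1 xD) (h2 xD).
have := Bu phi Hphi; rewrite /Bform eB.
rewrite (linear_onD (linear_onl symbilinear_Btilde Hp))//.
rewrite (Btilde_ael Hhs Hgs hg Hp) {1}/Btilde.
have -> : \int[mu]_(x in Om) (q x * f x * phi x) = 0.
  rewrite (_ : 0 = \int[mu]_(x in Om) (cst 0 x : R)); last by rewrite /Rintegral integral0.
  apply: eq_Rintegral => x /set_mem xOm.
  by rewrite (Cc_W_Om0 Cf xOm) mulr0 mul0r.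
by rewrite addr0 addrC => /eqP; rewrite addr_eq0 => /eqP.
Qed.

(* The condition on all extensions ft of the datum 0 is not automatic for an
   irregular Om: it follows from the existence of some weak solution u0, by
   subtracting the conditions on u0 for the extensions 0 and ft.  *)
Lemma homogeneous_solution w : H w -> (forall phi, H phi -> B w phi = 0) ->
  weak_solution s C Om L q 0 w.
Proof.
move=> Hw Bw; have Hws := Htilde_Hs Hw.
have [ex _ _] := Dirichlet_well_posed.
have H0s : Hs s (0 : V -> R) := sH.1.
have [u0 [[mu0 _] _ Hu0]] := ex _ (Hs_self (ext_dom C Om) s01 H0s).
have [mw ew] := Hs_self D s01 Hws.
split; first exact: (conj mw ew).
  move=> v Hv; rewrite /Bform -(Bw v Hv).
  have [Hget getE] : Hs_ext s D w (get (Hs_ext s D w)) by exact: getPex.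
  exact: (Btilde_extension Hget Hws getE Hv).
move=> ft Hft ft0.
have h1 := Hu0 _ (Hs_self D s01 H0s) (ae_eq_refl _ _ _).
have h2 := Hu0 _ Hft ft0.
have h3 : H (w + ((u0 \- ft) \_ D - (u0 \- 0) \_ D)).
  exact: (subspaceD sHt Hw (subspaceB sHt h2 h1)).
apply: Htilde_ae h3 => //.
  apply: measurable_fun_restrict => //; apply: measurable_funB => //.
  by case: Hft.
apply: filterS (Htilde_outside s01 mOm Hw) => x w0 _.
rewrite -[LHS]/(w x + (((u0 \- ft) \_ D) x - ((u0 \- 0) \_ D) x)) !patchE.
case: ifPn => [_|/negP xD].
  by rewrite /= subr0 addrAC subrr sub0r.
rewrite subrr addr0 w0// => xOm; apply: xD; rewrite mem_set//; exact: OmD.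
Qed.

(** Uniqueness of weak solutions speaks of [D] only; outside [D], hence outside [Om], w vanishes as
    an element of Htilde. *)
Lemma homogeneous_unique w : H w -> (forall phi, H phi -> B w phi = 0) ->
  w = cst 0 %[ae mu].
Proof.
move=> Hw Bw; have [_ uniq _] := Dirichlet_well_posed.
have H0s : Hs s (0 : V -> R) := sH.1.
have sol0 : weak_solution s C Om L q 0 0.
  apply: homogeneous_solution; first exact: sHt.1.
  move=> phi Hphi; exact: (linear_on0 sH (linear_onl symbilinear_Btilde (Htilde_Hs Hphi))).
have := uniq _ _ _ (Hs_self (ext_dom C Om) s01 H0s) (homogeneous_solution Hw Bw) sol0.
move=> wD; apply: filterS2 wD (Htilde_outside s01 mOm Hw) => x h1 h2 _.
have [xD|xD] := pselect (D x); first exact: h1.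
by rewrite h2// => xOm; apply: xD; exact: OmD.
Qed.

Lemma Hs_form_ae_eq u v w : Hs s u -> Hs s v -> Hs s w -> u = v %[ae mu] ->
  Hs_form s u w = Hs_form s v w.
Proof.
by move=> Hu Hv Hw uv; exact: (form_ael _ _ (Hs_L2 s01 Hu) (Hs_L2 s01 Hv) uv).
Qed.

Lemma homogeneous_form0 w : H w -> (forall phi, H phi -> B w phi = 0) -> Hs_form s w w = 0.
Proof.
move=> Hw Bw; have Hws := Htilde_Hs Hw; have H0s : Hs s (0 : V -> R) := sH.1.
rewrite (Hs_form_ae_eq Hws H0s Hws (homogeneous_unique Hw Bw)).
exact: (linear_on0 sH (linear_onl (symbilinear_Hs n s01) Hws)).
Qed.

Lemma symbilinear_sub (S T : set (V -> R)) b : T `<=` S -> symbilinear_on S b -> symbilinear_on T b.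
Proof.
move=> TS [b1 b2]; split=> [x y Tx Ty|y Ty a x z Tx Tz]; first by apply: b1; exact: TS.
by apply: b2; exact: TS.
Qed.

Lemma Btilde_upper : exists M : R, forall u, Hs s u -> B u u <= M * Hs_form s u u.
Proof.
have [lam lam1 [mL _ bnd up]] := symbol_bound.
have [p [Q [mp Q0 pQ pE]]] := potential_bounded mOm q_Linfty.
have l0 : 0 < lam by exact: lt_le_trans lam1.
exists (lam + Q) => u Hu; have Lu := Hs_L2 s01 Hu.
rewrite /Btilde mulrDl; apply: lerD.
  have mW := @measurable_Hs_weight R n s.
  rewrite /Hs_form -form_scale; last exact: L1_Hs_form.
  apply: (form_le s01 (c := lam)) => //; first exact: measurable_funM.
    by move=> xi; rewrite ger0_norm// mulr_ge0 ?ltW// Hs_weight_gt0.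
  by move=> xi; apply: le_trans (ler_norm _) (bnd xi).
have Iu : L1 (fun x => u x * u x * p x) by apply: L1_mul_bounded pQ => //; exact: integrable_mul.
rewrite pE//; apply: (@le_trans _ _ (Q * dot u u)); last first.
  by apply: ler_wpM2l => //; exact: L2dot_le_Hs.
rewrite L2dotRE -RintegralZl//; last exact: integrable_mul.
apply: le_Rintegral => //; first exact: (L1Z Q (integrable_mul Lu Lu)).
move=> x _; rewrite mulrC; apply: ler_wpM2r; first by rewrite -expr2 sqr_ge0.
exact: le_trans (ler_norm _) (pQ x).
Qed.

(** Garding's inequality; the [lam] provided here is the inverse of the ellipticity constant. *)
Lemma Btilde_lower : exists2 lam : R, 0 < lam & exists2 Q : R, 0 <= Q &
  forall u, Hs s u -> lam * form_L (riesz_weight s) u u - Q * dot u u <= B u u.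
Proof.
have [lam lam1 [mL lo bnd _]] := symbol_bound.
have [p [Q [mp Q0 pQ pE]]] := potential_bounded mOm q_Linfty.
have l0 : 0 < lam by exact: lt_le_trans lam1.
exists lam^-1; first by rewrite invr_gt0.
exists Q => // u Hu; have Lu := Hs_L2 s01 Hu.
have mr := @measurable_riesz_weight R n s.
have rb (xi : V) : `|riesz_weight s xi| <= 1 * Hs_weight s xi.
  by rewrite mul1r ger0_norm ?riesz_weight_ge0 ?riesz_weight_le.
rewrite /Btilde; apply: lerD.
  rewrite -form_scale; last exact: (L1_form s01 mr rb Hu Hu).
  apply: (form_le s01 (c := lam)) => //; first exact: measurable_funM.
  move=> xi; rewrite normrM (ger0_norm (x := lam^-1)); last by rewrite invr_ge0 ltW.
  apply: ler_pM => //; rewrite ?invr_ge0 ?(ltW l0)//.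
    by apply: (le_trans _ lam1); rewrite invf_le1.
  by have := rb xi; rewrite mul1r.
have Iu : L1 (fun x => u x * u x * p x) by apply: L1_mul_bounded pQ => //; exact: integrable_mul.
rewrite pE// -mulNr L2dotRE -RintegralZl//; last exact: integrable_mul.
apply: le_Rintegral => //; first exact: (L1Z (- Q) (integrable_mul Lu Lu)).
move=> x _; rewrite mulrC; apply: ler_wpM2l; first by rewrite -expr2 sqr_ge0.
by have := pQ x; rewrite ler_norml => /andP[].
Qed.

Lemma Btilde_solvable l : linear_on H l -> bounded_on H (Hs_form s) l ->
  exists2 w, H w & forall phi, H phi -> B w phi = l phi.
Proof.
move=> ll lb; have [M BM] := Btilde_upper.
have [lam lam0 [Q Q0 Blo]] := Btilde_lower.
have [k Omk] := bounded_sub_eball Om_bounded.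
have Q1 : 0 < Q + 1 by rewrite ltr_wpDl.
(* With this eta, Q + 1 times the compactness estimate costs half of the leading term of
   [Btilde_lower]. Using Q + 1 in place of Q also leaves one [dot u u] to spare. *)
have [N [p [K [K0 HK]]]] := @compact_embedding R n s s01 k (lam / (2 * (Q + 1)))
  ltac:(by rewrite divr_gt0// mulr_gt0).
(* Real and imaginary parts of the transform at the N points of the net: 2N real functionals. *)
pose lj (j : 'I_(N + N)) (u : V -> R) : R := match fintype.split j with
  inl i => fre (trunc k u) (p i) | inr i => fim (trunc k u) (p i) end.
have ljE u : \sum_j lj j u ^+ 2 = \sum_j (fre (trunc k u) (p j) ^+ 2 + fim (trunc k u) (p j) ^+ 2).
  rewrite big_split_ord big_split/=; congr (_ + _); apply: eq_bigr => i _; rewrite /lj.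
    by rewrite (unsplitK (inl i)).
  by rewrite (unsplitK (inr i)).
have HL2 u : H u -> L2V u by move=> /Htilde_Hs; exact: Hs_L2.
(* Write E for the Riesz form of u. Adding the two estimates gives (lam/2) E + [dot u u] <= [B u u]
   + (Q + 1) K times the sum of squares. As the H^s form is at most 2 ([dot u u] + E), the
   coercivity constant is min(lam/2, 1) / 2. *)
apply: (@symmetric_fredholm _ _ H (Hs_form s) B (N + N) lj ((Q + 1) * K) (Num.min (lam / 2) 1 / 2) M).
- exact: hilbert_Htilde.
- exact: symbilinear_sub (@Htilde_Hs _ _ _ _) symbilinear_Btilde.
- by rewrite divr_gt0// lt_min ltr01 divr_gt0.
- by move=> u /Htilde_Hs; exact: BM.
- move=> j a u v /HL2 Lu /HL2 Lv; have tu := L1_trunc k Lu; have tv := L1_trunc k Lv.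
  by rewrite /lj; case: (fintype.split j) => i; rewrite trunc_linear ?fre_linear ?fim_linear.
- move=> j; exists (@fourier_const R n ^+ 2 * fine (mu (eball (k%:R : R)))) => u Hu.
  have Lu := HL2 u Hu; have Hus := Htilde_Hs Hu.
  have c0 : 0 <= @fourier_const R n ^+ 2 * fine (mu (eball (k%:R : R))).
    by rewrite mulr_ge0 ?sqr_ge0//; exact: vol_ge0.
  apply: le_trans (ler_wpM2l c0 (L2dot_le_Hs s01 Hus)).
  rewrite /lj; case: (fintype.split j) => i; first exact: fre_trunc_bounded.
  exact: fim_trunc_bounded.
- move=> u Hu; have Hus := Htilde_Hs Hu; have lo := Blo u Hus.
  have out : {ae mu, forall x, ~ eball k%:R x -> u x = 0}.
    apply: filterS (Htilde_outside s01 mOm Hu) => x x0 xk; apply: x0 => /Omk.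
    exact: xk.
  have emb := HK u Hus out; rewrite ljE.
  have up := Hs_form_le_riesz s01 Hus.
  have E0 : 0 <= form_L (riesz_weight s) u u.
    rewrite riesz_formE; apply: Rintegral_ge0 => xi _.
    by rewrite mulr_ge0 ?riesz_weight_ge0 ?fourier_sqr_ge0.
  have D0 := L2dot_ge0 mu u.
  have m1 : Num.min (lam / 2) 1 <= lam / 2 by rewrite ge_min lexx.
  have m2 : Num.min (lam / 2) 1 <= 1 by rewrite ge_min lexx orbT.
  have m0 : 0 <= Num.min (lam / 2) 1 by rewrite le_min ler01 divr_ge0// ltW.
  move: (Num.min _ _) m0 m1 m2 => m m0 m1 m2.
  have e2 : (Q + 1) * dot u u <= lam / 2 * form_L (riesz_weight s) u u +
      (Q + 1) * K * \sum_j (fre (trunc k u) (p j) ^+ 2 + fim (trunc k u) (p j) ^+ 2).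
    apply: le_trans (ler_wpM2l (ltW Q1) emb) _.
    rewrite mulrDr mulrA [X in _ + X]mulrA lerD2r.
    have -> : (Q + 1) * (lam / (2 * (Q + 1))) = lam / 2 by field; rewrite gt_eqF.
    by [].
  have e1 : m / 2 * Hs_form s u u <= m * dot u u + m * form_L (riesz_weight s) u u.
    have m20 : 0 <= m / 2 by rewrite divr_ge0.
    by apply: le_trans (ler_wpM2l m20 up) _; rewrite mulrA divfK// mulrDr.
  have e3 : m * dot u u <= 1 * dot u u by exact: ler_wpM2r.
  have e4 : m * form_L (riesz_weight s) u u <= lam / 2 * form_L (riesz_weight s) u u by exact: ler_wpM2r.
  rewrite mulrDl mul1r in e2; move: lo e1 e2 e3 e4; clear.
  move: ((Q + 1) * K * _) => X1.
  move: (m / 2 * Hs_form s u u) (m * dot u u) (m * form_L (riesz_weight s) u u) => X2 X3 X4.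
  by move: (dot u u) (form_L (riesz_weight s) u u) (B u u) => X5 X6 X7; lra.
- by move=> u Hu Bu; exact: homogeneous_form0.
- exact: ll.
- exact: lb.
Qed.

Lemma poissonP f : Cc_infty W f -> weak_solution s C Om L q f (poisson s C Om L q f).
Proof.
move=> Cf; have [ex _ _] := Dirichlet_well_posed.
by apply: getPex; apply: ex; apply: Hs_self => //; exact: Cc_sub_Hs Cf.
Qed.

Lemma Hs_form_le_norm z u : Hs s z -> Hs s u -> `|Hs_form s z u| <= Hs_norm s z * Hs_norm s u.
Proof.
move=> Hz Hu; rewrite !Hs_normE -(sqrtrM _ (Hs_form_ge0 s01 z)) -sqrtr_sqr.
apply: ler_wsqrtr; rewrite mulrC.
exact: (form_cauchy_schwarz sH (symbilinear_Hs n s01) (fun x _ => Hs_form_ge0 s01 x) Hz Hu).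
Qed.

Lemma runge_of_unique_continuation :
  (forall w (v : (V -> R) -> R), H w -> Hs_dual s Om v ->
     (forall phi, H phi -> B w phi = v phi) ->
     w = cst 0 %[ae lebesgue_rV n in ext_dom C Om] ->
     (forall phi, Cc_infty W phi -> form_L L w phi = 0) ->
     (forall phi, H phi -> v phi = 0) /\
     w = cst 0 %[ae lebesgue_rV n in cone_dom C Om]) ->
  H `<=` Hs_closure s [set (poisson s C Om L q f) \_ Om | f in Cc_infty W].
Proof.
move=> UC; rewrite Hs_closureE//.
have bH := symbilinear_Hs n s01; have hH := hilbert_Htilde s01 Om.
have [_ bHt b0 _] := hH.
(* The restricted Poisson solutions need not be closed under linear combinations, since [poisson]
   chooses a solution for each f. The linear equation that they satisfy defines a subspace instead,
   and [MR] shows by uniqueness that its elements agree almost everywhere with such restrictions. *)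
pose M : set (V -> R) := [set g | H g /\ exists2 f, Cc_infty W f &
  forall phi, H phi -> B g phi = - form_L L f phi].
have subM : subspace M.
  split.
    split; first exact: sHt.1.
    exists 0; first exact: (subspace_Cc W).1.
    move=> phi /Htilde_Hs Hp; rewrite (linear_on0 sH (linear_onl symbilinear_Btilde Hp)).
    by rewrite (linear_on0 sH (linear_onl symbilinear_L Hp)) oppr0.
  move=> a g1 g2 [Hg1 [f1 Cf1 E1]] [Hg2 [f2 Cf2 E2]]; split; first exact: sHt.2.
  exists (a *: f1 + f2); first exact: (subspace_Cc W).2.
  move=> phi Hphi; have Hp := Htilde_Hs Hphi.
  rewrite (linear_onl symbilinear_Btilde Hp a (Htilde_Hs Hg1) (Htilde_Hs Hg2)).
  rewrite (linear_onl symbilinear_L Hp a (Cc_sub_Hs s01 Cf1) (Cc_sub_Hs s01 Cf2)).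
  by rewrite E1// E2// opprD mulrN.
have MR g : M g -> exists2 g', [set (poisson s C Om L q f) \_ Om | f in Cc_infty W] g' &
    H g' /\ g = g' %[ae mu].
  move=> [Hg [f Cf Eg]]; have [Hg' Eg'] := weak_solution_restrict Cf (poissonP Cf).
  exists (poisson s C Om L q f \_ Om); first by exists f.
  split => //; have Hd : H (g - poisson s C Om L q f \_ Om) by exact: subspaceB.
  have : g - poisson s C Om L q f \_ Om = cst 0 %[ae mu].
    apply: homogeneous_unique => // phi Hphi; have Hp := Htilde_Hs Hphi.
    rewrite (linear_onB (linear_onl symbilinear_Btilde Hp) (Htilde_Hs Hg) (Htilde_Hs Hg')).
    by rewrite Eg// Eg'// subrr.
  by apply: filterS => x /[apply] /eqP; rewrite subr_eq0 => /eqP.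
have dense : H `<=` closure_in H (Hs_form s) M.
  apply: dense_of_orthogonal => //; first by move=> g [].
  move=> z Hz zM; have Hzs := Htilde_Hs Hz.
  have lz : linear_on H (Hs_form s z) by exact: linear_onr.
  have [w Hw wz] : exists2 w, H w & forall phi, H phi -> B w phi = Hs_form s z phi.
    apply: Btilde_solvable => //; exists (Hs_form s z z) => u Hu.
    by rewrite mulrC; exact: (form_cauchy_schwarz sHt bHt b0 Hz Hu).
  have Hws := Htilde_Hs Hw.
  have dz : Hs_dual s Om (Hs_form s z).
    split; first by move=> a u v Hu Hv; exact: lz.
    by exists (Hs_norm s z) => u /Htilde_Hs; exact: Hs_form_le_norm.
  (* Unique continuation is applied with the functional <z, .> as right-hand side; its vanishing at
     z itself is the claim. *)
  have [vz _] : (forall phi, H phi -> Hs_form s z phi = 0) /\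
      w = cst 0 %[ae lebesgue_rV n in cone_dom C Om].
    apply: UC => //.
      apply: filterS (Htilde_outside s01 mOm Hw) => x x0 [_ xOm]; apply: x0 => h.
      by apply: xOm; exact: subset_closure.
    move=> f Cf; have [Hg Eg] := weak_solution_restrict Cf (poissonP Cf).
    have Mg : M (poisson s C Om L q f \_ Om) by split => //; exists f.
    have := zM _ Mg; rewrite -wz// (symbilinear_Btilde.1 _ _ Hws (Htilde_Hs Hg)) Eg//.
    rewrite (symbilinear_L.1 _ _ (Cc_sub_Hs s01 Cf) Hws) => /eqP.
    by rewrite oppr_eq0 => /eqP.
  exact: vz.
move=> x Hx; split; first exact: Htilde_Hs Hx.
move=> e e0; have [_ /(_ e e0)[y [My Hy xy]]] := dense x Hx.
have [g' Rg' [Hg' yg']] := MR y My; exists g'.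
split; [exact: Rg'|exact: Htilde_Hs Hg'|].
have Hxy := Htilde_Hs (subspaceB sHt Hx Hy); have Hxg := Htilde_Hs (subspaceB sHt Hx Hg').
have eq : x - g' = x - y %[ae mu].
  by apply: filterS yg' => t + _ => /(_ Logic.I) E; rewrite -[LHS]/(x t - g' t) -E.
rewrite (Hs_form_ae_eq Hxg Hxy Hxg eq) (bH.1 _ _ Hxy Hxg).
by rewrite (Hs_form_ae_eq Hxg Hxy Hxy eq).
Qed.

Lemma unique_continuation_of_runge w (v : (V -> R) -> R) :
  H `<=` Hs_closure s [set (poisson s C Om L q f) \_ Om | f in Cc_infty W] ->
  H w -> Hs_dual s Om v -> (forall phi, H phi -> B w phi = v phi) ->
  (forall phi, Cc_infty W phi -> form_L L w phi = 0) ->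
  (forall phi, H phi -> v phi = 0) /\ w = cst 0 %[ae lebesgue_rV n in cone_dom C Om].
Proof.
move=> dense Hw [vlin [M vM]] wv wW; have Hws := Htilde_Hs Hw.
have v0 phi : H phi -> v phi = 0.
  move=> Hphi; have Hp := Htilde_Hs Hphi.
  have M0 : 0 <= `|M| + 1 by rewrite addr_ge0.
  apply: (@eq0_of_sqr_le _ _ ((`|M| + 1) ^+ 2)) => e e0.
  have := dense phi Hphi; rewrite (Hs_closureE s01) => -[_ /(_ e e0)[g [[f Cf fg] Hgs hg]]].
  have [Hg Eg] := weak_solution_restrict Cf (poissonP Cf); rewrite fg in Hg Eg.
  have vg : v g = 0.
    rewrite -wv// (symbilinear_Btilde.1 _ _ Hws Hgs) Eg//.
    by rewrite (symbilinear_L.1 _ _ (Cc_sub_Hs s01 Cf) Hws) wW// oppr0.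
  have Hd := subspaceB sHt Hphi Hg.
  have vd : v (phi - g) = v phi.
    have := vlin (-1) g phi Hg Hphi; rewrite vg mulr0 add0r => <-; congr v.
    by apply/funext => x; rewrite mulN1r addrC.
  rewrite -vd -real_normK ?num_real//.
  have := vM _ Hd; rewrite Hs_normE => h.
  apply: (@le_trans _ _ (((`|M| + 1) * Num.sqrt (Hs_form s (phi - g) (phi - g))) ^+ 2)).
    rewrite lerXn2r ?nnegrE ?mulr_ge0 ?sqrtr_ge0//; apply: le_trans h _.
    by apply: ler_wpM2r; [exact: sqrtr_ge0|apply: le_trans (ler_norm M) _; rewrite lerDl].
  rewrite exprMn sqr_sqrtr ?Hs_form_ge0//; apply: ler_wpM2l; first exact: sqr_ge0.
  exact: ltW.
split => //.
have : w = cst 0 %[ae mu] by apply: homogeneous_unique => // phi Hphi; rewrite wv// v0.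
by apply: filterS => x h _; exact: h.
Qed.

End exterior_problem.
End dirichlet.

Theorem theorem1 (R : realType) (n : nat) (s : R)
    (C Om W : set 'rV[R]_n) (L q : 'rV[R]_n -> R)
    (hs : 0 < s < 1)
    (C_open : open C) (C_nonempty : C !=set0) (C_convex : convex_set C)
    (C_cone : is_cone C) (C_ne0 : ~ C 0)
    (Om_open : open Om) (Om_nonempty : Om !=set0) (Om_bounded : bounded_set Om)
    (W_open : open W) (W_sub : W `<=` ~` closure Om `&` cone_dom C Om)
    (q_Linfty : q \_ Om \in Lfun (lebesgue_rV n) +oo%E)
    (L_elliptic : elliptic_symbol s L)
    (L_dependence : domain_of_dependence s C Om L)
    (Dirichlet_well_posed : well_posed s C Om L q) :
  (Htilde s Om `<=`
     Hs_closure s [set (poisson s C Om L q f) \_ Om | f in Cc_infty W])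
  <->
  (forall w v, Htilde s Om w -> Hs_dual s Om v ->
     (forall phi, Htilde s Om phi -> Btilde Om L q w phi = v phi) ->
     w = cst 0 %[ae lebesgue_rV n in ext_dom C Om] ->
     (forall phi, Cc_infty W phi -> form_L L w phi = 0) ->
     (forall phi, Htilde s Om phi -> v phi = 0) /\
     w = cst 0 %[ae lebesgue_rV n in cone_dom C Om]).
Proof.
split=> [dense w v Hw Hv wv _ wW|]; last exact: runge_of_unique_continuation.
exact: (unique_continuation_of_runge hs C_nonempty C_cone Om_open W_sub q_Linfty
  L_elliptic L_dependence Dirichlet_well_posed dense Hw Hv wv wW).
Qed.
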